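(* Let $g$ be real-valued and of bounded variation on the torus $\mathbb{R}/\mathbb{Z}$ with at least one jump, with jumps $\{J_{j}\}$. Let $u(x,t)=\sum_{n\in\mathbb{Z}}\hat g(n)e^{2\pi i(nx-n^{2}t)}$, $w=|u|^{2}$, and $Y_{M}(t)=\sum_{m=1}^{M}m\,|\hat w(m,t)|^{2}$. Then, with mean and variance taken over a period in time ($t$ uniform on $[0,1]$), as $M\to\infty$, $$\mathbb{E}_{t}\,Y_{M}=\big(\kappa_{g}+o(1)\big)\log M,\qquad\operatorname{Var}_{t}(Y_{M})=O(\log M),\qquad\kappa_{g}=\frac{\|g\|_{L^{2}}^{2}\,\sum_{j}|J_{j}|^{2}}{2\pi^{2}},$$ and consequently, for almost every $t$, $$\frac{Y_{M}(t)}{\log M}\longrightarrow\kappa_{g}\qquad(M\to\infty);$$ at almost every time the density $w(\cdot,t)$ lies outside $H^{1/2}$, its critical mass diverging at the universal logarithmic rate $\kappa_{g}$. Moreover, for almost every $t$ the density $w(\cdot,t)$ lies in $C^{1/2-\varepsilon}$ for every $\varepsilon>0$, in no Besov space $B^{\sigma}_{1,\infty}$ with $\sigma>\tfrac12$, and its graph has upper box dimension exactly $\tfrac32$.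
   Context: $\hat g(n)=\int_{0}^{1}g(x)e^{-2\pi inx}\,dx$, and $\hat w(m,t)$ is the $m$-th Fourier coefficient of $w(\cdot,t)$ in $x$. $u$ is the free Schrödinger evolution of $g$ on the torus, $1$-periodic in $t$. The jumps $J_{j}$ are the (at most countably many) nonzero differences $g(x_{j}^{+})-g(x_{j}^{-})$ at the discontinuity points of $g$ on the torus. All function spaces are on $\mathbb{R}/\mathbb{Z}$. *)

(* Defs.v *)
From HB Require Import structures.
From mathcomp Require Import all_boot all_order all_algebra.
From mathcomp Require Import all_classical all_reals all_analysis.
From mathcomp Require Import complex.

Set Implicit Arguments.
Unset Strict Implicit.
Unset Printing Implicit Defensive.

Import Order.TTheory GRing.Theory Num.Theory.
Import numFieldNormedType.Exports.

Local Open Scope classical_set_scope.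
Local Open Scope ring_scope.
Local Open Scope complex_scope.

(* Functions on the torus R/Z are functions on R that are periodic of period 1;
   the integral over the torus is the Lebesgue integral over [0, 1]. *)

Section torus_fourier.
Variable R : realType.
Local Notation mu := (@lebesgue_measure R).

Definition e2pi (theta : R) : R[i] :=
  cos (2 * pi * theta) +i* sin (2 * pi * theta).

Definition torus_cintegral (f : R -> R[i]) : R[i] :=
  (\int[mu]_(x in `[0, 1]) complex.Re (f x)) +i*
  (\int[mu]_(x in `[0, 1]) complex.Im (f x)).

Definition fourier_coef (f : R -> R) (n : int) : R[i] :=
  torus_cintegral (fun x => (f x)%:C * e2pi (- (n%:~R * x))).

(* The index k runs over 0, ..., 2N, so that n = k - N runs over -N, ..., N. *)
Definition schrodinger_partial_sum (g : R -> R) (N : nat) (x t : R) : R[i] :=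
  \sum_(k < N.*2.+1) let n := k%:Z - N%:Z in
    fourier_coef g n * e2pi (n%:~R * x - n%:~R ^+ 2 * t).

(* For g in L^2 the series defining the evolution converges in L^2 in the space
   variable at each time, so u(., t) is determined up to a null set. *)
Definition schrodinger_evolution (g : R -> R) (u : R -> R -> R[i]) : Prop :=
  forall t : R,
    [/\ periodic (u ^~ t) 1,
        measurable_fun `[(0 : R), 1] (fun x => complex.Re (u x t)),
        measurable_fun `[(0 : R), 1] (fun x => complex.Im (u x t)) &
        (\int[mu]_(x in `[0%R, 1%R])
           ((Normc.normc (u x t - schrodinger_partial_sum g N x t)) ^+ 2)%:E)%E
        @[N --> \oo] --> 0%E].

Definition density (u : R -> R -> R[i]) (t x : R) : R :=
  Normc.normc (u x t) ^+ 2.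

Definition critical_mass (u : R -> R -> R[i]) (M : nat) (t : R) : R :=
  \sum_(1 <= m < M.+1)
    m%:R * Normc.normc (fourier_coef (density u t) m%:Z) ^+ 2.

End torus_fourier.

Section jumps.
Variable R : realType.
Local Notation mu := (@lebesgue_measure R).

Definition jump (g : R -> R) (x : R) : R := lim (g @ x^'+) - lim (g @ x^'-).

Definition jump_points (g : R -> R) : set R :=
  [set x | 0 <= x < 1 /\ jump g x != 0].

Definition kappa (g : R -> R) : R :=
  (\int[mu]_(x in `[0, 1]) (g x) ^+ 2)
  * fine (\esum_(x in jump_points g) ((`|jump g x| ^+ 2)%:E))
  / (2 * pi ^+ 2).

End jumps.

Section function_spaces.
Variable R : realType.
Local Notation mu := (@lebesgue_measure R).

(* Integrability makes the Fourier coefficients meaningful; for s >= 0 the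
   finiteness of the sum then forces f to be in L^2. *)
Definition in_sobolev (s : R) (f : R -> R) : Prop :=
  mu.-integrable `[0, 1] (EFin \o f) /\
  (\esum_(m in [set: int])
     ((1 + m%:~R ^+ 2) `^ s * Normc.normc (fourier_coef f m) ^+ 2)%:E < +oo)%E.

(* For a periodic f, a bound over all x, y in R is the same as a bound in terms
   of the distance on the torus, and f is then automatically bounded. *)
Definition in_hoelder (alpha : R) (f : R -> R) : Prop :=
  periodic f 1 /\
  exists C : R, forall x y, `|f x - f y| <= C * `|x - y| `^ alpha.

Definition iter_difference (r : nat) (h : R) (f : R -> R) (x : R) : R :=
  \sum_(k < r.+1) (-1) ^+ (r - k) * 'C(r, k)%:R * f (x + k%:R * h).

(* The Besov space B^sigma_{1,oo} (sigma > 0), defined by the L^1 modulus of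
   smoothness of order r, the least integer r > sigma. *)
Definition in_besov_1oo (sigma : R) (f : R -> R) : Prop :=
  let r := (Num.truncn sigma).+1 in
  [/\ periodic f 1, mu.-integrable `[0, 1] (EFin \o f) &
      exists C : R, forall h : R,
        (\int[mu]_(x in `[0%R, 1%R]) (`|iter_difference r h f x|)%:E
         <= (C * `|h| `^ sigma)%:E)%E].

End function_spaces.

Section box_dimension.
Variable R : realType.

(* Least number of balls of radius d that cover A (+oo if there is no finite
   cover). *)
Definition covering_number (T : pseudoMetricType R) (A : set T) (d : R)
    : \bar R :=
  ereal_inf [set (n%:R)%:E | n in
    [set n : nat | exists c : 'I_n -> T, A `<=` \bigcup_i ball (c i) d]].

Definition upper_box_dim (T : pseudoMetricType R) (A : set T) : \bar R :=
  limf_esup (fun d : R => lne (covering_number A d) * ((ln d^-1)^-1)%:E)%E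
            (0^'+).

(* The balls of R * R are those of the sup distance; replacing it by the
   Euclidean distance does not change the box dimension. *)
Definition torus_graph (f : R -> R) : set (R * R) :=
  [set (x, f x) | x in `[0, 1]].

End box_dimension.

(* Main.v *)
From HB Require Import structures.
From mathcomp Require Import all_boot all_order all_algebra.
From mathcomp Require Import all_classical all_reals all_analysis.
From mathcomp Require Import complex ring lra zify measurable_realfun.
Require Import Defs.

(** Write [a n] for the Fourier coefficients of [g] and [b n] for their squared
    moduli. Bounded variation gives [a n = O(1 / |n|)].

    _Growth of the critical mass._ The coefficient of index [m] of the density is
    the sum over [p] of [a (p + m)] times the conjugate of [a p], with the phase
    [e2pi (- (2 p + m) m t)]. Its squared modulus, multiplied by [m] and summed
    over [m <= M], splits into a part independent of [t] and a fluctuation that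
    consists of the frequencies [2 m q] with [m, q >= 1] ([truncated_massE]).

    The constant part is symmetrized by splitting the factor [m] as
    [(p + m) + (- p)]: up to [O(1)] it equals [2 |g|^2] times the sum of [m * b m]
    over [m <= M] ([truncated_mean_sym], [truncated_mean_approx]), where [|g|^2]
    is the square of the [L^2] norm. This last sum is computed from the jumps. The
    mean square of [g x - g (x - h)] is [h] times the sum of the squared jumps, up
    to [o(h)] ([sqr_modulus_cvg]); by Parseval it is also the sum of
    [b n * |1 - e2pi (n h)|^2]. Averaging over [h = k / N] against the inverse
    square kernel [|1 - e2pi h|^-2] turns the weight of [b n] into
    [|n| (N - |n|)], so that the sum of [m * b m] is asymptotic to [ln M] times the
    sum of the squared jumps divided by [4 pi^2] ([log_average_coefficients]).

    The mean square of the fluctuation only involves pairs of terms with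
    [m q = m' q']. The decay of [a n] bounds the amplitudes, and on a hyperbola
    [m q = l] each of [m], [q] and [m - q] determines the pair; this gives a
    variance bounded in [M] ([hyperbola_energy]). Along [M = 2 ^ k] the squared
    deviations divided by [(k + 1)^2] are then summable in mean, so that they tend
    to zero for almost every [t]; since the critical mass is nondecreasing in
    [M], the almost everywhere limit follows ([ae_critical_mass_log_asymp]).

    _Regularity._ Weyl differencing bounds a quadratic exponential sum over a
    dyadic block by geometric sums, which are dominated by Fejér kernels of
    explicit mean; hence for almost every [t] all such sums, even with monotone
    weights, have square root cancellation up to powers of the logarithm
    ([ae_weyl_regular]). Since [g x] has increments [O(h)] in [L^1], duality turns
    this into a uniform bound [O(k^2 2^(-k/2))] for the dyadic block [k] of the
    evolution and [O(k^2 2^(k/2) |h|)] for its increments ([dyadic_block_sup],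
    [dyadic_block_increment]). Interpolating and summing over [k] shows that the
    density has a version in every Hölder class of exponent less than [1/2]
    ([density_hoelder_version]).

    _Optimality._ The critical mass of the density is half of the square of its
    homogeneous [H^(1/2)] seminorm, truncated at [M]; it diverges because the
    rate is positive. If the density had differences [O(h^sigma)] in [L^1] with
    [sigma > 1/2], then together with a Hölder exponent close to [1/2] their mean
    square would be [O(h^(1 + e))] with [e > 0], and the mass would be bounded
    ([half_mass_bounded]). This excludes the Besov spaces. It also gives the
    lower bound [3/2] for the box dimension, since a covering of the graph by
    [n] balls of radius [d] bounds the mean modulus of the increments over [d] by
    [O(n d^2 + d)] ([upper_box_dim_graph_ge]); the upper bound [3/2] follows from
    Hölder continuity ([upper_box_dim_graph_le]). *)

Set Implicit Arguments.
Unset Strict Implicit.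
Unset Printing Implicit Defensive.

Import Order.TTheory GRing.Theory Num.Theory.
Import numFieldNormedType.Exports.

Local Open Scope classical_set_scope.
Local Open Scope ring_scope.

(** * Bounded measurable functions on the torus *)

Section bounded_measurable.
Variable R : realType.
Implicit Types (f g : R -> R) (h c : R).
Local Notation mu := (@lebesgue_measure R).

Definition bounded_mfun f : Prop :=
  measurable_fun [set: R] f /\ exists C : R, forall x, `|f x| <= C.

Definition torus_integral f : R := \int[mu]_(x in `[0, 1]) f x.

Lemma bounded_mfun_cst c : bounded_mfun (fun=> c).
Proof. by split; [exact: measurable_cst | exists `|c|]. Qed.

Lemma bounded_mfunD f g : bounded_mfun f -> bounded_mfun g ->
  bounded_mfun (fun x => f x + g x).
Proof.
move=> [mf [C fC]] [mg [D gD]]; split; first exact: measurable_funD.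
by exists (C + D) => x; rewrite (le_trans (ler_normD _ _))// lerD.
Qed.

Lemma bounded_mfunN f : bounded_mfun f -> bounded_mfun (fun x => - f x).
Proof.
move=> [mf [C fC]]; split; first exact: measurable_funN.
by exists C => x; rewrite normrN.
Qed.

Lemma bounded_mfunB f g : bounded_mfun f -> bounded_mfun g ->
  bounded_mfun (fun x => f x - g x).
Proof. by move=> bf bg; apply: bounded_mfunD => //; exact: bounded_mfunN. Qed.

Lemma bounded_mfunM f g : bounded_mfun f -> bounded_mfun g ->
  bounded_mfun (fun x => f x * g x).
Proof.
move=> [mf [C fC]] [mg [D gD]]; split; first exact: measurable_funM.
by exists (C * D) => x; rewrite normrM ler_pM.
Qed.

Lemma bounded_mfunZ c f : bounded_mfun f -> bounded_mfun (fun x => c * f x).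
Proof. by move=> bf; apply: bounded_mfunM => //; exact: bounded_mfun_cst. Qed.

Lemma bounded_mfunX n f : bounded_mfun f -> bounded_mfun (fun x => f x ^+ n).
Proof.
move=> bf; elim: n => [|n IHn].
  by under eq_fun do rewrite expr0; exact: bounded_mfun_cst.
by under eq_fun do rewrite exprS; exact: bounded_mfunM.
Qed.

Lemma bounded_mfun_norm f : bounded_mfun f -> bounded_mfun (fun x => `|f x|).
Proof.
move=> [mf [C fC]]; split; first exact: measurableT_comp.
by exists C => x; rewrite normr_id.
Qed.

Lemma bounded_mfun_sum (J : Type) (r : seq J) (P : pred J) (F : J -> R -> R) :
  (forall i, bounded_mfun (F i)) ->
  bounded_mfun (fun x => \sum_(i <- r | P i) F i x).
Proof.
move=> bF; elim: r => [|i r IHr].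
  by under eq_fun do rewrite big_nil; exact: bounded_mfun_cst.
under eq_fun do rewrite big_cons.
by case: (P i) => //; exact: bounded_mfunD.
Qed.

Lemma bounded_mfun_comp f (phi : R -> R) : measurable_fun [set: R] phi ->
  bounded_mfun f -> bounded_mfun (f \o phi).
Proof.
move=> mphi [mf [C fC]]; split; first exact: measurableT_comp.
by exists C => x /=.
Qed.

Lemma bounded_mfun_shift h f : bounded_mfun f -> bounded_mfun (fun x => f (x + h)).
Proof.
move=> bf; apply: (@bounded_mfun_comp f (fun x => x + h)) => //.
exact: measurable_funD.
Qed.

Lemma bounded_mfun_integrable f (a b : R) : bounded_mfun f ->
  mu.-integrable `[a, b] (EFin \o f).
Proof.
move=> [mf [C fC]]; apply: measurable_bounded_integrable => //.
- by rewrite /= lebesgue_measure_itv/=; case: ifPn => _; rewrite ?ltry.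
- exact: measurable_funS mf.
- exists C; split; first exact: num_real.
  by move=> M CM x /= _; rewrite (le_trans (fC x))// ltW.
Qed.

Lemma bounded_mfun_uniform f : bounded_mfun f ->
  (uniform_prob (@ltr01 R)).-integrable setT (EFin \o f).
Proof.
move=> [mf [C fC]]; apply: measurable_bounded_integrable => //.
  by rewrite -ge0_fin_numE ?fin_num_measure.
exists C; split; first exact: num_real.
by move=> M CM x /= _; rewrite (le_trans (fC x))// ltW.
Qed.

Local Notation I01 := (bounded_mfun_integrable 0 1).

Lemma torus_integralD f g : bounded_mfun f -> bounded_mfun g ->
  torus_integral (fun x => f x + g x) = torus_integral f + torus_integral g.
Proof. by move=> bf bg; rewrite /torus_integral RintegralD//; exact: I01. Qed.

Lemma torus_integralB f g : bounded_mfun f -> bounded_mfun g ->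
  torus_integral (fun x => f x - g x) = torus_integral f - torus_integral g.
Proof. by move=> bf bg; rewrite /torus_integral RintegralB//; exact: I01. Qed.

Lemma torus_integralZ c f : bounded_mfun f ->
  torus_integral (fun x => c * f x) = c * torus_integral f.
Proof. by move=> bf; rewrite /torus_integral RintegralZl//; exact: I01. Qed.

Lemma torus_integralN f : bounded_mfun f ->
  torus_integral (fun x => - f x) = - torus_integral f.
Proof.
move=> bf; under eq_fun do rewrite -mulN1r.
by rewrite torus_integralZ// mulN1r.
Qed.

Lemma torus_integral_cst c : torus_integral (fun=> c) = c.
Proof.
rewrite /torus_integral Rintegral_cst//= lebesgue_measure_itv/= lte01 sube0/=.
by rewrite mulr1.
Qed.

Lemma torus_integral_sum (J : Type) (r : seq J) (P : pred J) (F : J -> R -> R) :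
  (forall i, bounded_mfun (F i)) ->
  torus_integral (fun x => \sum_(i <- r | P i) F i x) =
  \sum_(i <- r | P i) torus_integral (F i).
Proof.
move=> bF; elim: r => [|i r IHr].
  by under eq_fun do rewrite big_nil; rewrite big_nil torus_integral_cst.
under eq_fun do rewrite big_cons.
rewrite big_cons; case: (P i) => //.
by rewrite torus_integralD ?IHr//; exact: bounded_mfun_sum.
Qed.

Lemma eq_torus_integral f g : (forall x, 0 <= x <= 1 -> f x = g x) ->
  torus_integral f = torus_integral g.
Proof.
move=> fg; apply: eq_Rintegral => x; rewrite inE/= in_itv/=; exact: fg.
Qed.

Lemma torus_integral_ge0 f : (forall x, 0 <= f x) -> 0 <= torus_integral f.
Proof. by move=> f0; apply: Rintegral_ge0 => x _. Qed.

Lemma le_torus_integral f g : bounded_mfun f -> bounded_mfun g ->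
  (forall x, 0 <= x <= 1 -> f x <= g x) -> torus_integral f <= torus_integral g.
Proof.
move=> bf bg fg; apply: le_Rintegral; rewrite //=; try exact: I01.
Qed.

Lemma le_norm_torus_integral f : bounded_mfun f ->
  `|torus_integral f| <= torus_integral (fun x => `|f x|).
Proof. by move=> bf; apply: le_normr_Rintegral => //; exact: I01. Qed.

Lemma torus_integralE f : bounded_mfun f ->
  (\int[mu]_(x in `[0%R, 1%R]) (f x)%:E = (torus_integral f)%:E)%E.
Proof.
move=> bf; rewrite /torus_integral /Rintegral fineK//.
by apply: integrable_fin_num => //; exact: I01.
Qed.

Lemma ae_le_torus_integral f g : bounded_mfun f -> bounded_mfun g ->
  {ae mu, forall x, 0 <= x <= 1 -> f x <= g x} ->
  torus_integral f <= torus_integral g.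
Proof.
move=> bf bg fg.
pose k x := Num.max (f x) (g x).
have bk : bounded_mfun k.
  case: bf bg => [mf [C fC]] [mg [D gD]]; split; first exact: measurable_maxr.
  exists (Num.max C D) => x; rewrite /k; case: (leP (f x) (g x)) => _.
    by rewrite le_max gD orbT.
  by rewrite le_max fC.
apply: (@le_trans _ _ (torus_integral k)).
  by apply: le_torus_integral => // x _; rewrite /k le_max lexx.
rewrite -lee_fin -!torus_integralE// le_eqVlt; apply/orP; left; apply/eqP.
apply: ae_eq_integral => //.
- by apply/measurable_EFinP; exact: measurable_funS bk.1.
- by apply/measurable_EFinP; exact: measurable_funS bg.1.
- move: fg; apply: (@filterS _ _ (ae_filter_ringOfSetsType _)) => x fg; rewrite /= in_itv/= => x01.
  by rewrite /k; congr EFin; apply/max_r/fg.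
Qed.

Lemma lebesgue_measure_shift h (A : set R) : measurable A ->
  pushforward mu ((fun x => x + h) : _ -> measurableTypeR R) A = mu A.
Proof.
move=> mA.
have mh : measurable_fun [set: R] ((fun x => x + h) : R -> measurableTypeR R).
  exact: measurable_funD.
pose nu := pushforward mu ((fun x => x + h) : _ -> measurableTypeR R).
pose m := isMeasurableFun.Build _ _ _ _ _ mh.
pose F : {mfun _ >-> _} := HB.pack (fun x : R => (x + h) : measurableTypeR R) m.
apply/esym/(@lebesgue_measure_unique R (pushforward mu F)) => //= _ [[a b]] _ <-.
rewrite /pushforward/=.
have -> : F @^-1` `]a, b]%classic = `]a - h, b - h]%classic.
  by apply/seteqP; split => x /=; rewrite !in_itv/= -lerBrDr -ltrBlDr.
rewrite !lebesgue_measure_itv/= !lte_fin ltrD2r -EFinB.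
by case: ifPn => // _; rewrite -!EFinB; congr EFin; ring.
Qed.

Lemma Rintegral_shift f h (a b : R) : bounded_mfun f ->
  \int[mu]_(x in `[a, b]) f (x + h) = \int[mu]_(x in `[a + h, b + h]) f x.
Proof.
move=> bf; rewrite /Rintegral; congr fine.
have mh : measurable_fun [set: measurableTypeR R]
    ((fun x => x + h) : measurableTypeR R -> measurableTypeR R).
  exact: measurable_funD.
have -> : `[a, b]%classic = (fun x => x + h) @^-1` `[a + h, b + h].
  by apply/seteqP; split => x /=; rewrite !in_itv/= !lerD2r.
rewrite -[LHS](@integral_pushforward _ _ _ _ _ _ mh mu `[a + h, b + h] (EFin \o f)) //=.
- apply: eq_measure_integral => A mA _; exact: lebesgue_measure_shift.
- by apply/measurable_EFinP; exact: bf.1.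
- have -> : (fun x => x + h) @^-1` `[a + h, b + h] = `[a, b]%classic.
    by apply/seteqP; split => x /=; rewrite !in_itv/= !lerD2r.
  exact: (@bounded_mfun_integrable (fun x => f (x + h)) a b (bounded_mfun_shift h bf)).
Qed.

Lemma periodic_int f (n : int) x : periodic f 1 -> f (x + n%:~R) = f x.
Proof.
move=> pf; case: n => n; first by rewrite -pmulrn; exact: periodicn.
by rewrite NegzE mulrNz -pmulrn -[LHS](@periodicn _ _ f 1 pf n.+1) addrNK.
Qed.

Lemma torus_integral_shift h f : bounded_mfun f -> periodic f 1 ->
  torus_integral (fun x => f (x + h)) = torus_integral f.
Proof.
move=> bf pf.
wlog h01 : h / 0 <= h < 1.
  move=> H; rewrite -(H (h - (Num.floor h)%:~R)).
    apply: eq_torus_integral => x _.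
    by rewrite -[RHS](periodic_int (Num.floor h) _ pf) addrA subrK.
  have /andP[h1 h2] := floor_itv h.
  by rewrite subr_ge0 h1/= ltrBlDl -[1]/(1%:~R) -intrD.
case/andP: h01 => h0 /ltW h1.
rewrite /torus_integral Rintegral_shift// add0r.
have E (a b c : R) : a <= b -> b <= c -> \int[mu]_(x in `[a, c]) f x =
    \int[mu]_(x in `[a, b]) f x + \int[mu]_(x in `[b, c]) f x.
  move=> ab bc; rewrite -[X in _ + X]Rintegral_itv_obnd_cbnd; last first.
    apply: (integrableS _ _ _ (@bounded_mfun_integrable f b c bf)) => //.
    exact: subset_itv_oc_cc.
  by rewrite -(@Rintegral_itvB _ _ (BLeft a) (BRight c) b) 1?addrCA ?subrr ?addr0//;
    exact: bounded_mfun_integrable.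
rewrite (E h 1 (1 + h))// ?lerDl//.
rewrite (E 0 h 1)// addrC; congr (_ + _).
rewrite [in LHS]addrC -[X in `[X, _]](add0r 1) -Rintegral_shift//.
by apply: eq_Rintegral => x _; rewrite pf.
Qed.

Lemma cvg_torus_integral (F : nat -> R -> R) f C :
  (forall n, measurable_fun [set: R] (F n)) -> (forall n x, `|F n x| <= C) ->
  (forall x, F n x @[n --> \oo] --> f x) ->
  bounded_mfun f /\ torus_integral (F n) @[n --> \oo] --> torus_integral f.
Proof.
move=> mF FC Ff.
have mf : measurable_fun [set: R] f.
  by apply: (measurable_fun_cvg mF) => x _; exact: Ff.
have bf : bounded_mfun f.
  split=> //; exists C => x.
  by by apply: (cvgr_to_le (cvg_norm (Ff x))); near=> n.
split=> //.
have bF n : bounded_mfun (F n) by split => //; exists C.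
have [] := @dominated_convergence _ _ _ mu `[0%R, 1%R]%classic
  (measurable_itv _) (fun n => EFin \o F n) (EFin \o f) (EFin \o cst C).
- by move=> n; apply/measurable_EFinP; exact: measurable_funS (mF n).
- by apply/measurable_EFinP; exact: measurable_funS mf.
- by apply: aeW => x _; apply: cvg_EFin; [exact: nearW|exact: Ff].
- exact/I01/bounded_mfun_cst.
- by apply: aeW => x n _ /=; rewrite lee_fin.
move=> _ _; rewrite torus_integralE//.
under eq_fun do rewrite torus_integralE//.
by move/fine_cvgP => [].
Unshelve. all: by end_near. Qed.

(** A property of a periodic function holds almost everywhere as soon as it does
    on one period, null sets being translation invariant. *)
Lemma ae_periodic (P : R -> Prop) : (forall x, P x -> P (x + 1)) ->
  (forall x, P (x + 1) -> P x) ->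
  {ae mu, forall x, 0 <= x <= 1 -> P x} -> {ae mu, forall x, P x}.
Proof.
move=> P1 PN1 [N [mN N0 PN]].
have Pn (n : nat) x : (P x -> P (x + n%:R)) /\ (P (x + n%:R) -> P x).
  elim: n => [|n [IH1 IH2]]; first by rewrite addr0.
  by rewrite -natr1 addrA; split => [/IH1/P1|/PN1/IH2].
have Pz (n : int) x : P (x + n%:~R) -> P x.
  case: n => n; first by rewrite -pmulrn; case: (Pn n x).
  rewrite NegzE mulrNz -pmulrn => /(Pn n.+1 _).1.
  by rewrite subrK.
pose T (n : int) := ((fun x => x + n%:~R) : R -> measurableTypeR R) @^-1` N.
have mT n : measurable (T n).
  rewrite -[T n]setTI; apply: (@measurable_funD _ _ _ _ id (cst n%:~R)) => //.
have T0 n : mu.-negligible (T n).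
  exists (T n); split => //; first exact: mT.
  by rewrite -N0 -(lebesgue_measure_shift n%:~R mN).
apply: (@negligibleS _ _ _ mu (\bigcup_(n in [set: nat]) (T n%:Z `|` T (- n%:Z)))); last first.
  by apply: negligible_bigcup => n; exact: negligibleU.
move=> x /= nPx.
have Tx : T (- Num.floor x) x.
  apply: PN => /=; apply: contra_not nPx => H.
  apply: (@Pz (- Num.floor x)); apply: H.
  have /andP[h1 h2] := floor_itv x.
  by rewrite mulrNz subr_ge0 h1/= lerBlDl ltW// -[1]/(1%:~R) -intrD.
move: Tx; case: (- Num.floor x) => n Tx; first by exists n => //; left.
by exists n.+1 => //; right; rewrite -NegzE.
Qed.

End bounded_measurable.

(** * Complex modulus, exponentials and trigonometric polynomials *)

Local Open Scope complex_scope.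
Local Notation normc := Normc.normc.

Section complex_modulus.
Variable R : realType.
Implicit Types (z w : R[i]) (x y : R).

Lemma normc_ge0 z : 0 <= normc z.
Proof. by case: z => a b; exact: sqrtr_ge0. Qed.

Lemma sqr_normcE z : normc z ^+ 2 = complex.Re z ^+ 2 + complex.Im z ^+ 2.
Proof. by case: z => a b /=; rewrite sqr_sqrtr// addr_ge0// sqr_ge0. Qed.

Lemma normc_conj z : normc z^*%C = normc z.
Proof. by case: z => a b /=; rewrite sqrrN. Qed.

Lemma mulc_conj z : z * z^*%C = (normc z ^+ 2)%:C.
Proof.
case: z => a b; rewrite sqr_normcE /= /GRing.mul/=.
by congr (_ +i* _); ring.
Qed.

Lemma normcB_sym z w : normc (z - w) = normc (w - z).
Proof. by rewrite -normcN opprB. Qed.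

Lemma ler_norm_Re z : `|complex.Re z| <= normc z.
Proof.
by rewrite -(ler_pXn2r (n := 2)) ?nnegrE ?normc_ge0// real_normK ?num_real//
  sqr_normcE lerDl sqr_ge0.
Qed.

Lemma ler_norm_Im z : `|complex.Im z| <= normc z.
Proof.
by rewrite -(ler_pXn2r (n := 2)) ?nnegrE ?normc_ge0// real_normK ?num_real//
  sqr_normcE lerDr sqr_ge0.
Qed.

Lemma normc_real x : normc x%:C = `|x|.
Proof. by rewrite /= expr0n/= addr0 sqrtr_sqr. Qed.

Lemma normcX z n : normc (z ^+ n) = normc z ^+ n.
Proof.
elim: n => [|n IHn]; first by rewrite !expr0 Normc.normc1.
by rewrite !exprS Normc.normcM IHn.
Qed.

Lemma normc_sum (J : Type) (r : seq J) (P : pred J) (F : J -> R[i]) :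
  normc (\sum_(i <- r | P i) F i) <= \sum_(i <- r | P i) normc (F i).
Proof.
elim/big_rec2 : _ => [|i y z _ IH]; first by rewrite Normc.normc0.
by rewrite (le_trans (le_normcD _ _))// lerD2l.
Qed.

Lemma ler_normcB z w : `|normc z - normc w| <= normc (z - w).
Proof.
have h (a b : R[i]) : normc a - normc b <= normc (a - b).
  by rewrite lerBlDr -{1}(subrK b a); exact: le_normcD.
by rewrite ler_norml h lerNl opprB normcB_sym h.
Qed.

Lemma normc_eq0 z : (normc z == 0) = (z == 0).
Proof.
by apply/eqP/eqP => [/Normc.eq0_normc//|->]; rewrite Normc.normc0.
Qed.

Lemma complex_ReD z w : complex.Re (z + w) = complex.Re z + complex.Re w.
Proof. by case: z; case: w. Qed.

Lemma complex_ImD z w : complex.Im (z + w) = complex.Im z + complex.Im w.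
Proof. by case: z; case: w. Qed.

Lemma complex_ReM z w : complex.Re (z * w) =
  complex.Re z * complex.Re w - complex.Im z * complex.Im w.
Proof. by case: z; case: w. Qed.

Lemma complex_ImM z w : complex.Im (z * w) =
  complex.Re z * complex.Im w + complex.Im z * complex.Re w.
Proof. by case: z; case: w. Qed.

Lemma conjcM z w : (z * w)^*%C = z^*%C * w^*%C.
Proof. exact: rmorphM. Qed.

Lemma conjcN z : (- z)^*%C = - z^*%C.
Proof. exact: rmorphN. Qed.

Lemma conjc_sum (J : Type) (r : seq J) (P : pred J) (F : J -> R[i]) :
  (\sum_(i <- r | P i) F i)^*%C = \sum_(i <- r | P i) (F i)^*%C.
Proof. exact: (rmorph_sum (@conjc R)). Qed.

Lemma realcB x y : (x - y)%:C = x%:C - y%:C :> R[i].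
Proof. exact: rmorphB. Qed.

Lemma realcM x y : (x * y)%:C = x%:C * y%:C :> R[i].
Proof. exact: rmorphM. Qed.

Lemma realc_sum (J : Type) (r : seq J) (P : pred J) (F : J -> R) :
  (\sum_(i <- r | P i) F i)%:C = \sum_(i <- r | P i) (F i)%:C :> R[i].
Proof. exact: (rmorph_sum (real_complex R)). Qed.

Lemma complex_Re_sum (J : Type) (r : seq J) (P : pred J) (F : J -> R[i]) :
  complex.Re (\sum_(i <- r | P i) F i) = \sum_(i <- r | P i) complex.Re (F i).
Proof. by elim/big_rec2 : _ => // i y z _ <-; rewrite complex_ReD. Qed.

Lemma eqc_Re_Im z w : complex.Re z = complex.Re w ->
  complex.Im z = complex.Im w -> z = w.
Proof. by case: z w => [a b] [c d] /= -> ->. Qed.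

End complex_modulus.

Section exponentials.
Variable R : realType.
Implicit Types (a b x y : R).

Lemma e2pi0 : e2pi (0 : R) = 1.
Proof. by rewrite /e2pi mulr0 cos0 sin0. Qed.

Lemma e2piD x y : e2pi (x + y) = e2pi x * e2pi y.
Proof.
by rewrite /e2pi mulrDr cosD sinD /GRing.mul/=; congr (_ +i* _); rewrite addrC.
Qed.

Lemma e2piN x : e2pi (- x) = (e2pi x)^*%C.
Proof. by rewrite /e2pi mulrN cosN sinN. Qed.

Lemma normc_e2pi x : normc (e2pi x) = 1.
Proof.
by apply/eqP; rewrite -(@eqrXn2 _ 2)// ?normc_ge0// sqr_normcE/= cos2Dsin2 expr1n.
Qed.

Lemma e2piB x y : e2pi (x - y) = e2pi x * (e2pi y)^*%C.
Proof. by rewrite e2piD e2piN. Qed.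

Lemma e2pi_conjK x : e2pi x * (e2pi x)^*%C = 1.
Proof. by rewrite -e2piB subrr e2pi0. Qed.

Lemma e2pi1 : e2pi (1 : R) = 1.
Proof. by rewrite /e2pi mulr1 mulr_natl cos2pi sin2pi. Qed.

Lemma e2pi_half : e2pi (2^-1 : R) = -1.
Proof.
rewrite /e2pi mulrAC mulfV ?pnatr_eq0// mul1r cospi sinpi.
by apply: eqc_Re_Im => //=; rewrite oppr0.
Qed.

Lemma e2piMn n x : e2pi (n%:R * x) = e2pi x ^+ n.
Proof.
elim: n => [|n IHn]; first by rewrite mul0r e2pi0 expr0.
by rewrite -natr1 mulrDl mul1r e2piD IHn exprSr.
Qed.

Lemma e2pi_int (n : int) : e2pi (n%:~R : R) = 1.
Proof.
case: n => n; first by rewrite -pmulrn -[_%:R]mulr1 e2piMn e2pi1 expr1n.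
rewrite NegzE mulrNz e2piN -pmulrn -[_%:R]mulr1 e2piMn e2pi1 expr1n.
exact: conjc1.
Qed.

Lemma periodic_e2pi (n : int) b : periodic (fun x => e2pi (n%:~R * x + b)) 1.
Proof. by move=> x; rewrite mulrDr mulr1 addrAC e2piD e2pi_int mulr1. Qed.

Lemma sqr_normc_1Be2pi x : normc (1 - e2pi x) ^+ 2 = 2 - 2 * cos (2 * pi * x).
Proof.
rewrite sqr_normcE/= sub0r sqrrN.
by have := cos2Dsin2 (2 * pi * x); lra.
Qed.

End exponentials.

Section complex_integral.
Variable R : realType.
Implicit Types (F G : R -> R[i]) (z : R[i]).
Local Notation cint := (@torus_cintegral R).

Definition bounded_cfun F : Prop :=
  bounded_mfun (fun x => complex.Re (F x)) /\
  bounded_mfun (fun x => complex.Im (F x)).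

Lemma torus_cintegralE F : cint F =
  torus_integral (fun x => complex.Re (F x)) +i*
  torus_integral (fun x => complex.Im (F x)).
Proof. by []. Qed.

Lemma bounded_cfun_cst z : bounded_cfun (fun=> z).
Proof. by split; exact: bounded_mfun_cst. Qed.

Lemma bounded_cfun_real (f : R -> R) : bounded_mfun f ->
  bounded_cfun (fun x => (f x)%:C).
Proof. by move=> bf; split => //=; exact: bounded_mfun_cst. Qed.

Lemma bounded_cfunD F G : bounded_cfun F -> bounded_cfun G ->
  bounded_cfun (fun x => F x + G x).
Proof.
move=> [rF iF] [rG iG]; split.
  by under eq_fun do rewrite complex_ReD; exact: bounded_mfunD.
by under eq_fun do rewrite complex_ImD; exact: bounded_mfunD.
Qed.

Lemma bounded_cfunM F G : bounded_cfun F -> bounded_cfun G ->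
  bounded_cfun (fun x => F x * G x).
Proof.
move=> [rF iF] [rG iG]; split.
  by under eq_fun do rewrite complex_ReM; apply: bounded_mfunB; exact: bounded_mfunM.
by under eq_fun do rewrite complex_ImM; apply: bounded_mfunD; exact: bounded_mfunM.
Qed.

Lemma bounded_cfunZ z F : bounded_cfun F -> bounded_cfun (fun x => z * F x).
Proof. by move=> bF; apply: bounded_cfunM => //; exact: bounded_cfun_cst. Qed.

Lemma bounded_cfunN F : bounded_cfun F -> bounded_cfun (fun x => - F x).
Proof.
by move=> bF; under eq_fun do rewrite -mulN1r; exact: bounded_cfunZ.
Qed.

Lemma bounded_cfunB F G : bounded_cfun F -> bounded_cfun G ->
  bounded_cfun (fun x => F x - G x).
Proof. by move=> bF bG; apply: bounded_cfunD => //; exact: bounded_cfunN. Qed.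

Lemma bounded_cfun_conj F : bounded_cfun F -> bounded_cfun (fun x => (F x)^*%C).
Proof.
move=> [rF iF]; split.
  rewrite (_ : (fun x => _) = (fun x => complex.Re (F x)))//.
  by apply/funext => x; case: (F x).
rewrite (_ : (fun x => _) = (fun x => - complex.Im (F x))); last first.
  by apply/funext => x; case: (F x).
exact: bounded_mfunN.
Qed.

Lemma bounded_cfun_sum (J : Type) (r : seq J) (P : pred J) (F : J -> R -> R[i]) :
  (forall i, bounded_cfun (F i)) ->
  bounded_cfun (fun x => \sum_(i <- r | P i) F i x).
Proof.
move=> bF; elim: r => [|i r IHr].
  by under eq_fun do rewrite big_nil; exact: bounded_cfun_cst.
under eq_fun do rewrite big_cons.
by case: (P i) => //; exact: bounded_cfunD.
Qed.

Lemma measurable_affine (a b : R) : measurable_fun [set: R] (fun x : R => a * x + b).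
Proof. exact: measurable_funD. Qed.

Lemma bounded_cfun_e2pi (a b : R) : bounded_cfun (fun x => e2pi (a * x + b)).
Proof.
split; split; rewrite /e2pi/=.
- apply: (@measurableT_comp _ _ _ _ _ _ cos).
    by apply: continuous_measurable_fun; exact: continuous_cos.
  by apply: measurable_funM => //; exact: measurable_affine.
- by exists 1 => x; exact: cos_max.
- apply: (@measurableT_comp _ _ _ _ _ _ sin).
    by apply: continuous_measurable_fun; exact: continuous_sin.
  by apply: measurable_funM => //; exact: measurable_affine.
- by exists 1 => x; exact: sin_max.
Qed.

Lemma bounded_cfun_e2piZ (a : R) : bounded_cfun (fun x => e2pi (a * x)).
Proof. by have := bounded_cfun_e2pi a 0; under eq_fun do rewrite addr0. Qed.

Lemma bounded_mfun_normc F : bounded_cfun F -> bounded_mfun (fun x => normc (F x)).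
Proof.
move=> [[mr [C rC]] [mi [D iD]]]; split.
  rewrite (_ : (fun x => _) = Num.sqrt \o
    (fun x => complex.Re (F x) ^+ 2 + complex.Im (F x) ^+ 2)); last first.
    by apply/funext => x /=; case: (F x).
  apply: measurableT_comp.
    by apply: continuous_measurable_fun; exact: sqrt_continuous.
  by apply: measurable_funD; exact: measurable_funX.
exists (C + D) => x; rewrite ger0_norm ?normc_ge0//.
apply: (@le_trans _ _ (`|complex.Re (F x)| + `|complex.Im (F x)|)); last exact: lerD.
rewrite -(ler_pXn2r (n := 2)) ?nnegrE ?normc_ge0 ?addr_ge0//.
rewrite sqr_normcE sqrrD !real_normK ?num_real//.
by rewrite addrAC lerDl mulrn_wge0// mulr_ge0.
Qed.

Lemma bounded_mfun_sqr_normc F : bounded_cfun F ->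
  bounded_mfun (fun x => normc (F x) ^+ 2).
Proof. by move=> bF; apply: bounded_mfunX; exact: bounded_mfun_normc. Qed.

Lemma torus_cintegralD F G : bounded_cfun F -> bounded_cfun G ->
  cint (fun x => F x + G x) = cint F + cint G.
Proof.
move=> [rF iF] [rG iG]; rewrite !torus_cintegralE.
under eq_fun do rewrite complex_ReD.
under [X in _ +i* torus_integral X]eq_fun do rewrite complex_ImD.
by rewrite !torus_integralD.
Qed.

Lemma torus_cintegralZ z F : bounded_cfun F ->
  cint (fun x => z * F x) = z * cint F.
Proof.
move=> [rF iF]; rewrite !torus_cintegralE.
under eq_fun do rewrite complex_ReM.
under [X in _ +i* torus_integral X]eq_fun do rewrite complex_ImM.
rewrite torus_integralB ?torus_integralD ?torus_integralZ//; try exact: bounded_mfunZ.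
by case: z.
Qed.

Lemma torus_cintegralN F : bounded_cfun F -> cint (fun x => - F x) = - cint F.
Proof.
by move=> bF; under eq_fun do rewrite -mulN1r; rewrite torus_cintegralZ// mulN1r.
Qed.

Lemma torus_cintegralB F G : bounded_cfun F -> bounded_cfun G ->
  cint (fun x => F x - G x) = cint F - cint G.
Proof.
by move=> bF bG; rewrite torus_cintegralD ?torus_cintegralN//; exact: bounded_cfunN.
Qed.

Lemma torus_cintegral_cst z : cint (fun=> z) = z.
Proof. by rewrite torus_cintegralE !torus_integral_cst; case: z. Qed.

Lemma torus_cintegral_sum (J : Type) (r : seq J) (P : pred J) (F : J -> R -> R[i]) :
  (forall i, bounded_cfun (F i)) ->
  cint (fun x => \sum_(i <- r | P i) F i x) = \sum_(i <- r | P i) cint (F i).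
Proof.
move=> bF; elim: r => [|i r IHr].
  by under eq_fun do rewrite big_nil; rewrite big_nil torus_cintegral_cst.
under eq_fun do rewrite big_cons.
rewrite big_cons; case: (P i) => //.
by rewrite torus_cintegralD ?IHr//; exact: bounded_cfun_sum.
Qed.

Lemma torus_cintegral_real (f : R -> R) :
  cint (fun x => (f x)%:C) = (torus_integral f)%:C.
Proof. by rewrite torus_cintegralE/= torus_integral_cst. Qed.

Lemma torus_cintegral_conj F : bounded_cfun F ->
  cint (fun x => (F x)^*%C) = (cint F)^*%C.
Proof.
move=> [rF iF]; rewrite !torus_cintegralE/= -torus_integralN//.
by congr (torus_integral _ +i* torus_integral _); apply/funext => x; case: (F x).
Qed.

Lemma eq_torus_cintegral F G : (forall x, 0 <= x <= 1 -> F x = G x) ->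
  cint F = cint G.
Proof.
move=> FG; rewrite !torus_cintegralE.
by congr (_ +i* _); apply: eq_torus_integral => x /FG ->.
Qed.

Lemma le_normc_torus_cintegral F : bounded_cfun F ->
  normc (cint F) <= torus_integral (fun x => normc (F x)).
Proof.
move=> bF; set z := cint F.
have [->|z0] := eqVneq z 0.
  by rewrite Normc.normc0; apply: torus_integral_ge0 => x; exact: normc_ge0.
have zp : 0 < normc z by rewrite lt_neqAle normc_ge0 eq_sym normc_eq0 z0.
rewrite -(ler_pM2l zp) -expr2.
have [w wz wn] : exists2 w, w * z = (normc z ^+ 2)%:C & normc w = normc z.
  by exists z^*%C; rewrite ?normc_conj// mulrC mulc_conj.
have -> : normc z ^+ 2 = torus_integral (fun x => complex.Re (w * F x)).
  have : (normc z ^+ 2)%:C = cint (fun x => w * F x) by rewrite torus_cintegralZ.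
  by rewrite torus_cintegralE => -[].
rewrite -torus_integralZ; last exact: bounded_mfun_normc.
apply: le_torus_integral.
- by case: (bounded_cfunZ w bF).
- by apply: bounded_mfunZ; exact: bounded_mfun_normc.
- move=> x _; rewrite (le_trans (ler_norm _))// (le_trans (ler_norm_Re _))//.
  by rewrite Normc.normcM wn.
Qed.

Lemma torus_cintegral_shift (h : R) F : bounded_cfun F -> periodic F 1 ->
  cint (fun x => F (x + h)) = cint F.
Proof.
move=> [rF iF] pF; rewrite !torus_cintegralE; congr (_ +i* _).
  by apply: (@torus_integral_shift _ h (fun x => complex.Re (F x))) => // x; rewrite pF.
by apply: (@torus_integral_shift _ h (fun x => complex.Im (F x))) => // x; rewrite pF.
Qed.

(** Translating by half a period of a nonconstant exponential changes its sign,
    so that its mean vanishes. *)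
Lemma torus_cintegral_e2pi (n : int) :
  cint (fun x => e2pi (n%:~R * x)) = (n == 0)%:R.
Proof.
have [->|n0] := eqVneq n 0.
  rewrite (_ : (fun x => _) = fun=> 1) ?torus_cintegral_cst//.
  by apply/funext => x; rewrite mul0r e2pi0.
have bF := bounded_cfun_e2piZ n%:~R.
have nR : n%:~R != 0 :> R by rewrite intr_eq0.
have pF : periodic (fun x : R => e2pi (n%:~R * x)) 1.
  by move=> x; have := @periodic_e2pi R n 0 x; rewrite !addr0.
have := torus_cintegral_shift (2^-1 / n%:~R) bF pF.
under eq_fun do rewrite mulrDr [_ * (_ / _)]mulrC divfK// e2piD e2pi_half mulrC.
rewrite torus_cintegralZ// mulN1r => /eqP; rewrite -subr_eq0 -opprD oppr_eq0.
by rewrite -mulr2n mulrn_eq0/= => /eqP.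
Qed.

Lemma torus_cintegral_trigpoly (J : Type) (r : seq J) (c : J -> R[i]) (l : J -> int) :
  cint (fun x => \sum_(i <- r) c i * e2pi ((l i)%:~R * x)) =
  \sum_(i <- r | l i == 0) c i.
Proof.
rewrite torus_cintegral_sum; last first.
  by move=> i; apply: bounded_cfunZ; exact: bounded_cfun_e2piZ.
rewrite [RHS]big_mkcond/=; apply: eq_bigr => i _.
rewrite torus_cintegralZ; last exact: bounded_cfun_e2piZ.
by rewrite torus_cintegral_e2pi; case: eqP; rewrite ?mulr1 ?mulr0.
Qed.

Lemma bounded_cfun_trigpoly (J : Type) (r : seq J) (P : pred J) (c : J -> R[i])
    (l b : J -> R) :
  bounded_cfun (fun x => \sum_(i <- r | P i) c i * e2pi (l i * x + b i)).
Proof.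
by apply: bounded_cfun_sum => i; apply: bounded_cfunZ; exact: bounded_cfun_e2pi.
Qed.

Lemma sqr_normc_sum (J : Type) (r : seq J) (F : J -> R[i]) :
  (normc (\sum_(i <- r) F i) ^+ 2)%:C = \sum_(i <- r) \sum_(j <- r) F i * (F j)^*%C.
Proof.
rewrite -mulc_conj rmorph_sum mulr_suml; apply: eq_bigr => i _.
by rewrite mulr_sumr.
Qed.

Lemma torus_integral_sqr_trigpoly (J : Type) (r : seq J) (c : J -> R[i])
    (l : J -> int) :
  (torus_integral (fun x => normc (\sum_(i <- r) c i * e2pi ((l i)%:~R * x)) ^+ 2))%:C
  = \sum_(i <- r) \sum_(j <- r | l i == l j) c i * (c j)^*%C.
Proof.
rewrite -torus_cintegral_real.
under eq_fun do rewrite sqr_normc_sum.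
rewrite torus_cintegral_sum; last first.
  move=> i; apply: bounded_cfun_sum => j; apply: bounded_cfunM.
    by apply: bounded_cfunZ; exact: bounded_cfun_e2piZ.
  by apply: bounded_cfun_conj; apply: bounded_cfunZ; exact: bounded_cfun_e2piZ.
apply: eq_bigr => i _.
rewrite (_ : (fun x => _) = (fun x => \sum_(j <- r)
   (c i * (c j)^*%C) * e2pi ((l i - l j)%:~R * x))); last first.
  apply/funext => x; apply: eq_bigr => j _.
  by rewrite rmorphM/= mulrACA -e2piB intrB mulrBl.
rewrite torus_cintegral_trigpoly; apply: eq_bigl => j.
by rewrite subr_eq0.
Qed.

Lemma le_torus_integral_sqr_trigpoly (J : Type) (r : seq J) (c : J -> R[i])
    (l : J -> int) :
  torus_integral (fun x => normc (\sum_(i <- r) c i * e2pi ((l i)%:~R * x)) ^+ 2)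
  <= \sum_(i <- r) \sum_(j <- r | l i == l j) normc (c i) * normc (c j).
Proof.
set I := torus_integral _.
have I0 : 0 <= I by apply: torus_integral_ge0 => x; rewrite sqr_ge0.
rewrite -(ger0_norm I0) -normc_real /I torus_integral_sqr_trigpoly.
rewrite (le_trans (normc_sum _ _ _))// ler_sum// => i _.
rewrite (le_trans (normc_sum _ _ _))// ler_sum// => j _.
by rewrite Normc.normcM normc_conj.
Qed.

End complex_integral.

(** * Functions of bounded variation *)

Section monotone_majorant.
Variable R : realType.
Implicit Types (g T : R -> R) (V : R).
Local Notation mu := (@lebesgue_measure R).

(** [T] is a primitive of the variation of [g], of total mass [V] per period. *)
Definition variation_majorant g T V : Prop :=
  (forall x y : R, x <= y -> `|g y - g x| <= T y - T x) /\
  (forall x : R, T (x + 1) = T x + V).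

Lemma periodic_frac g (x : R) : periodic g 1 -> g (x - (Num.floor x)%:~R) = g x.
Proof. by move=> pg; rewrite -mulrNz periodic_int. Qed.

Lemma frac_itv (x : R) : 0 <= x - (Num.floor x)%:~R < 1.
Proof.
have /andP[h1 h2] := floor_itv x.
by rewrite subr_ge0 h1/= ltrBlDl -[1]/(1%:~R) -intrD.
Qed.

(** The total variation on [[0, x]] is extended to the line by adding the
    variation of one period at each integer. *)
Lemma variation_majorant_exists g : periodic g 1 -> bounded_variation 0 1 g ->
  exists T V, variation_majorant g T V.
Proof.
move=> pg bv.
pose tau (y : R) : R := fine (total_variation 0 y g).
have tvfin (a b : R) : 0 <= a -> a <= b -> b <= 1 ->
    total_variation a b g \is a fin_num.
  move=> a0 ab b1; apply/bounded_variationP => //.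
  apply: (bounded_variationr a0 ab); apply: bounded_variationl b1 bv.
  exact: le_trans ab.
have tauB (a b : R) : 0 <= a -> a <= b -> b <= 1 -> `|g b - g a| <= tau b - tau a.
  move=> a0 ab b1; rewrite /tau (@total_variationD _ 0 b a)//.
  have f1 := tvfin 0 a (lexx _) a0 (le_trans ab b1).
  have f2 := tvfin a b a0 ab b1.
  rewrite fineD// addrAC subrr add0r -lee_fin fineK//.
  exact: total_variation_ge.
have tau0 : tau 0 = 0 by rewrite /tau total_variationxx.
have g10 : g 1 = g 0 by have := pg 0; rewrite add0r.
pose V := tau 1.
pose T (x : R) := tau (x - (Num.floor x)%:~R) + V * (Num.floor x)%:~R.
exists T, V; split; last first.
  move=> x; have -> : T (x + 1) = tau (x + 1 - (Num.floor x + 1)%:~R) +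
      V * (Num.floor x + 1)%:~R.
    by rewrite /T floorDrz ?floor1// ?num_real// rpred1.
  rewrite /T intrD.
  have -> : x + 1 - ((Num.floor x)%:~R + 1%:~R) = x - (Num.floor x)%:~R by ring.
  by rewrite mulrDr mulr1 addrA.
move=> x y xy; rewrite -(periodic_frac x pg) -(periodic_frac y pg) /T.
have := frac_itv x; have := frac_itv y.
have : Num.floor x <= Num.floor y by exact: le_floor.
move: (Num.floor x) (Num.floor y) => m n mn.
set a := x - _; set b := y - _ => /andP[b0 /ltW b1] /andP[a0 /ltW a1].
have xa : x = a + m%:~R by rewrite subrK.
have yb : y = b + n%:~R by rewrite subrK.
have [mn'|mn'] := eqVneq m n.
  subst n; have ab : a <= b by rewrite -(lerD2r m%:~R) -xa -yb.
  by rewrite (le_trans (tauB _ _ a0 ab b1))//; lra.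
have {}mn : (m%:~R : R) + 1 <= n%:~R.
  by rewrite -[1]/(1%:~R) -intrD ler_int lezD1 lt_neqAle mn'.
have h1 := tauB a 1 a0 a1 (lexx _).
have h2 := tauB 0 b (lexx _) b0 b1.
have V0 : 0 <= V.
  by have := tauB 0 1 (lexx _) ler01 (lexx _); rewrite tau0 subr0; apply: le_trans.
have := ler_normD (g b - g 0) (g 1 - g a).
have -> : g b - g 0 + (g 1 - g a) = g b - g a by rewrite g10; ring.
move=> h3; rewrite (le_trans h3)//.
have h4 : V * m%:~R + V <= V * n%:~R by rewrite -{2}[V]mulr1 -mulrDr ler_wpM2l.
by move: h1 h2; rewrite tau0 -/V; lra.
Qed.

Variables (g T : R -> R) (V : R).
Hypothesis pg : periodic g 1.
Hypothesis gT : variation_majorant g T V.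

Lemma majorant_nondecreasing : {homo T : x y / x <= y}.
Proof. by move=> x y /gT.1 h; rewrite -subr_ge0 (le_trans _ h). Qed.

Lemma majorantB_nondecreasing : {homo (fun x => T x - g x) : x y / x <= y}.
Proof.
by move=> x y /gT.1 h; have := ler_norm (g y - g x); move: h; lra.
Qed.

Lemma bv_measurable : measurable_fun [set: R] g.
Proof.
rewrite (_ : g = T \- (fun x => T x - g x)); last first.
  by apply/funext => x /=; rewrite opprB addrCA subrr addr0.
by apply: measurable_funB; apply: nondecreasing_measurable => //;
  [exact: majorant_nondecreasing | exact: majorantB_nondecreasing].
Qed.

Lemma bv_bounded_mfun : bounded_mfun g.
Proof.
split; first exact: bv_measurable.
exists (`|g 0| + V) => x; rewrite -(periodic_frac x pg).
have /andP[a0 a1] := frac_itv x; move: (x - _) a0 a1 => a a0 a1.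
have := gT.1 _ _ a0; have := majorant_nondecreasing (ltW a1).
have := gT.2 0; rewrite add0r; have := ler_normD (g a - g 0) (g 0).
by rewrite subrK; lra.
Qed.

(** [T x - V x] is periodic, so that only the affine part [V x] contributes to
    the mean of the increments of [T]. *)
Lemma bv_L1_modulus (h : R) :
  torus_integral (fun x => `|g (x + h) - g x|) <= V * `|h|.
Proof.
have bg := bv_bounded_mfun.
have V0 : 0 <= V.
  have := majorant_nondecreasing (ler01 : (0 : R) <= 1).
  by have := gT.2 0; rewrite add0r => ->; rewrite lerDl.
wlog h0 : h / 0 <= h.
  move=> H; have [/H//|h0] := leP 0 h.
  have := H (- h); rewrite oppr_ge0 normrN => /(_ (ltW h0)); apply: le_trans.
  rewrite le_eqVlt; apply/orP; left; apply/eqP.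
  have pF : periodic (fun x => `|g (x + h) - g x|) 1.
    by move=> x /=; rewrite addrAC !pg.
  rewrite -(torus_integral_shift (- h) _ pF); last first.
    apply: bounded_mfun_norm; apply: bounded_mfunB => //.
    exact: bounded_mfun_shift.
  by apply: eq_torus_integral => x _; rewrite subrK distrC.
pose F x := T x - V * x.
have pF : periodic F 1 by move=> x; rewrite /F gT.2; ring.
have bF : bounded_mfun F.
  split.
    apply: measurable_funB.
      by apply: nondecreasing_measurable => //; exact: majorant_nondecreasing.
    exact: measurable_funM.
  exists (`|T 0| + V) => x; rewrite -(periodic_frac x pF).
  have /andP[a0 a1] := frac_itv x; move: (x - _) a0 a1 => a a0 a1.
  have h1 := majorant_nondecreasing a0.
  have := majorant_nondecreasing (ltW a1); have := gT.2 0; rewrite add0r => -> h2.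
  have := ler_norm (T 0); have := ler_norm (- T 0); rewrite normrN => h3 h4.
  have h5 : 0 <= V * a by rewrite mulr_ge0.
  have h6 : V * a <= V by rewrite ler_piMr// ltW.
  by rewrite ler_norml /F; apply/andP; split; lra.
have bFh := bounded_mfun_shift h bF.
apply: (@le_trans _ _ (torus_integral (fun x => (F (x + h) - F x) + V * h))).
  apply: le_torus_integral.
  - apply: bounded_mfun_norm; apply: bounded_mfunB => //.
    exact: bounded_mfun_shift.
  - by apply: bounded_mfunD; [exact: bounded_mfunB|exact: bounded_mfun_cst].
  - move=> x _; rewrite (le_trans (gT.1 _ _ _)) ?lerDl// /F.
    by rewrite le_eqVlt; apply/orP; left; apply/eqP; ring.
rewrite torus_integralD; [|exact: bounded_mfunB|exact: bounded_mfun_cst].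
by rewrite torus_integralB// torus_integral_shift// subrr add0r
  torus_integral_cst ger0_norm.
Qed.

Lemma nondecreasing_cvg_right (f : R -> R) (p : R) : {homo f : x y / x <= y} ->
  cvg (f @ p^'+).
Proof.
move=> ndf; apply: nondecreasing_at_right_is_cvgr.
  by near=> s => x y _ _; exact: ndf.
near=> x; exists (f p) => _ /= [s + <-]; rewrite in_itv/= => /andP[ps _].
exact/ndf/ltW.
Unshelve. all: by end_near. Qed.

Lemma nondecreasing_cvg_left (f : R -> R) (p : R) : {homo f : x y / x <= y} ->
  cvg (f @ p^'-).
Proof.
move=> ndf; apply: nondecreasing_at_left_is_cvgr.
  by near=> s => x y _ _; exact: ndf.
near=> x; exists (f p) => _ /= [s + <-]; rewrite in_itv/= => /andP[_ ps].
exact/ndf/ltW.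
Unshelve. all: by end_near. Qed.

Lemma bv_split : g = T \- (fun x => T x - g x).
Proof. by apply/funext => x /=; rewrite opprB addrCA subrr addr0. Qed.

Lemma bv_cvg_right (p : R) : cvg (g @ p^'+).
Proof.
rewrite bv_split; apply: is_cvgB; apply: nondecreasing_cvg_right.
  exact: majorant_nondecreasing.
exact: majorantB_nondecreasing.
Qed.

Lemma bv_cvg_left (p : R) : cvg (g @ p^'-).
Proof.
rewrite bv_split; apply: is_cvgB; apply: nondecreasing_cvg_left.
  exact: majorant_nondecreasing.
exact: majorantB_nondecreasing.
Qed.

Lemma bv_one_sided (p eps : R) : 0 < eps -> exists2 r : R, 0 < r &
  (forall x : R, p < x < p + r -> `|g x - lim (g @ p^'+)| <= eps) /\
  (forall x : R, p - r < x < p -> `|g x - lim (g @ p^'-)| <= eps).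
Proof.
move=> e0.
have /cvgrPdist_le := @bv_cvg_right p; move=> /(_ _ e0) [r1 /= r10 h1].
have /cvgrPdist_le := @bv_cvg_left p; move=> /(_ _ e0) [r2 /= r20 h2].
exists (Num.min r1 r2); first by rewrite lt_min r10.
split => x /andP[xl xr]; rewrite distrC; [apply: h1 => //|apply: h2 => //].
  rewrite /= ltr_norml; move: xr; rewrite -ltrBlDl lt_min => /andP[? _].
  by apply/andP; split; lra.
rewrite /= ltr_norml; move: xl; rewrite ltrBlDr addrC -ltrBlDr lt_min => /andP[_ ?].
by apply/andP; split; lra.
Qed.

(** Off the finitely many points given by compactness, a short increment of [g]
    stays on one side of every point and is therefore small. *)
Lemma bv_small_increments (eps : R) : 0 < eps -> exists P : seq R,
  all (fun p : R => 0 <= p < 1) P /\ exists2 h0 : R, 0 < h0 & forall h x : R,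
    0 < h < h0 -> 0 <= x < 1 ->
    (forall p, p \in P -> x != p /\ x != p + h) ->
    (forall p, p \in P -> ~~ (p < x < p + h)) -> `|g x - g (x - h)| <= eps.
Proof.
move=> e0; have e20 : 0 < eps / 2 by rewrite divr_gt0.
have /choice[r rP] (p : R) : exists r : R, 0 < r /\
    (forall x : R, p < x < p + r -> `|g x - lim (g @ p^'+)| <= eps / 2) /\
    (forall x : R, p - r < x < p -> `|g x - lim (g @ p^'-)| <= eps / 2).
  by have [r r0 h] := bv_one_sided p e20; exists r.
have := @segment_compact R 0 1; rewrite compact_cover.
move=> /(_ R `[0, 1]%classic (fun p : R => ball p (r p / 2))) [].
- by move=> p _; apply: ball_open; rewrite divr_gt0// (rP p).1.
- by move=> x x01; exists x => //; apply: ballxx; rewrite divr_gt0// (rP x).1.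
move=> D D01 cov.
exists [seq p <- finmap.enum_fset D | 0 <= p < 1]; split; first exact: filter_all.
have [h0 h00 h0P] : exists2 h0 : R, 0 < h0 & forall p, p \in finmap.enum_fset D -> h0 <= r p / 2.
  elim: (finmap.enum_fset D) => [|p s [h0 h00 IH]]; first by exists 1.
  exists (Num.min (r p / 2) h0); first by rewrite lt_min h00 divr_gt0// (rP p).1.
  move=> q; rewrite in_cons => /orP[/eqP->|/IH]; first by rewrite ge_min lexx.
  by move=> h; rewrite ge_min h orbT.
exists h0 => // h x /andP[hp hh0] /andP[x0 x1] exc cross.
have [|p /= pD] := cov x; first by rewrite /= in_itv/= x0 ltW.
rewrite /ball/= => xp.
have rp := h0P p pD; have [rp0 [hR hL]] := rP p.
have p0 : 0 <= p by have := D01 _ pD; rewrite inE/= in_itv/= => /andP[].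
have pP : p < 1 -> p \in [seq p <- finmap.enum_fset D | 0 <= p < 1].
  by move=> p1; rewrite mem_filter p0 p1.
move: xp; rewrite ltr_norml => /andP[xp1 xp2].
have bound (y l : R) : `|g x - l| <= eps / 2 -> `|g y - l| <= eps / 2 ->
    `|g x - g y| <= eps.
  move=> a b; have -> : g x - g y = (g x - l) - (g y - l) by ring.
  by rewrite (le_trans (ler_normB _ _))// [eps]splitr lerD.
have [px|xp|xp] := ltrgtP p x.
- have {}pP := pP (lt_trans px x1).
  have [pxh|xhp|xhp] := ltrgtP p (x - h).
  + by apply: (bound _ (lim (g @ p^'+))); apply: hR; apply/andP; split => //; lra.
  + by have := cross p pP; rewrite px/= -ltrBlDr xhp.
  + by have [_] := exc p pP; rewrite xhp subrK eqxx.
- by apply: (bound _ (lim (g @ p^'-))); apply: hL; apply/andP; split => //; lra.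
- have {}pP : p \in [seq p <- finmap.enum_fset D | 0 <= p < 1] by apply: pP; rewrite xp.
  by have [] := exc p pP; rewrite xp eqxx.
Qed.

End monotone_majorant.

(** * The quadratic modulus of continuity and the jumps *)

Section quadratic_modulus.
Variable R : realType.
Local Notation mu := (@lebesgue_measure R).

Definition sqr_modulus (g : R -> R) (h : R) : R :=
  torus_integral (fun x => (g x - g (x - h)) ^+ 2).

Lemma ler_sum_uniq_sub (J : eqType) (s t : seq J) (F : J -> R) : uniq s ->
  {subset s <= t} -> (forall x, 0 <= F x) ->
  \sum_(x <- s) F x <= \sum_(x <- t) F x.
Proof.
move=> us st F0; elim: s us t st => [|x s IH] /=.
  by move=> _ t _; rewrite big_nil sumr_ge0.
move=> /andP[xs us] t st; have xt : x \in t by rewrite st// mem_head.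
rewrite big_cons (perm_big _ (perm_to_rem xt)) big_cons lerD2l IH// => y ys.
have : y \in t by rewrite st// in_cons ys orbT.
rewrite (perm_mem (perm_to_rem xt)) in_cons => /orP[/eqP yx|//].
by rewrite -yx ys in xs.
Qed.

Lemma finite_seq_negligible (s : seq R) : mu.-negligible [set` s].
Proof.
have cs : countable [set` s] by apply: finite_set_countable; exact: finite_seq.
exists [set` s]; split => //; first exact: countable_measurable.
exact: countable_lebesgue_measure0.
Qed.

Lemma torus_integral_indic (a b : R) : 0 <= a -> a <= b -> b <= 1 ->
  torus_integral (\1_(`]a, b[%classic) : R -> R) = b - a.
Proof.
move=> a0 ab b1; rewrite /torus_integral /Rintegral integral_indic//.
rewrite (_ : _ `&` _ = `]a, b[%classic); last first.
  apply/setIidPl => x /=; rewrite !in_itv/= => /andP[h1 h2].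
  by rewrite (ltW (le_lt_trans a0 h1)) (ltW (lt_le_trans h2 b1)).
rewrite /= lebesgue_measure_itv/= lte_fin; case: ltP => //= ba.
by apply/esym/eqP; rewrite subr_eq0 eq_le ab ba.
Qed.

Lemma bounded_mfun_indic (a b : R) : bounded_mfun (\1_(`]a, b[%classic) : R -> R).
Proof.
split; first exact: measurable_indic.
by exists 1 => x; rewrite indicE; case: (x \in _); rewrite ?normr1 ?normr0.
Qed.

Variables (g T : R -> R) (V : R).
Hypothesis pg : periodic g 1.
Hypothesis gT : variation_majorant g T V.

Let bg : bounded_mfun g := bv_bounded_mfun pg gT.

Lemma majorant_mass_ge0 : 0 <= V.
Proof.
have := majorant_nondecreasing gT (ler01 : (0 : R) <= 1).
by have := gT.2 0; rewrite add0r => ->; rewrite lerDl.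
Qed.
Let V0 := majorant_mass_ge0.

Lemma bv_jump_increments (P : seq R) (eps : R) : 0 < eps ->
  exists2 h0 : R, 0 < h0 & forall h x p : R, 0 < h < h0 -> p \in P ->
    p < x < p + h -> `|g x - g (x - h) - jump g p| <= eps.
Proof.
move=> e0; have e20 : 0 < eps / 2 by rewrite divr_gt0.
elim: P => [|p P [h1 h10 IH]]; first by exists 1.
have [r r0 [hR hL]] := bv_one_sided gT p e20.
exists (Num.min r h1); first by rewrite lt_min r0.
move=> h x q /andP[hp]; rewrite lt_min => /andP[hr hh1].
rewrite in_cons => /orP[/eqP->{q}|qP]; last by apply: IH => //; rewrite hp.
move=> /andP[px xph]; rewrite /jump.
have := hR x _; rewrite px (lt_trans xph) ?ltrD2l// => /(_ isT) b1.
have b2 : `|g (x - h) - lim (g @ p^'-)| <= eps / 2.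
  by apply: hL; apply/andP; split; lra.
have -> : g x - g (x - h) - (lim (g @ p^'+) - lim (g @ p^'-)) =
  (g x - lim (g @ p^'+)) - (g (x - h) - lim (g @ p^'-)) by ring.
by rewrite (le_trans (ler_normB _ _))// [eps]splitr lerD.
Qed.

Lemma separated (P : seq R) : exists2 h0 : R, 0 < h0 &
  forall p q, p \in P -> q \in P -> p != q -> h0 <= `|p - q|.
Proof.
elim: P => [|p P [h1 h10 IH]]; first by exists 1.
have [h2 h20 IH2] : exists2 h2 : R, 0 < h2 & forall q, q \in P -> p != q -> h2 <= `|p - q|.
  elim: P {IH} => [|q P [h2 h20 IH]]; first by exists 1.
  have [pq|pq] := eqVneq p q.
    exists h2 => // q'; rewrite in_cons => /orP[/eqP->|/IH//].
    by rewrite pq eqxx.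
  exists (Num.min h2 `|p - q|); first by rewrite lt_min h20 normr_gt0 subr_eq0.
  move=> q'; rewrite in_cons => /orP[/eqP-> _|q'P pq']; rewrite ge_min ?lexx ?orbT//.
  by rewrite IH.
exists (Num.min h1 h2); first by rewrite lt_min h10.
move=> q q'; rewrite !in_cons => /orP[/eqP->|qP] /orP[/eqP->|q'P] qq'.
- by rewrite eqxx in qq'.
- by rewrite ge_min orbC IH2.
- by rewrite distrC ge_min orbC IH2// eq_sym.
- by rewrite ge_min IH.
Qed.

Lemma ler_sqrB (x y e : R) : `|x - y| <= e -> `|x ^+ 2 - y ^+ 2| <= 2 * e * `|x| + e ^+ 2.
Proof.
move=> xy; have e0 : 0 <= e by exact: le_trans xy.
rewrite subr_sqr normrM.
have : `|x + y| <= 2 * `|x| + e.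
  have -> : x + y = 2 * x - (x - y) by ring.
  by rewrite (le_trans (ler_normB _ _))// normrM gtr0_norm// lerD2l.
move=> h; apply: (@le_trans _ _ (e * (2 * `|x| + e))); first exact: ler_pM.
by rewrite le_eqVlt; apply/orP; left; apply/eqP; ring.
Qed.

(** The increment over [h] is close to the jump at [p] on the interval of length
    [h] that follows [p], and is small elsewhere; there its square is small
    compared with its modulus, whose mean is [O(h)]. Any finite set containing
    [P] does, which is what lets the sum over all jumps be reached. *)
Lemma sqr_modulus_jumps (eps : R) : 0 < eps -> exists P : seq R,
  [/\ uniq P, all (fun p : R => 0 <= p < 1) P &
  forall P' : seq R, uniq P' -> all (fun p : R => 0 <= p < 1) P' -> {subset P <= P'} ->
    exists2 h0 : R, 0 < h0 & forall h : R, 0 < h < h0 ->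
      `|sqr_modulus g h - h * \sum_(p <- P') jump g p ^+ 2| <= eps * h].
Proof.
move=> e0; pose e1 := eps / (2 * (V + 1)).
have V1 : 0 < V + 1 by rewrite ltr_wpDl.
have e10 : 0 < e1 by rewrite divr_gt0// mulr_gt0.
have e1V : e1 * V <= eps / 2.
  have -> : eps / 2 = e1 * (V + 1) by rewrite /e1; field; rewrite gt_eqF.
  by rewrite ler_pM2l// lerDl.
have [P [P01 [h1 h10 hP]]] := bv_small_increments gT e10.
exists (undup P); split; first exact: undup_uniq.
  by apply/allP => p; rewrite mem_undup; exact: (allP P01).
move=> P' uP' P'01 PP'.
pose n : R := (size P')%:R.
pose e2 := Num.min 1 (eps / (2 * (2 * V + n + 1))).
have n0 : 0 <= n by [].
have D0 : 0 < 2 * V + n + 1 by rewrite ltr_wpDl// addr_ge0// mulr_ge0.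
have e20 : 0 < e2 by rewrite lt_min ltr01 divr_gt0// mulr_gt0.
have e2n : 2 * e2 * V + e2 ^+ 2 * n <= eps / 2.
  apply: (@le_trans _ _ (e2 * (2 * V + n + 1))).
    have : e2 ^+ 2 * n <= e2 * n by rewrite ler_wpM2r// expr2 ler_piMr ?(ltW e20)// /e2 ge_min lexx.
    by have := ltW e20; rewrite !mulrDr mulr1; lra.
  rewrite (_ : eps / 2 = eps / (2 * (2 * V + n + 1)) * (2 * V + n + 1)).
    by rewrite ler_pM2r// /e2 ge_min lexx orbT.
  by field; rewrite gt_eqF.
have [h2 h20 hJ] := bv_jump_increments P' e20.
have [h3 h30 hS] := separated P'.
have [h4 h40 hB] : exists2 h4 : R, 0 < h4 & forall p, p \in P' -> p + h4 <= 1.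
  elim: P' P'01 {uP' PP' n e2 n0 D0 e20 e2n hJ hS} => [_|p P' IH /= /andP[/andP[p0 p1]]].
    by exists 1.
  move=> /IH[h4 h40 h4P]; exists (Num.min h4 (1 - p)); first by rewrite lt_min h40 subr_gt0.
  move=> q; rewrite in_cons => /orP[/eqP->|/h4P]; first by rewrite -lerBrDl ge_min lexx orbT.
  by rewrite -!lerBrDl => qh; rewrite ge_min qh.
exists (Num.min (Num.min h1 h2) (Num.min h3 h4)); first by rewrite !lt_min h10 h20 h30.
move=> h /andP[hp]; rewrite !lt_min => /andP[/andP[hh1 hh2] /andP[hh3 hh4]].
pose D x := g x - g (x - h).
have bD : bounded_mfun D.
  by apply: bounded_mfunB => //; apply: (bounded_mfun_shift (- h)).
have bJ (c : R -> R) : bounded_mfun (fun x => \sum_(p <- P') c p * \1_(`]p, p + h[%classic) x).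
  by apply: bounded_mfun_sum => p; apply: bounded_mfunZ; exact: bounded_mfun_indic.
have iJ (c : R -> R) : torus_integral (fun x => \sum_(p <- P') c p * \1_(`]p, p + h[%classic) x)
    = h * \sum_(p <- P') c p.
  rewrite torus_integral_sum; last first.
    by move=> p; apply: bounded_mfunZ; exact: bounded_mfun_indic.
  rewrite mulr_sumr; apply: eq_big_seq => p pP'.
  have /andP[p0 p1] := allP P'01 _ pP'.
  rewrite torus_integralZ; last exact: bounded_mfun_indic.
  rewrite torus_integral_indic//; first by ring.
    by rewrite lerDl ltW.
  by rewrite (le_trans _ (hB _ pP'))// lerD2l ltW.
have -> : sqr_modulus g h - h * \sum_(p <- P') jump g p ^+ 2 = torus_integral
    (fun x => D x ^+ 2 - \sum_(p <- P') jump g p ^+ 2 * \1_(`]p, p + h[%classic) x).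
  by rewrite torus_integralB ?iJ//; exact: bounded_mfunX.
have bE : bounded_mfun (fun x => D x ^+ 2 -
    \sum_(p <- P') jump g p ^+ 2 * \1_(`]p, p + h[%classic) x).
  by apply: bounded_mfunB => //; exact: bounded_mfunX.
apply: (le_trans (le_norm_torus_integral bE)).
(* [e1] bounds the increments off the intervals that follow the points of [P'],
   [e2] their distance to the jump on these intervals *)
apply: (@le_trans _ _ (torus_integral (fun x => (e1 + 2 * e2) * `|D x| +
   \sum_(p <- P') e2 ^+ 2 * \1_(`]p, p + h[%classic) x))); last first.
  rewrite torus_integralD ?iJ//; last first.
    by apply: bounded_mfunZ; exact: bounded_mfun_norm.
  rewrite torus_integralZ; last exact: bounded_mfun_norm.
  have hD : torus_integral (fun x => `|D x|) <= V * h.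
    have := bv_L1_modulus pg gT (- h); rewrite normrN gtr0_norm//.
    by under eq_fun do rewrite distrC.
  rewrite big_const_seq count_predT iter_addr_0 -[X in h * X]mulr_natr -/n.
  have : (e1 + 2 * e2) * torus_integral (fun x => `|D x|) <= (e1 + 2 * e2) * (V * h).
    by rewrite ler_pM2l// addr_gt0// mulr_gt0.
  move=> h5; apply: (le_trans (lerD h5 (lexx _))).
  have -> : (e1 + 2 * e2) * (V * h) + h * (e2 ^+ 2 * n) =
     (e1 * V + (2 * e2 * V + e2 ^+ 2 * n)) * h by ring.
  by rewrite ler_pM2r// [eps]splitr lerD.
apply: ae_le_torus_integral.
- exact: bounded_mfun_norm.
- by apply: bounded_mfunD => //; apply: bounded_mfunZ; exact: bounded_mfun_norm.
pose E := 1 :: P' ++ [seq p + h | p <- P'].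
apply: (negligibleS _ (finite_seq_negligible E)) => x /= nx.
apply: contrapT => /negP xE; apply: nx => /andP[x0 x1].
move: xE; rewrite /E inE mem_cat !negb_or => /and3P[xn1 xP' xP'h].
have {x1 xn1} x1 : x < 1 by rewrite lt_neqAle xn1.
have Dn0 : 0 <= `|D x| by [].
have [|/hasPn nc] := boolP (has (fun p => p < x < p + h) P').
  move=> /hasP[p pP' pxh].
  have other q : q \in P' -> q != p -> (\1_(`]q, q + h[%classic) x : R) = 0.
    move=> qP' qp; rewrite indicE; case: (boolP (x \in _)) => //.
    rewrite inE/= in_itv/= => /andP[qx xqh].
    have := hS _ _ qP' pP' qp; case/andP: pxh => px xph.
    by rewrite leNgt ltr_norml; move/negP; case; apply/andP; split; lra.
  have one : (\1_(`]p, p + h[%classic) x : R) = 1.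
    by rewrite indicE mem_set//= in_itv.
  have sum (c : R -> R) : \sum_(q <- P') c q * \1_(`]q, q + h[%classic) x = c p.
    rewrite (bigD1_seq p)//= one mulr1 big_seq_cond big1 ?addr0// => q /andP[qP' qp].
    by rewrite other ?mulr0.
  rewrite !sum.
  have := hJ h x p _ pP' pxh; rewrite hp => /(_ hh2) hjx.
  have := ler_sqrB hjx; have := mulr_ge0 (ltW e10) Dn0.
  by rewrite mulrDl; lra.
have sum0 (c : R -> R) : \sum_(q <- P') c q * \1_(`]q, q + h[%classic) x = 0.
  rewrite big_seq_cond big1// => q /andP[qP' _]; rewrite indicE.
  have := nc q qP'; case: (boolP (x \in _)); last by rewrite mulr0.
  by rewrite inE/= in_itv/= => ->.
rewrite !sum0 subr0 addr0 normrX expr2.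
have Dx : `|D x| <= e1.
  apply: hP; rewrite ?hp ?x0//.
    move=> p pP; have pP' : p \in P' by apply: PP'; rewrite mem_undup.
    split; first by apply: contraNneq xP' => ->.
    by apply: contraNneq xP'h => ->; apply: map_f.
  by move=> p pP; apply: nc; apply: PP'; rewrite mem_undup.
apply: ler_wpM2r => //; rewrite (le_trans Dx)// lerDl mulr_ge0// ltW//.
Qed.

(** The finite sums of squared jumps are comparable with one and the same
    quantity, the quadratic modulus at a small step divided by this step; hence
    they are bounded and close to their supremum. *)
Lemma sqr_modulus_cvg : (\esum_(x in jump_points g) ((`|jump g x| ^+ 2)%:E) < +oo)%E /\
  forall eps : R, 0 < eps -> exists2 h0 : R, 0 < h0 & forall h : R, 0 < h < h0 ->
  `|sqr_modulus g h - h * fine (\esum_(x in jump_points g) ((`|jump g x| ^+ 2)%:E))|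
     <= eps * h.
Proof.
set S := (\esum_(x in _) _)%E.
(* both bounds on S below follow from comparing the sums over two finite sets *)
have key (eps : R) : 0 < eps -> exists P : seq R, [/\ uniq P, all (fun p : R => 0 <= p < 1) P,
   (S <= (\sum_(p <- P) jump g p ^+ 2 + 2 * eps)%:E)%E &
   exists2 h0 : R, 0 < h0 & forall h : R, 0 < h < h0 ->
      `|sqr_modulus g h - h * \sum_(p <- P) jump g p ^+ 2| <= eps * h].
  move=> e0; have [P [uP P01 PH]] := sqr_modulus_jumps e0.
  exists P; split => //; last exact: PH.
  apply: ub_ereal_sup => _ /= [A [fA AJ] <-].
  have [s us As] : exists2 s : seq R, uniq s & A = [set` s].
    by exists (finmap.enum_fset (fset_set A)); rewrite ?finmap.fset_uniq// -[LHS]fset_setK.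
  have -> : \sum_(x \in A) (`|jump g x| ^+ 2)%:E = (\sum_(x <- s) jump g x ^+ 2)%:E.
    rewrite As -fsbig_seq// -sumEFin; apply: eq_bigr => x _.
    by rewrite real_normK ?num_real.
  pose P' := undup (P ++ s).
  have uP' : uniq P' by exact: undup_uniq.
  have P'01 : all (fun p : R => 0 <= p < 1) P'.
    apply/allP => p; rewrite mem_undup mem_cat => /orP[/(allP P01)//|ps].
    by have [] : jump_points g p by apply: AJ; rewrite As.
  have [h0 h00 H0] := PH P uP P01 (fun x h => h).
  have [h1 h10 H1] : exists2 h0 : R, 0 < h0 & forall h : R, 0 < h < h0 ->
      `|sqr_modulus g h - h * \sum_(p <- P') jump g p ^+ 2| <= eps * h.
    by apply: PH => // p pP; rewrite mem_undup mem_cat pP.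
  pose h := Num.min h0 h1 / 2.
  have m0 : 0 < Num.min h0 h1 by rewrite lt_min h00.
  have hp : 0 < h by rewrite divr_gt0.
  have hm : h < Num.min h0 h1 by rewrite /h; lra.
  have {}hm : (h < h0) /\ (h < h1) by move: hm; rewrite lt_min => /andP.
  have := H0 h; rewrite hp hm.1 => /(_ isT) H0h.
  have := H1 h; rewrite hp hm.2 => /(_ isT) H1h.
  have sP' : \sum_(x <- s) jump g x ^+ 2 <= \sum_(p <- P') jump g p ^+ 2.
    apply: ler_sum_uniq_sub => // [p ps|p]; last exact: sqr_ge0.
    by rewrite mem_undup mem_cat ps orbT.
  rewrite lee_fin (le_trans sP')// -(ler_pM2l hp).
  have := ler_norm (sqr_modulus g h - h * \sum_(p <- P) jump g p ^+ 2).
  have := ler_norm (h * \sum_(p <- P') jump g p ^+ 2 - sqr_modulus g h).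
  rewrite [X in _ <= X]distrC mulrDr.
  have -> : h * (2 * eps) = eps * h + eps * h by ring.
  by lra.
have Sge (P : seq R) : uniq P -> all (fun p : R => 0 <= p < 1) P ->
    ((\sum_(p <- P) jump g p ^+ 2)%:E <= S)%E.
  move=> uP P01; pose s := [seq p <- P | jump g p != 0].
  apply: ereal_sup_ubound; exists [set` s]; first split.
  - exact: finite_seq.
  - move=> p /=; rewrite mem_filter => /andP[jp pP]; split => //.
    exact: (allP P01).
  - rewrite -fsbig_seq ?filter_uniq// -sumEFin big_filter big_mkcond/=.
    apply: eq_bigr => p _; rewrite real_normK ?num_real//.
    by case: eqVneq => //= ->; rewrite expr0n.
have S0 : (0 <= S)%E by apply: esum_ge0 => x _; rewrite lee_fin sqr_ge0.
have Sfin : (S < +oo)%E.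
  by have [P [_ _ h _]] := key 1 ltr01; apply: (le_lt_trans h); rewrite ltry.
split => // eps e0; have e40 : 0 < eps / 4 by rewrite divr_gt0.
have [P [uP P01 SP [h0 h00 H]]] := key _ e40.
exists h0 => // h hh; have /andP[hp _] := hh.
have := Sge P uP P01; move: SP.
have -> : S = (fine S)%:E by rewrite fineK// ge0_fin_numE.
rewrite !lee_fin => Sle Sge'.
have := H h hh; set q := sqr_modulus g h; set sP := \sum_(p <- P) _ in Sle Sge' *.
rewrite !ler_norml => /andP[a b].
have c1 : h * fine S <= h * (sP + 2 * (eps / 4)) by rewrite ler_pM2l.
have c2 : h * sP <= h * fine S by rewrite ler_pM2l.
move: c1; rewrite mulrDr (_ : h * (2 * (eps / 4)) = eps * h / 2); last by field.
rewrite (_ : eps / 4 * h = eps * h / 4) in a b; last by field.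
have : 0 < eps * h by rewrite mulr_gt0.
by move=> ? ?; apply/andP; split; lra.
Qed.

End quadratic_modulus.

(** * Trigonometric inequalities and symmetric windows of integers *)

Section trigonometric_inequalities.
Variable R : realType.
Implicit Types x s : R.

Lemma nondecreasing_of_derive (f f' : R -> R) :
  (forall x, is_derive x 1 f (f' x)) -> (forall x, 0 <= x -> 0 <= f' x) ->
  forall x, 0 <= x -> f 0 <= f x.
Proof.
move=> df f'0 x x0.
apply: (@ger0_derive1_le_cc _ f 0 x); rewrite ?in_itv/= ?lexx ?x0//.
- by move=> y; rewrite in_itv/= => /andP[y0 _]; rewrite derive1E derive_val f'0// ltW.
- apply: continuous_subspaceT => y; apply: differentiable_continuous.
  by apply/derivable1_diffP; have := df y; case.
Qed.

Lemma sin_le_id x : 0 <= x -> sin x <= x.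
Proof.
move=> x0; rewrite -subr_ge0.
have := @nondecreasing_of_derive (fun y => y - sin y) (fun y => 1 - cos y) _ _ x x0.
rewrite sin0 subr0; apply.
by move=> y _; rewrite subr_ge0 cos_le1.
Qed.

Lemma cos_ge_quad x : 0 <= x -> 1 - x ^+ 2 / 2 <= cos x.
Proof.
move=> x0; rewrite -subr_ge0.
have := @nondecreasing_of_derive (fun y => cos y - (1 - y ^+ 2 / 2))
  (fun y => - sin y + y) _ _ x x0.
rewrite cos0 expr0n/= mul0r subr0 subrr; apply.
- move=> y; apply: is_derive_eq.
  by rewrite /GRing.scale/=; field.
- by move=> y y0; rewrite addrC subr_ge0 sin_le_id.
Qed.

Lemma sin_ge_cubic x : 0 <= x -> x - x ^+ 3 / 6 <= sin x.
Proof.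
move=> x0; rewrite -subr_ge0.
have := @nondecreasing_of_derive (fun y => sin y - (y - y ^+ 3 / 6))
  (fun y => cos y - (1 - y ^+ 2 / 2)) _ _ x x0.
rewrite sin0 expr0n/= mul0r !subr0; apply.
- move=> y; apply: is_derive_eq.
  by rewrite /GRing.scale/=; field.
- by move=> y y0; rewrite subr_ge0 cos_ge_quad.
Qed.

Lemma sin_ge_third x : 0 <= x <= 2 -> x / 3 <= sin x.
Proof.
move=> /andP[x0 x2]; apply: le_trans (sin_ge_cubic x0).
rewrite -subr_ge0.
have -> : x - x ^+ 3 / 6 - x / 3 = x * (4 - x ^+ 2) / 6 by field.
rewrite divr_ge0// mulr_ge0// subr_ge0.
by rewrite (_ : 4 = 2 ^+ 2 :> R) ?ler_sqr ?nnegrE//; ring.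
Qed.

Lemma normc_1Be2pi s : normc (1 - e2pi s) = 2 * `|sin (pi * s)|.
Proof.
apply/eqP; rewrite -(@eqrXn2 _ 2) ?normc_ge0 ?mulr_ge0//; apply/eqP.
rewrite sqr_normc_1Be2pi exprMn real_normK ?num_real//.
rewrite (_ : 2 * pi * s = (pi * s) *+ 2); last by ring.
rewrite cos_mulr2n; have := cos2Dsin2 (pi * s).
by move: (cos _) (sin _) => c d h; rewrite mulr2n (_ : c ^+ 2 = 1 - d ^+ 2); [ring|lra].
Qed.

Lemma pi_lt4 : (pi : R) < 4.
Proof. by have := @pihalf_lt2 R; rewrite ltr_pdivrMr//; lra. Qed.

(** For [|s| <= 1/2] the sine of [pi |s|] is at least [pi |s| / 3], as [pi / 2] is
    less than [2], and [2 pi / 3] exceeds [1]. *)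
Lemma normc_1Be2pi_ge s : `|s| <= 2^-1 -> `|s| <= normc (1 - e2pi s).
Proof.
move=> s2; rewrite normc_1Be2pi.
have -> : `|sin (pi * s)| = `|sin (pi * `|s|)|.
  have [s0|s0] := leP 0 s; first by rewrite (ger0_norm s0).
  by rewrite (ltr0_norm s0) mulrN sinN normrN.
have ps0 : 0 <= pi * `|s| by rewrite mulr_ge0// pi_ge0.
have ps2 : pi * `|s| <= 2.
  have := pi_lt4; have := @pi_ge2 R; move: s2 (normr_ge0 s) => s2 s0 p2 p4.
  apply: (@le_trans _ _ (4 * 2^-1)); last by rewrite -[4]/(2 * 2)%:R; lra.
  by rewrite ler_pM// ?pi_ge0// ltW.
have h := @sin_ge_third (pi * `|s|); rewrite ps0 ps2 in h; have {}h := h isT.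
have h1 : 2 * `|s| <= pi * `|s| by rewrite ler_wpM2r// pi_ge2.
by have := ler_norm (sin (pi * `|s|)); have := normr_ge0 s; lra.
Qed.

End trigonometric_inequalities.

Section integer_windows.
Implicit Types (N M : nat) (n : int).

Definition zrange N : seq int := [seq k%:Z - N%:Z | k <- iota 0 N.*2.+1].

Lemma mem_zrange N n : (n \in zrange N) = (`|n| <= N)%N.
Proof.
apply/mapP/idP => [[k]|nN]; first by rewrite mem_iota => kN ->; lia.
exists (absz (n + N%:Z)); last by lia.
by rewrite mem_iota; lia.
Qed.

Lemma zrange_uniq N : uniq (zrange N).
Proof. by rewrite map_inj_uniq ?iota_uniq// => i j; lia. Qed.

Lemma big_zrange (V : nmodType) N (F : int -> V) :
  \sum_(n <- zrange N) F n = \sum_(k < N.*2.+1) F (k%:Z - N%:Z).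
Proof. by rewrite big_map -/(index_iota 0 N.*2.+1) big_mkord. Qed.

Lemma zrange_opp N : perm_eq (zrange N) [seq - n | n <- zrange N].
Proof.
apply: uniq_perm; first exact: zrange_uniq.
  by rewrite map_inj_uniq ?zrange_uniq//; exact: oppr_inj.
move=> n; rewrite mem_zrange; apply/idP/mapP => [nN|[m mN ->]].
  by exists (- n); rewrite ?mem_zrange ?opprK// abszN.
by rewrite abszN -mem_zrange.
Qed.

Lemma big_zrange_opp (V : nmodType) N (F : int -> V) :
  \sum_(n <- zrange N) F (- n) = \sum_(n <- zrange N) F n.
Proof. by rewrite [RHS](perm_big _ (zrange_opp N)) [RHS]big_map. Qed.

Lemma big_zrangeS (V : nmodType) N (F : int -> V) :
  \sum_(n <- zrange N.+1) F n =
  \sum_(n <- zrange N) F n + (F N.+1%:Z + F (- N.+1%:Z)).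
Proof.
rewrite (perm_big (zrange N ++ [:: N.+1%:Z; - N.+1%:Z])).
  by rewrite big_cat/= big_cons big_cons big_nil addr0.
apply: uniq_perm; first exact: zrange_uniq.
  rewrite cat_uniq zrange_uniq andTb; apply/andP; split; last by [].
  by rewrite -all_predC /= !mem_zrange; lia.
by move=> n; rewrite mem_cat !mem_zrange !inE; lia.
Qed.

Lemma big_zrange0 (V : nmodType) (F : int -> V) : \sum_(n <- zrange 0) F n = F 0.
Proof. by rewrite big_zrange big_ord1. Qed.

Lemma big_zrange_split (V : nmodType) N (F : int -> V) :
  \sum_(n <- zrange N) F n =
  F 0 + \sum_(1 <= k < N.+1) (F k%:Z + F (- k%:Z)).
Proof.
elim: N => [|N IHN]; first by rewrite big_zrange0 big_geq// addr0.
rewrite big_zrangeS IHN [in RHS]big_nat_recr//=.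
by rewrite -addrA.
Qed.

Lemma big_zrange_telescope (V : zmodType) N (F : int -> V) :
  \sum_(n <- zrange N) (F (n - 1) - F n) = F (- N%:Z - 1) - F N%:Z.
Proof.
elim: N => [|N IHN]; first by rewrite big_zrange0 oppr0 sub0r.
rewrite big_zrangeS IHN.
have -> : (N.+1%:Z - 1 = N%:Z)%R by lia.
have -> : (- N%:Z - 1 = - N.+1%:Z)%R by lia.
rewrite addrA [X in X + _]addrA addrNK [LHS]addrC addrA.
by rewrite addrNK.
Qed.

End integer_windows.

(** * Fourier coefficients *)

Section uniform_and_fubini.
Variable R : realType.
Local Notation mu := (@lebesgue_measure R).
Local Notation P := (uniform_prob (@ltr01 R)).

Lemma integral_uniform_torus (f : R -> R) : bounded_mfun f ->
  (\int[P]_x (f x)%:E = (torus_integral f)%:E)%E.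
Proof.
move=> bf; have [mf [C fC]] := bf.
have bfC : bounded_mfun (fun x => f x + C).
  by apply: bounded_mfunD => //; exact: bounded_mfun_cst.
have -> : (fun x => (f x)%:E) = (fun x => ((f x + C)%:E - C%:E)%E).
  by apply/funext => x; rewrite -EFinB addrK.
rewrite integralB//=; last 2 first.
- exact: bounded_mfun_uniform.
- exact: (bounded_mfun_uniform (bounded_mfun_cst C)).
rewrite integral_cst//= probability_setT mule1.
rewrite (@integral_uniform _ _ _ _ (fun x => (f x + C)%:E)); last 2 first.
- by apply/measurable_EFinP; exact: bfC.1.
- by move=> x; rewrite lee_fin -lerBlDr sub0r; have := fC x; rewrite ler_norml => /andP[].
rewrite torus_integralE// subr0 invr1 mul1e torus_integralD//; last exact: bounded_mfun_cst.
by rewrite torus_integral_cst -EFinB addrK.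
Qed.

Lemma torus_integral_fubini (K : R -> R -> R) (C : R) :
  measurable_fun [set: R * R] (fun z => K z.1 z.2) ->
  (forall x y, `|K x y| <= C) ->
  torus_integral (fun x => torus_integral (K x)) =
  torus_integral (fun y => torus_integral (K ^~ y)).
Proof.
move=> mK KC.
have b1 x : bounded_mfun (K x).
  split; last by exists C.
  exact: (measurableT_comp mK (measurable_pair1 x)).
have b2 y : bounded_mfun (K ^~ y).
  split; last by exists C.
  exact: (measurableT_comp mK (measurable_pair2 y)).
pose f (z : R * R) := (K z.1 z.2)%:E.
have intK : (P \x P)%E.-integrable setT f.
  apply: measurable_bounded_integrable => //.
    rewrite (_ : [set: _] = setT `*` setT); last by apply/seteqP; split.
    have E : (P \x P)%E (setT `*` setT) = 1%E.
      have P1 : P setT = 1%E by exact: probability_setT.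
      transitivity (P setT * P setT)%E; last by rewrite P1 mule1.
      by rewrite product_measure1E.
    by change ((P \x P)%E (setT `*` setT) < +oo)%E; rewrite E ltry.
  exists C; split; first exact: num_real.
  by move=> M CM z /= _; rewrite (le_trans (KC _ _))// ltW.
have mF := measurable_fubini_F intK; have mG := measurable_fubini_G intK.
have bF : bounded_mfun (fun x => torus_integral (K x)).
  split.
    apply/measurable_EFinP; move: mF; congr (measurable_fun _ _).
    by apply/funext => x; exact: (integral_uniform_torus (b1 x)).
  exists C => x; rewrite (le_trans (le_norm_torus_integral (b1 x)))//.
  rewrite -[leRHS]torus_integral_cst; apply: le_torus_integral => //.
    exact: bounded_mfun_norm.
  exact: bounded_mfun_cst.
have bG : bounded_mfun (fun y => torus_integral (K ^~ y)).
  split.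
    apply/measurable_EFinP; move: mG; congr (measurable_fun _ _).
    by apply/funext => x; exact: (integral_uniform_torus (b2 x)).
  exists C => x; rewrite (le_trans (le_norm_torus_integral (b2 x)))//.
  rewrite -[leRHS]torus_integral_cst; apply: le_torus_integral => //.
    exact: bounded_mfun_norm.
  exact: bounded_mfun_cst.
have := Fubini intK; rewrite /f/=.
under eq_integral do rewrite integral_uniform_torus//.
under [X in _ = X -> _]eq_integral do rewrite integral_uniform_torus//.
by rewrite !integral_uniform_torus// => -[].
Qed.

End uniform_and_fubini.

Section fourier_coefficients.
Variable R : realType.
Implicit Types (F : R -> R[i]) (f : R -> R) (n : int) (h : R).
Local Notation cint := (@torus_cintegral R).

Definition cfourier_coef F n : R[i] := cint (fun x => F x * e2pi (- (n%:~R * x))).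

Lemma fourier_coefE f n : fourier_coef f n = cfourier_coef (fun x => (f x)%:C) n.
Proof. by []. Qed.

Lemma bounded_cfun_e2piN (a : R) : bounded_cfun (fun x : R => e2pi (- (a * x))).
Proof. by under eq_fun do rewrite -mulNr; exact: bounded_cfun_e2piZ. Qed.

Lemma bounded_cfun_coef F n : bounded_cfun F ->
  bounded_cfun (fun x => F x * e2pi (- (n%:~R * x))).
Proof. by move=> bF; apply: bounded_cfunM => //; exact: bounded_cfun_e2piN. Qed.

Lemma cfourier_coefD F G n : bounded_cfun F -> bounded_cfun G ->
  cfourier_coef (fun x => F x + G x) n = cfourier_coef F n + cfourier_coef G n.
Proof.
move=> bF bG; rewrite /cfourier_coef; under eq_fun do rewrite mulrDl.
by rewrite torus_cintegralD//; exact: bounded_cfun_coef.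
Qed.

Lemma cfourier_coefB F G n : bounded_cfun F -> bounded_cfun G ->
  cfourier_coef (fun x => F x - G x) n = cfourier_coef F n - cfourier_coef G n.
Proof.
move=> bF bG; rewrite /cfourier_coef; under eq_fun do rewrite mulrBl.
by rewrite torus_cintegralB//; exact: bounded_cfun_coef.
Qed.

Lemma cfourier_coef_cst (z : R[i]) n :
  cfourier_coef (fun=> z) n = if n == 0 then z else 0.
Proof.
rewrite /cfourier_coef torus_cintegralZ; last exact: bounded_cfun_e2piN.
under eq_fun do rewrite -mulNr -mulrNz.
by rewrite torus_cintegral_e2pi oppr_eq0; case: eqP; rewrite ?mulr1 ?mulr0.
Qed.

Lemma fourier_coefB f1 f2 n : bounded_mfun f1 -> bounded_mfun f2 ->
  fourier_coef (fun x => f1 x - f2 x) n = fourier_coef f1 n - fourier_coef f2 n.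
Proof.
move=> b1 b2; rewrite !fourier_coefE -cfourier_coefB//; try exact: bounded_cfun_real.
by congr cfourier_coef; apply/funext => x; rewrite realcB.
Qed.

Lemma fourier_coef_shift f n h : bounded_mfun f -> periodic f 1 ->
  fourier_coef (fun x => f (x + h)) n = e2pi (n%:~R * h) * fourier_coef f n.
Proof.
move=> bf pf; rewrite !fourier_coefE /cfourier_coef.
have bF := bounded_cfun_coef n (bounded_cfun_real bf).
rewrite -torus_cintegralZ// -[RHS](@torus_cintegral_shift _ h); last 2 first.
- exact: bounded_cfunZ.
- move=> x /=; rewrite pf -!mulNr -!mulrNz.
  by have := @periodic_e2pi R (- n) 0 x; rewrite !addr0 => ->.
apply: eq_torus_cintegral => x _; rewrite mulrCA; congr (_ * _).
by rewrite -e2piD; congr e2pi; ring.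
Qed.

Lemma fourier_coefN f n : bounded_mfun f ->
  fourier_coef f (- n) = (fourier_coef f n)^*%C.
Proof.
move=> bf; rewrite !fourier_coefE /cfourier_coef -torus_cintegral_conj; last first.
  exact: bounded_cfun_coef (bounded_cfun_real bf).
apply: eq_torus_cintegral => x _; rewrite conjcM conjc_real -e2piN.
by rewrite mulrNz mulNr.
Qed.

Lemma le_normc_fourier_coef f n : bounded_mfun f ->
  normc (fourier_coef f n) <= torus_integral (fun x => `|f x|).
Proof.
move=> bf; rewrite fourier_coefE.
apply: (le_trans (le_normc_torus_cintegral (bounded_cfun_coef n (bounded_cfun_real bf)))).
rewrite le_eqVlt; apply/orP; left; apply/eqP; apply: eq_torus_integral => x _.
by rewrite Normc.normcM normc_e2pi mulr1 normc_real.
Qed.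

Lemma sqr_normcB (z w : R[i]) :
  normc (z - w) ^+ 2 = normc z ^+ 2 - 2 * complex.Re (z * w^*%C) + normc w ^+ 2.
Proof. by case: z w => [a b] [c d]; rewrite !sqr_normcE/=; ring. Qed.

(** The mean square of the difference of [F] and its partial Fourier sum is
    nonnegative. *)
Lemma bessel F (s : seq int) : bounded_cfun F -> uniq s ->
  \sum_(n <- s) normc (cfourier_coef F n) ^+ 2 <=
  torus_integral (fun x => normc (F x) ^+ 2).
Proof.
move=> bF us; set c := cfourier_coef F.
pose S x := \sum_(n <- s) c n * e2pi (n%:~R * x).
have bS : bounded_cfun S.
  by apply: bounded_cfun_sum => n; apply: bounded_cfunZ; exact: bounded_cfun_e2piZ.
have : 0 <= torus_integral (fun x => normc (F x - S x) ^+ 2).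
  by apply: torus_integral_ge0 => x; exact: sqr_ge0.
under eq_fun do rewrite sqr_normcB.
have bFS : bounded_cfun (fun x => F x * (S x)^*%C).
  by apply: bounded_cfunM => //; exact: bounded_cfun_conj.
rewrite torus_integralD; last 2 first.
- apply: bounded_mfunB; first exact: bounded_mfun_sqr_normc.
  by apply: bounded_mfunZ; exact: bFS.1.
- exact: bounded_mfun_sqr_normc.
rewrite torus_integralB; last 2 first.
- exact: bounded_mfun_sqr_normc.
- by apply: bounded_mfunZ; exact: bFS.1.
rewrite torus_integralZ; last exact: bFS.1.
have -> : torus_integral (fun x => complex.Re (F x * (S x)^*%C)) =
    \sum_(n <- s) normc (c n) ^+ 2.
  transitivity (complex.Re (cint (fun x => F x * (S x)^*%C))) => //.
  suff -> : cint (fun x => F x * (S x)^*%C) = (\sum_(n <- s) normc (c n) ^+ 2)%:C by [].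
  under eq_fun do rewrite /S conjc_sum mulr_sumr.
  rewrite torus_cintegral_sum; last first.
    move=> n; apply: bounded_cfunM => //; apply: bounded_cfun_conj.
    by apply: bounded_cfunZ; exact: bounded_cfun_e2piZ.
  rewrite realc_sum; apply: eq_bigr => n _.
  rewrite -mulc_conj mulrC /c -torus_cintegralZ; last exact: bounded_cfun_coef.
  by apply: eq_torus_cintegral => x _; rewrite conjcM -e2piN mulrCA.
have -> : torus_integral (fun x => normc (S x) ^+ 2) = \sum_(n <- s) normc (c n) ^+ 2.
  suff : (torus_integral (fun x => normc (S x) ^+ 2))%:C =
      (\sum_(n <- s) normc (c n) ^+ 2)%:C by case.
  rewrite torus_integral_sqr_trigpoly realc_sum; apply: eq_big_seq => n ns.
  rewrite (eq_bigl (fun m => m == n)); last by move=> m; rewrite eq_sym.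
  by rewrite -big_filter filter_pred1_uniq// big_seq1 mulc_conj.
by set a := \sum_(_ <- _) _; set b := torus_integral _; lra.
Qed.

(** By Bessel's inequality the squared moduli are summable along [l]. *)
Lemma riemann_lebesgue F (l : nat -> int) : bounded_cfun F -> injective l ->
  normc (cfourier_coef F (l k)) @[k --> \oo] --> 0.
Proof.
move=> bF il; pose u k := normc (cfourier_coef F (l k)) ^+ 2.
have : u @ \oo --> 0.
  apply: cvg_series_cvg_0; apply: nondecreasing_is_cvgn.
    apply/nondecreasing_seqP => n; rewrite /series/= big_nat_recr//= lerDl.
    exact: sqr_ge0.
  exists (torus_integral (fun x => normc (F x) ^+ 2)) => _ [N _ <-].
  rewrite /series/= /u -(big_map l xpredT (fun n => normc (cfourier_coef F n) ^+ 2)).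
  by apply: bessel => //; rewrite map_inj_uniq ?iota_uniq.
move=> /(continuous_cvg _ (@sqrt_continuous R 0)); rewrite sqrtr0.
apply: cvg_trans; apply: near_eq_cvg; apply: nearW => k.
by rewrite /u /= sqrtr_sqr ger0_norm// normc_ge0.
Qed.

Lemma near_half_int (s : R) : exists n : int, `|s - n%:~R| <= 2^-1.
Proof.
exists (Num.floor (s + 2^-1)); have /andP[] := floor_itv (s + 2^-1).
rewrite intrD mulr1z ler_norml; move: (_%:~R) => a h1 h2.
by apply/andP; split; lra.
Qed.

(** Dividing [F - F 0] by [e2pi - 1] leaves a bounded function, whose Fourier
    coefficients turn the partial sums at [0] into a telescoping sum. *)
Lemma lipschitz_fourier_inversion f (L : R) : bounded_mfun f -> periodic f 1 ->
  (forall s, `|f s - f 0| <= L * `|s|) ->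
  normc (\sum_(n <- zrange N) fourier_coef f n - (f 0)%:C) @[N --> \oo] --> 0.
Proof.
move=> bf pf fL.
pose d (s : R) := e2pi s - 1.
pose psi s := (f s - f 0)%:C / d s.
have reduce s : exists2 s', `|s'| <= 2^-1 & f s = f s' /\ e2pi s = e2pi s'.
  have [n hn] := near_half_int s; exists (s - n%:~R) => //; split.
    by rewrite -mulrNz periodic_int.
  by rewrite -mulrNz e2piD e2pi_int mulr1.
have L0 : 0 <= L.
  by have := fL 1; rewrite normr1 mulr1; apply: le_trans.
have fd s : `|f s - f 0| <= L * normc (d s).
  have [s' s'2 [-> es]] := reduce s; rewrite /d es normcB_sym.
  by rewrite (le_trans (fL s'))// ler_wpM2l// normc_1Be2pi_ge.
have psiL s : normc (psi s) <= L.
  have [d0|d0] := eqVneq (d s) 0.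
    by rewrite /psi d0 invr0 mulr0 Normc.normc0.
  rewrite /psi Normc.normcM Normc.normcV normc_real ler_pdivrMr//.
  by rewrite lt_neqAle normc_ge0 eq_sym normc_eq0 d0.
have bd : bounded_cfun d.
  apply: bounded_cfunB; last exact: bounded_cfun_cst.
  by have := @bounded_cfun_e2piZ R 1; under eq_fun do rewrite mul1r.
have bpsi : bounded_cfun psi.
  have mi : measurable_fun [set: R]
      (fun s => (complex.Re (d s) ^+ 2 + complex.Im (d s) ^+ 2)^-1).
    rewrite (_ : (fun s => _) = (@powR R ^~ (-1)) \o
       (fun s => complex.Re (d s) ^+ 2 + complex.Im (d s) ^+ 2)); last first.
      by apply/funext => s /=; rewrite powR_inv1// addr_ge0// sqr_ge0.
    apply: measurableT_comp; first exact: measurable_powR.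
    by apply: measurable_funD; apply: measurable_funX; [exact: bd.1.1|exact: bd.2.1].
  have mf0 : measurable_fun [set: R] (fun s => f s - f 0).
    by apply: measurable_funB => //; exact: bf.1.
  split; split.
  - rewrite (_ : (fun x => _) = (fun s => (f s - f 0) * (complex.Re (d s) *
        (complex.Re (d s) ^+ 2 + complex.Im (d s) ^+ 2)^-1))); last first.
      by apply/funext => s; rewrite /psi; case: (d s) => a b /=; rewrite !mul0r subr0.
    by apply: measurable_funM => //; apply: measurable_funM => //; exact: bd.1.1.
  - by exists L => x; rewrite (le_trans (ler_norm_Re _)).
  - rewrite (_ : (fun x => _) = (fun s => (f s - f 0) * (- complex.Im (d s) *
        (complex.Re (d s) ^+ 2 + complex.Im (d s) ^+ 2)^-1))); last first.
      apply/funext => s; rewrite /psi; case: (d s) => a b /=.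
      by rewrite mul0r addr0 mulNr.
    apply: measurable_funM => //; apply: measurable_funM => //.
    by apply: measurable_funN; exact: bd.2.1.
  - by exists L => x; rewrite (le_trans (ler_norm_Im _)).
have fE s : (f s)%:C = (f 0)%:C + d s * psi s.
  have [d0|d0] := eqVneq (d s) 0.
    rewrite d0 mul0r addr0; congr (_%:C); apply/eqP.
    by rewrite -subr_eq0 -normr_le0 (le_trans (fd s))// d0 Normc.normc0 mulr0.
  by rewrite /psi mulrCA mulfV// mulr1 -rmorphD/= addrC subrK.
(* multiplication by [e2pi] shifts the index of the Fourier coefficients by one *)
have cE n : fourier_coef f n = (if n == 0 then (f 0)%:C else 0) +
    (cfourier_coef psi (n - 1) - cfourier_coef psi n).
  rewrite fourier_coefE (_ : (fun x => _) = (fun s => (f 0)%:C + d s * psi s)); last first.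
    by apply/funext => s; exact: fE.
  rewrite cfourier_coefD; [|exact: bounded_cfun_cst|exact: bounded_cfunM].
  rewrite cfourier_coef_cst; congr (_ + _); rewrite /cfourier_coef.
  rewrite -torus_cintegralB; try exact: bounded_cfun_coef.
  apply: eq_torus_cintegral => x _.
  rewrite /d mulrBl mul1r mulrBl; congr (_ - _).
  rewrite mulrAC mulrC; congr (_ * _); rewrite -e2piD; congr e2pi.
  by rewrite intrB; ring.
have sumE N : \sum_(n <- zrange N) fourier_coef f n - (f 0)%:C =
    cfourier_coef psi (- N%:Z - 1) - cfourier_coef psi N%:Z.
  under eq_bigr do rewrite cE.
  rewrite big_split/= big_zrange_telescope addrAC -[RHS]add0r; congr (_ + _).
  rewrite (bigD1_seq 0) ?zrange_uniq ?mem_zrange//= big1 ?addr0 ?subrr//.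
  by move=> n /negbTE ->.
apply: (@squeeze_cvgr _ _ _ _ (fun=> 0) (fun N =>
    normc (cfourier_coef psi (- N%:Z - 1)) + normc (cfourier_coef psi N%:Z))).
- apply: nearW => N; rewrite normc_ge0 sumE (le_trans (le_normcD _ _))//.
  by rewrite normcN.
- exact: cvg_cst.
- rewrite -[0 in X in _ --> X]addr0; apply: cvgD.
    by apply: (@riemann_lebesgue psi (fun N => - N%:Z - 1)) => // i j; lia.
  by apply: (@riemann_lebesgue psi (fun N => N%:Z)) => // i j; lia.
Qed.

Lemma torus_cintegral_fubini (K : R -> R -> R[i]) (C : R) :
  measurable_fun [set: R * R] (fun z => complex.Re (K z.1 z.2)) ->
  measurable_fun [set: R * R] (fun z => complex.Im (K z.1 z.2)) ->
  (forall x y, normc (K x y) <= C) ->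
  cint (fun x => cint (K x)) = cint (fun y => cint (K ^~ y)).
Proof.
move=> mr mi KC; rewrite !torus_cintegralE /=; congr (_ +i* _).
  apply: (@torus_integral_fubini R (fun x y => complex.Re (K x y)) C) => // x y.
  exact: le_trans (ler_norm_Re _) _.
apply: (@torus_integral_fubini R (fun x y => complex.Im (K x y)) C) => // x y.
exact: le_trans (ler_norm_Im _) _.
Qed.

End fourier_coefficients.

(** * Fourier series of functions of bounded variation *)

Section bv_fourier.
Variable R : realType.
Variables (g T : R -> R) (V : R).
Hypothesis pg : periodic g 1.
Hypothesis gT : variation_majorant g T V.
Local Notation cint := (@torus_cintegral R).
Local Notation b n := (normc (fourier_coef g n) ^+ 2).

Let bg : bounded_mfun g := bv_bounded_mfun pg gT.

(** Unlike [g], its autocorrelation is Lipschitz continuous, so that its Fourier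
    series converges pointwise; its value at [0] gives Parseval's identity, and
    twice its decrease from [0] to [h] is the mean square of an increment. *)
Definition autocorrelation (f : R -> R) (h : R) : R :=
  torus_integral (fun x => f (x + h) * f x).

Let phi := autocorrelation g.

Lemma bounded_mfun_product h : bounded_mfun (fun x => g (x + h) * g x).
Proof. by apply: bounded_mfunM => //; exact: bounded_mfun_shift. Qed.

Lemma autocorrelation_lipschitz : exists L : R, forall s t : R,
  `|phi s - phi t| <= L * `|s - t|.
Proof.
have [C gC] := bg.2; exists (C * V) => s t.
have C0 : 0 <= C by exact: le_trans (gC 0).
rewrite /phi /autocorrelation -torus_integralB; try exact: bounded_mfun_product.
apply: (le_trans (le_norm_torus_integral _)).
  by apply: bounded_mfunB; exact: bounded_mfun_product.
have bD : bounded_mfun (fun x => `|g (x + (s - t)) - g x|).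
  by apply: bounded_mfun_norm; apply: bounded_mfunB => //; exact: bounded_mfun_shift.
have pD : periodic (fun x => `|g (x + (s - t)) - g x|) 1.
  by move=> x /=; rewrite addrAC !pg.
apply: (@le_trans _ _ (torus_integral (fun x => C * `|g (x + t + (s - t)) - g (x + t)|))).
  apply: le_torus_integral.
  - apply: bounded_mfun_norm.
    by apply: bounded_mfunB; exact: bounded_mfun_product.
  - by apply: bounded_mfunZ; exact: (bounded_mfun_shift t bD).
  - move=> x _; rewrite -mulrBl normrM mulrC (_ : x + t + (s - t) = x + s); last by ring.
    exact: ler_wpM2r.
rewrite torus_integralZ; last exact: (bounded_mfun_shift t bD).
by rewrite (torus_integral_shift t bD pD) -mulrA ler_wpM2l//; exact: (bv_L1_modulus pg gT).
Qed.

Lemma autocorrelation_periodic : periodic phi 1.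
Proof.
move=> h; apply: eq_torus_integral => x _.
by rewrite addrA pg.
Qed.

Lemma autocorrelation_bounded : bounded_mfun phi.
Proof.
have [C gC] := bg.2; have [L hL] := autocorrelation_lipschitz.
split.
  apply: continuous_measurable_fun => x; apply/cvgrPdist_le => e e0.
  have L0 : 0 <= L by have := hL 1 0; rewrite subr0 normr1 mulr1; apply: le_trans.
  exists (e / (L + 1)) => /=; first by rewrite divr_gt0// ltr_wpDl.
  move=> y xy; rewrite (le_trans (hL _ _))//.
  apply: (@le_trans _ _ ((L + 1) * `|x - y|)); first by rewrite ler_wpM2r// lerDl.
  by rewrite mulrC -ler_pdivlMr ?ltr_wpDl// ltW.
exists (C * C) => h.
apply: (le_trans (le_norm_torus_integral (bounded_mfun_product h))).
rewrite -[leRHS]torus_integral_cst; apply: le_torus_integral.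
- exact: bounded_mfun_norm (bounded_mfun_product h).
- exact: bounded_mfun_cst.
- by move=> x _; rewrite normrM ler_pM.
Qed.

Lemma fourier_coef_autocorrelation (n : int) : fourier_coef phi n = (b n)%:C.
Proof.
have [C gC] := bg.2.
pose K h x := (g (x + h) * g x)%:C * e2pi (- (n%:~R * h)).
transitivity (cint (fun h => cint (K h))).
  rewrite fourier_coefE; apply: eq_torus_cintegral => h _; rewrite /K.
  under [in RHS]eq_fun do rewrite mulrC.
  rewrite torus_cintegralZ ?torus_cintegral_real 1?mulrC//.
  exact/bounded_cfun_real/bounded_mfun_product.
have mgg : measurable_fun [set: R * R] (fun z => g (z.2 + z.1) * g z.2).
  apply: measurable_funM.
    apply: (@measurableT_comp _ _ _ _ _ _ g); first exact: bg.1.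
    by apply: measurable_funD; [exact: measurable_snd|exact: measurable_fst].
  by apply: (@measurableT_comp _ _ _ _ _ _ g); [exact: bg.1|exact: measurable_snd].
have me := @bounded_cfun_e2piN R n%:~R.
rewrite (@torus_cintegral_fubini _ K (C * C)); first last.
- move=> h x; rewrite /K Normc.normcM normc_e2pi mulr1 normc_real normrM.
  by rewrite ler_pM.
- rewrite /K; under eq_fun do rewrite complex_ImM/= mul0r addr0.
  apply: measurable_funM => //.
  by apply: (measurableT_comp me.2.1); exact: measurable_fst.
- rewrite /K; under eq_fun do rewrite complex_ReM/= mul0r subr0.
  apply: measurable_funM => //.
  by apply: (measurableT_comp me.1.1); exact: measurable_fst.
transitivity (cint (fun x => fourier_coef g n * ((g x)%:C * e2pi (n%:~R * x)))).
  apply: eq_torus_cintegral => x _.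
  rewrite (_ : K^~ x = (fun h => (g x)%:C * ((g (h + x))%:C * e2pi (- (n%:~R * h))))).
    rewrite torus_cintegralZ; last first.
      apply: bounded_cfun_coef; apply: bounded_cfun_real.
      exact: bounded_mfun_shift.
    rewrite -[X in _ * X](fourier_coefE (fun h => g (h + x))) fourier_coef_shift//.
    by ring.
  by apply/funext => h; rewrite /K [h + x]addrC realcM mulrAC mulrC.
rewrite torus_cintegralZ; last first.
  by apply: bounded_cfunM; [exact: bounded_cfun_real|exact: bounded_cfun_e2piZ].
rewrite -mulc_conj; congr (_ * _); rewrite -fourier_coefN// fourier_coefE.
by apply: eq_torus_cintegral => x _; rewrite mulrNz mulNr opprK.
Qed.

Lemma cvg_Re (u : nat -> R[i]) (l : R) :
  normc (u N - l%:C) @[N --> \oo] --> 0 -> complex.Re (u N) @[N --> \oo] --> l.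
Proof.
move=> h; apply/cvgrPdist_le => e e0.
have /cvgrPdist_le/(_ e e0) := h; apply: filterS => N.
rewrite sub0r normrN ger0_norm ?normc_ge0// => hN.
rewrite distrC (le_trans _ hN)// (le_trans _ (ler_norm_Re _))//.
by rewrite complex_ReD/=; case: (u N).
Qed.

Lemma fourier_coef_autocorrelation_cvg (h : R) :
  \sum_(n <- zrange N) complex.Re (e2pi (n%:~R * h)) * b n @[N --> \oo] --> phi h.
Proof.
have [L hL] := autocorrelation_lipschitz.
have := @lipschitz_fourier_inversion _ (fun s => phi (s + h)) L
  (bounded_mfun_shift h autocorrelation_bounded) _ _.
rewrite add0r => H.
have pp : periodic (fun s => phi (s + h)) 1.
  by move=> s /=; rewrite addrAC autocorrelation_periodic.
have lp s : `|phi (s + h) - phi h| <= L * `|s|.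
  by rewrite (le_trans (hL _ _))// addrK.
have {H} := cvg_Re (H pp lp); apply: cvg_trans; apply: near_eq_cvg; apply: nearW => N.
rewrite complex_Re_sum; apply: eq_bigr => n _.
rewrite fourier_coef_shift; [|exact: autocorrelation_bounded|exact: autocorrelation_periodic].
by rewrite fourier_coef_autocorrelation complex_ReM/= mulr0 subr0.
Qed.

Lemma parseval_bv :
  \sum_(n <- zrange N) b n @[N --> \oo] --> torus_integral (fun x => g x ^+ 2).
Proof.
have := @fourier_coef_autocorrelation_cvg 0.
rewrite /phi /autocorrelation.
under [X in torus_integral X]eq_fun do rewrite addr0 -expr2.
apply: cvg_trans; apply: near_eq_cvg; apply: nearW => N.
by apply: eq_bigr => n _; rewrite mulr0 e2pi0 mul1r.
Qed.

(** The quadratic modulus is [2 phi 0 - 2 phi h] for the autocorrelation [phi],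
    and [|1 - e2pi s|^2] is [2 - 2 cos (2 pi s)]. *)
Lemma parseval_increments (h : R) :
  \sum_(n <- zrange N) b n * normc (1 - e2pi (n%:~R * h)) ^+ 2 @[N --> \oo]
  --> sqr_modulus g h.
Proof.
have -> : sqr_modulus g h = 2 * phi 0 - 2 * phi h.
  have bgh := bounded_mfun_shift (- h) bg.
  rewrite /sqr_modulus; under eq_fun do rewrite sqrrB.
  rewrite torus_integralD; last 2 first.
  - apply: bounded_mfunB; first exact: bounded_mfunX.
    under eq_fun do rewrite -mulr_natl.
    by apply: bounded_mfunZ; exact: bounded_mfunM.
  - exact: bounded_mfunX.
  rewrite torus_integralB; last 2 first.
  - exact: bounded_mfunX.
  - under eq_fun do rewrite -mulr_natl.
    by apply: bounded_mfunZ; exact: bounded_mfunM.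
  under [X in _ - torus_integral X]eq_fun do rewrite -mulr_natl.
  rewrite torus_integralZ; last exact: bounded_mfunM.
  have E0 : torus_integral (fun x => g x ^+ 2) = phi 0.
    by apply: eq_torus_integral => x _; rewrite addr0 expr2.
  have E1 : torus_integral (fun x => g (x - h) ^+ 2) = phi 0.
    rewrite -E0 -[RHS](torus_integral_shift (- h))//; first exact: bounded_mfunX.
    by move=> x /=; rewrite pg.
  have E2 : torus_integral (fun x => g x * g (x - h)) = phi h.
    rewrite /phi /autocorrelation -[RHS](torus_integral_shift (- h)).
    - by apply: eq_torus_integral => x _; rewrite subrK.
    - exact: bounded_mfun_product.
    - by move=> x /=; rewrite addrAC !pg.
  by rewrite E0 E1 E2; ring.
have c0 := @fourier_coef_autocorrelation_cvg 0.
have ch := @fourier_coef_autocorrelation_cvg h.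
have c2 (v : nat -> R) (l : R) : v N @[N --> \oo] --> l -> 2 * v N @[N --> \oo] --> 2 * l.
  by move=> vl; apply: cvgM => //; exact: cvg_cst.
apply: cvg_trans (cvgB (c2 _ _ c0) (c2 _ _ ch)); apply: near_eq_cvg; apply: nearW => N.
transitivity (2 * \sum_(n <- zrange N) complex.Re (e2pi (n%:~R * 0)) * b n -
  2 * \sum_(n <- zrange N) complex.Re (e2pi (n%:~R * h)) * b n); first by [].
rewrite !mulr_sumr -sumrB; apply: eq_bigr => n _.
rewrite mulr0 e2pi0 sqr_normc_1Be2pi; move: (b n) => bn.
by rewrite (_ : complex.Re (1 : R[i]) = 1)//=; ring.
Qed.

Lemma fourier_coef_increment (n : int) (h : R) :
  fourier_coef (fun x => g (x + h) - g x) n = (e2pi (n%:~R * h) - 1) * fourier_coef g n.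
Proof.
rewrite fourier_coefB//; last exact: bounded_mfun_shift.
by rewrite fourier_coef_shift// mulrBl mul1r.
Qed.

(** The step [h] of half a wavelength, [1 / (2 |n|)], makes the multiplier
    [e2pi (n h) - 1] of an increment equal to [-2]. *)
Lemma fourier_coef_decay (n : int) : normc (fourier_coef g n) * `|n|%:~R <= V.
Proof.
have V0 : 0 <= V := majorant_mass_ge0 gT.
have [->|n0] := eqVneq n 0; first by rewrite normr0 mulr0.
have nR : n%:~R != 0 :> R by rewrite intr_eq0.
have np : (0 : R) < `|n%:~R| by rewrite normr_gt0.
have bD : bounded_mfun (fun x => g (x + 2^-1 / n%:~R) - g x).
  by apply: bounded_mfunB => //; exact: bounded_mfun_shift.
have := le_normc_fourier_coef n bD; rewrite fourier_coef_increment.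
rewrite [X in e2pi X]mulrC divfK// e2pi_half Normc.normcM.
have -> : normc (-1 - 1 : R[i]) = 2.
  rewrite (_ : -1 - 1 = (-2 : R)%:C :> R[i]); last by apply: eqc_Re_Im => /=; ring.
  by rewrite normc_real normrN ger0_norm.
move=> h; have {h} := le_trans h (bv_L1_modulus pg gT _).
rewrite normrM (normfV n%:~R) (@ger0_norm _ 2^-1)// mulrA ler_pdivlMr//.
rewrite intr_norm; have := normc_ge0 (fourier_coef g n).
have := mulr_ge0 (normc_ge0 (fourier_coef g n)) (ltW np).
by rewrite -mulrA; move: (normc _ * _) => a; lra.
Qed.

End bv_fourier.

(** * Logarithmic averages of Fourier coefficients *)

Local Arguments e2pi : simpl never.
Local Arguments conjc : simpl never.
Local Arguments fourier_coef : simpl never.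
Local Arguments Normc.normc : simpl never.

Section logarithmic_asymptotics.
Variable R : realType.
Implicit Types (u v : nat -> R) (L : R).

(** [u N = (L + o(1)) ln N], in a form that is insensitive to bounded
    perturbations of [u]. *)
Definition log_asymp u L : Prop := forall eps : R, 0 < eps ->
  exists C : R, forall N, (0 < N)%N -> `|u N - L * ln N%:R| <= eps * ln N%:R + C.

Definition harmonic_sum (N : nat) : R := \sum_(1 <= k < N) k%:R^-1.

Lemma ln_nat_ge0 (N : nat) : 0 <= ln (N%:R : R).
Proof.
case: N => [|N]; first by rewrite ln0.
by rewrite ln_ge0// ler1n.
Qed.

Lemma ln_succ_le (k : nat) : (0 < k)%N -> ln (k.+1%:R : R) - ln k%:R <= k%:R^-1.
Proof.
move=> k0; have kp : (0 : R) < k%:R by rewrite ltr0n.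
rewrite -ln_div ?posrE ?ltr0n//.
have -> : k.+1%:R / k%:R = 1 + k%:R^-1 :> R by rewrite -natr1; field; rewrite gt_eqF.
by apply: le_ln1Dx; rewrite (lt_trans (ltrN10 _))// invr_gt0.
Qed.

Lemma ln_succ_ge (k : nat) : (0 < k)%N -> k.+1%:R^-1 <= ln (k.+1%:R : R) - ln k%:R.
Proof.
move=> k0; have kp : (0 : R) < k%:R by rewrite ltr0n.
rewrite -[leRHS]opprB lerNr -ln_div ?posrE ?ltr0n//.
have -> : k%:R / k.+1%:R = 1 + - k.+1%:R^-1 :> R.
  by rewrite -natr1; field; rewrite gt_eqF// addr_gt0.
by apply: le_ln1Dx; rewrite ltrN2 invf_lt1 ?ltr0n// ltr1n.
Qed.

Lemma harmonic_sum_ge (N : nat) : (0 < N)%N -> ln (N%:R : R) <= harmonic_sum N.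
Proof.
case: N => // N _; elim: N => [|N IHN]; first by rewrite /harmonic_sum big_geq// ln1.
rewrite /harmonic_sum big_nat_recr//= -/(harmonic_sum N.+1).
by rewrite -(subrK (ln N.+1%:R) (ln N.+2%:R)) addrC lerD// ln_succ_le.
Qed.

Lemma harmonic_sum_le (N : nat) : (0 < N)%N -> harmonic_sum N <= 1 + ln (N%:R : R).
Proof.
have h (n : nat) : harmonic_sum n.+2 <= 1 + ln (n.+1%:R : R).
  elim: n => [|n IHn]; first by rewrite /harmonic_sum big_nat1 invr1 ln1 addr0.
  rewrite /harmonic_sum big_nat_recr//= -/(harmonic_sum n.+2).
  by rewrite -(subrK (ln n.+1%:R) (ln n.+2%:R)) [X in 1 + X]addrC addrA lerD// ln_succ_ge.
case: N => // -[|N] _; first by rewrite /harmonic_sum big_geq// ln1 addr0.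
rewrite (le_trans (h N))// lerD2l ler_ln ?posrE ?ltr0n// ler_nat//.
Qed.

Lemma log_asymp_harmonic u L :
  (forall eps : R, 0 < eps -> exists C : R, forall N, (0 < N)%N ->
    `|u N - L * harmonic_sum N| <= eps * harmonic_sum N + C) -> log_asymp u L.
Proof.
move=> H eps e0; have [C HC] := H eps e0; exists (C + `|L| + eps) => N N0.
have h1 := harmonic_sum_ge N0; have h2 := harmonic_sum_le N0.
have -> : u N - L * ln N%:R = (u N - L * harmonic_sum N) + L * (harmonic_sum N - ln N%:R).
  by ring.
apply: (le_trans (ler_normD _ _)).
have h3 : `|L * (harmonic_sum N - ln N%:R)| <= `|L|.
  by rewrite normrM ler_piMr// ger0_norm; lra.
have h4 : eps * harmonic_sum N <= eps * (1 + ln N%:R) by rewrite ler_pM2l.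
rewrite mulrDr mulr1 in h4.
by have := HC N N0; lra.
Qed.

Lemma cvg_ln_nat : ln (N%:R : R) @[N --> \oo] --> +oo.
Proof.
apply/cvgryPge => A; near=> N.
rewrite -[A]expRK ler_ln ?posrE ?expR_gt0//; last first.
  by rewrite ltr0n; near: N; exact: nbhs_infty_gt.
by near: N; exact: nbhs_infty_ger.
Unshelve. all: by end_near. Qed.

Lemma log_asymp_cvg u L : log_asymp u L -> u N / ln N%:R @[N --> \oo] --> L.
Proof.
move=> H; apply/cvgrPdist_le => e e0.
have e20 : 0 < e / 2 by rewrite divr_gt0.
have [C HC] := H _ e20.
near=> N.
have N0 : (0 < N)%N by near: N; exact: nbhs_infty_gt.
have l0 : 0 < ln (N%:R : R).
  by rewrite ln_gt0// ltr1n; near: N; exact: nbhs_infty_gt.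
have lC : C / (e / 2) <= ln N%:R.
  by near: N; move/cvgryPge : cvg_ln_nat; apply.
rewrite distrC -[L](mulfK (lt0r_neq0 l0)) -mulrBl normrM normfV (gtr0_norm l0).
rewrite ler_pdivrMr// (le_trans (HC N N0))//.
rewrite ler_pdivrMr// in lC.
by rewrite {2}(splitr e) mulrDl lerD2l mulrC.
Unshelve. all: by end_near. Qed.

Lemma log_asymp_bounded u v L (B : R) : log_asymp u L ->
  (forall N, (0 < N)%N -> `|v N - u N| <= B) -> log_asymp v L.
Proof.
move=> H uv eps e0; have [C HC] := H eps e0; exists (C + B) => N N0.
have -> : v N - L * ln N%:R = (u N - L * ln N%:R) + (v N - u N) by ring.
rewrite (le_trans (ler_normD _ _))// addrA; apply: lerD; [exact: HC|exact: uv].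
Qed.

Lemma log_asympZ u L (c : R) : log_asymp u L -> log_asymp (fun N => c * u N) (c * L).
Proof.
move=> H eps e0; have c1 : 0 < `|c| + 1 by rewrite ltr_wpDl.
have e10 : 0 < eps / (`|c| + 1) by rewrite divr_gt0.
have [C HC] := H _ e10; exists (`|c| * C) => N N0.
rewrite -mulrA -mulrBr normrM.
apply: (@le_trans _ _ (`|c| * (eps / (`|c| + 1) * ln N%:R + C))).
  by rewrite ler_wpM2l// HC.
rewrite mulrDr lerD2r mulrA ler_wpM2r ?ln_nat_ge0// mulrCA ler_piMr ?(ltW e0)//.
by rewrite ler_pdivrMr// mul1r lerDl.
Qed.

End logarithmic_asymptotics.

Section roots_of_unity.
Variable R : realType.

Lemma normc_1Be2piN (s : R) : normc (1 - e2pi (- s)) = normc (1 - e2pi s).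
Proof. by rewrite !normc_1Be2pi mulrN sinN normrN. Qed.

Lemma normc_1Be2pi_gt0 (s : R) : 0 < s < 1 -> 0 < normc (1 - e2pi s).
Proof.
move=> /andP[s0 s1]; rewrite normc_1Be2pi mulr_gt0// normr_gt0 gt_eqF//.
have p0 := @pi_gt0 R.
by apply: sin_gt0_pi; rewrite mulr_gt0//= -[ltRHS]mulr1 ltr_pM2l.
Qed.

Lemma sum_roots_of_unity (N : nat) (d : int) : (0 < N)%N -> (absz d < N)%N ->
  \sum_(k < N) e2pi (d%:~R * (k%:R / N%:R) : R) = (if d == 0 then N else 0)%:R.
Proof.
move=> N0 dN; have NR : (N%:R : R) != 0 by rewrite pnatr_eq0 -lt0n.
have [->|d0] := eqVneq d 0.
  under eq_bigr do rewrite mul0r e2pi0.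
  by rewrite sumr_const card_ord.
set w := e2pi (d%:~R / N%:R : R).
have wE (k : nat) : e2pi (d%:~R * (k%:R / N%:R)) = w ^+ k.
  by rewrite /w -e2piMn; congr e2pi; ring.
under eq_bigr do rewrite wE.
have w1 : 1 - w != 0.
  rewrite -normc_eq0.
  have aux (s : R) : 0 < `|s| < 1 -> normc (1 - e2pi s) != 0.
    have [s0|s0] := leP 0 s; first by rewrite ger0_norm// => /normc_1Be2pi_gt0/gt_eqF->.
    by rewrite ltr0_norm// => /normc_1Be2pi_gt0; rewrite normc_1Be2piN => /gt_eqF->.
  apply: aux; rewrite normrM normfV (@ger0_norm _ N%:R)// divr_gt0 ?normr_gt0 ?intr_eq0//=.
    by rewrite ltr_pdivrMr ?ltr0n// mul1r -intr_norm -abszE -pmulrn ltr_nat.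
  by rewrite ltr0n.
have := subrX1 w N; have -> : w ^+ N = 1.
  rewrite /w -e2piMn mulrC divfK// -[RHS](@e2pi_int R d); congr e2pi.
rewrite subrr => /esym/eqP; rewrite mulf_eq0 subr_eq0 eq_sym -subr_eq0 (negbTE w1)/=.
by move=> /eqP.
Qed.

(** For [n] congruent to [r] modulo [N], the quotient is the squared modulus of
    a geometric sum of [r] terms at a nontrivial [N]-th root of unity. Over all
    roots of unity these squares add up to [N r], and the trivial one
    contributes [r ^ 2]. *)
Lemma sum_fejer_quotients (N : nat) (n : int) (r : nat) : (0 < N)%N -> (r <= N)%N ->
  (exists q : int, n = q * N%:Z + r%:Z) ->
  \sum_(1 <= k < N) normc (1 - e2pi (n%:~R * (k%:R / N%:R) : R)) ^+ 2 /
     normc (1 - e2pi (k%:R / N%:R : R)) ^+ 2 = r%:R * (N%:R - r%:R) :> R.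
Proof.
move=> N0 rN [q nE]; have NR : (N%:R : R) != 0 by rewrite pnatr_eq0 -lt0n.
pose G (k : nat) : R := normc (\sum_(j < r) e2pi (j%:R * (k%:R / N%:R) : R)) ^+ 2.
have GE k : G k = normc (\sum_(j < r) e2pi (k%:R / N%:R : R) ^+ j) ^+ 2.
  by rewrite /G; under eq_bigr do rewrite e2piMn.
have termE k : (1 <= k < N)%N -> normc (1 - e2pi (n%:~R * (k%:R / N%:R) : R)) ^+ 2 /
     normc (1 - e2pi (k%:R / N%:R : R)) ^+ 2 = G k.
  move=> /andP[k0 kN].
  have kp : 0 < normc (1 - e2pi (k%:R / N%:R : R)).
    apply: normc_1Be2pi_gt0; rewrite divr_gt0 ?ltr0n//=.
    by rewrite ltr_pdivrMr ?ltr0n// mul1r ltr_nat.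
  have -> : e2pi (n%:~R * (k%:R / N%:R) : R) = e2pi (k%:R / N%:R) ^+ r.
    rewrite -e2piMn nE intrD intrM mulrDl e2piD.
    have -> : q%:~R * N%:~R * (k%:R / N%:R) = (q * k%:Z)%:~R :> R.
      by rewrite intrM -!pmulrn; field.
    by rewrite e2pi_int mul1r -pmulrn.
  rewrite normcB_sym subrX1 Normc.normcM normcB_sym exprMn mulrAC mulfV ?mul1r; last first.
    by rewrite expf_neq0// gt_eqF.
  by rewrite GE.
rewrite (eq_big_nat _ _ termE).
have tot : \sum_(k < N) G k = N%:R * r%:R.
  apply: complexI; rewrite realc_sum.
  under eq_bigr do rewrite sqr_normc_sum.
  rewrite exchange_big/=.
  under eq_bigr do rewrite exchange_big/=.
  transitivity (\sum_(i < r) (N%:R : R[i])).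
    apply: eq_bigr => i _; rewrite (bigD1 i)//= [X in _ + X]big1 ?addr0; last first.
      move=> j ji.
      have E : (i%:R - j%:R : R) = (i%:Z - j%:Z)%:~R by rewrite intrB -!pmulrn.
      under eq_bigr do rewrite -e2piB -mulrBl E.
      rewrite sum_roots_of_unity//.
        by case: eqP => // ij; case/eqP: ji; apply/val_inj => /=; lia.
      by have := ltn_ord i; have := ltn_ord j; lia.
    under eq_bigr do rewrite e2pi_conjK.
    by rewrite sumr_const card_ord.
  rewrite sumr_const card_ord -mulrnA realcM.
  by rewrite natrM; congr (_ * _); rewrite (rmorph_nat (real_complex R)).
have : \sum_(k < N) G k = G 0%N + \sum_(1 <= k < N) G k.
  by rewrite -(big_mkord xpredT G) big_ltn.
rewrite tot.
have -> : G 0%N = r%:R ^+ 2.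
  rewrite /G; under eq_bigr do rewrite mul0r mulr0 e2pi0.
  rewrite sumr_const card_ord.
  by rewrite -(rmorph_nat (real_complex R)) normc_real ger0_norm.
by move=> h; rewrite mulrBr -expr2 [r%:R * _]mulrC h addrAC subrr add0r.
Qed.

End roots_of_unity.

Section inverse_square_kernel.
Variable R : realType.

(** The kernel is [(2 sin (pi h))^-2], and [x ^ 2 - (sin x) ^ 2] is of order
    [x ^ 4]. *)
Lemma inverse_kernel_approx (h : R) : 0 < h <= 2^-1 ->
  `|(normc (1 - e2pi h) ^+ 2)^-1 - (4 * pi ^+ 2 * h ^+ 2)^-1| <= 1.
Proof.
move=> /andP[h0 h2]; rewrite normc_1Be2pi.
have p0 := @pi_gt0 R; have p4 := @pi_lt4 R.
set x := pi * h; have x0 : 0 < x by rewrite mulr_gt0.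
have x2 : x <= 2.
  apply: (@le_trans _ _ (4 * 2^-1)); last by lra.
  by rewrite ler_pM// ltW.
have s3 : x / 3 <= sin x by apply: sin_ge_third; rewrite ltW.
have s1 := sin_le_id (ltW x0); have sc := sin_ge_cubic (ltW x0).
have sp : 0 < sin x by apply: lt_le_trans s3; rewrite divr_gt0.
rewrite (gtr0_norm sp); set s := sin x in s3 s1 sc sp *.
have -> : 4 * pi ^+ 2 * h ^+ 2 = 4 * x ^+ 2 by rewrite /x; ring.
have -> : ((2 * s) ^+ 2)^-1 - (4 * x ^+ 2)^-1 = (x ^+ 2 - s ^+ 2) / (4 * x ^+ 2 * s ^+ 2).
  by field; rewrite !gt_eqF.
have d0 : 0 < 4 * x ^+ 2 * s ^+ 2 by rewrite !mulr_gt0// exprn_gt0.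
have n0 : 0 <= x ^+ 2 - s ^+ 2 by rewrite subr_ge0 ler_sqr ?nnegrE// ltW.
rewrite ger0_norm ?divr_ge0 ?(ltW d0)// ler_pdivrMr// mul1r.
have e1 : x ^+ 2 - s ^+ 2 <= x ^+ 3 / 6 * (2 * x).
  rewrite subr_sqr; apply: ler_pM; rewrite ?subr_ge0 ?addr_ge0//; try exact: ltW.
    by rewrite lerBlDr addrC -lerBlDr.
  lra.
apply: (le_trans e1).
have e2 : (x / 3) ^+ 2 <= s ^+ 2 by rewrite ler_sqr ?nnegrE ?divr_ge0// ltW.
have e3 : 4 * x ^+ 2 * (x / 3) ^+ 2 <= 4 * x ^+ 2 * s ^+ 2.
  by rewrite ler_pM2l// mulr_gt0// exprn_gt0.
apply: le_trans e3.
rewrite -subr_ge0.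
have -> : 4 * x ^+ 2 * (x / 3) ^+ 2 - x ^+ 3 / 6 * (2 * x) = x ^+ 4 / 9 by field.
by rewrite divr_ge0// exprn_ge0// ltW.
Qed.

Lemma sum_inverse_distances (N : nat) :
  \sum_(1 <= k < N) ((k%:R / N%:R)^-1 + (1 - k%:R / N%:R)^-1) =
  2 * N%:R * harmonic_sum R N.
Proof.
case: N => [|N]; first by rewrite big_geq// mulr0 mul0r.
have NR : (N.+1%:R : R) != 0 by rewrite pnatr_eq0.
have kR (k : nat) : (0 < k)%N -> (k%:R : R) != 0 by rewrite pnatr_eq0 -lt0n.
rewrite big_split/=.
have -> : \sum_(1 <= i < N.+1) (1 - i%:R / N.+1%:R)^-1 =
    \sum_(1 <= k < N.+1) (k%:R / N.+1%:R)^-1 :> R.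
  rewrite [RHS]big_nat_rev/=; apply: eq_big_nat => i /andP[i0 iN].
  congr (_^-1); rewrite add1n subSS.
  by rewrite natrB ?(ltnW iN)//; field.
rewrite -mulr2n /harmonic_sum -[LHS]mulr_natl -[RHS]mulrA; congr (_ * _).
rewrite mulr_sumr; apply: eq_big_nat => k /andP[k0 _].
by rewrite invf_div.
Qed.

End inverse_square_kernel.

Lemma cvg_sum_seq (R : realType) (J : Type) (s : seq J) (F : nat -> J -> R) (l : J -> R) :
  (forall j, F N j @[N --> \oo] --> l j) ->
  \sum_(j <- s) F N j @[N --> \oo] --> \sum_(j <- s) l j.
Proof.
move=> Fl; elim: s => [|j s IH].
  by under eq_fun do rewrite big_nil; rewrite big_nil; exact: cvg_cst.
under eq_fun do rewrite big_cons.
by rewrite big_cons; apply: cvgD.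
Qed.

Section logarithmic_wiener.
Variable R : realType.
Variables (b : int -> R) (Phi : R -> R) (J C B : R).
Hypothesis b_ge0 : forall n, 0 <= b n.
Hypothesis b_even : forall n, b (- n) = b n.
Hypothesis b_decay : forall n, n%:~R ^+ 2 * b n <= C.
Hypothesis PhiE : forall h, \sum_(n <- zrange N)
  b n * normc (1 - e2pi (n%:~R * h)) ^+ 2 @[N --> \oo] --> Phi h.
Hypothesis PhiJ : forall eps : R, 0 < eps -> exists2 h0 : R, 0 < h0 &
  forall h : R, 0 < h < h0 -> `|Phi h - h * J| <= eps * h.
Hypothesis PhiB : forall h, `|Phi h| <= B.

Let Phi_reflect h : Phi (1 - h) = Phi h.
Proof.
have E : (fun N => \sum_(n <- zrange N) b n * normc (1 - e2pi (n%:~R * (1 - h))) ^+ 2) =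
         (fun N => \sum_(n <- zrange N) b n * normc (1 - e2pi (n%:~R * h)) ^+ 2).
  apply/funext => N; apply: eq_bigr => n _; congr (_ * _ ^+ 2).
  by rewrite mulrBr mulr1 e2piD e2pi_int mul1r normc_1Be2piN.
have H1 := @PhiE (1 - h); rewrite E in H1.
exact: (cvg_unique (@Rhausdorff R) H1 (@PhiE h)).
Qed.

(** Near [0] the hypothesis on [Phi] applies; away from [0] the quotient is
    bounded. *)
Let quotient_half (eps : R) : 0 < eps -> exists K : R, forall h : R, 0 < h <= 2^-1 ->
  `|Phi h / normc (1 - e2pi h) ^+ 2 - J / (4 * pi ^+ 2) * h^-1| <= eps * h^-1 + K.
Proof.
move=> e0; have [h0 h00 H] := PhiJ e0.
have B0 : 0 <= B by exact: le_trans (PhiB 0).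
exists (B + (B + `|J|) / h0 ^+ 2) => h /andP[hp h2].
have p2 := @pi_ge2 R; have p0 := @pi_gt0 R.
have q0 : 0 < 4 * pi ^+ 2 * h ^+ 2 by rewrite !mulr_gt0// exprn_gt0.
have qh : h ^+ 2 <= 4 * pi ^+ 2 * h ^+ 2.
  rewrite ler_peMl ?sqr_ge0// (@le_trans _ _ (1 * 1 ^+ 2))//; first by rewrite expr1n mulr1.
  by rewrite ler_pM ?ler1n// ?ler_sqr ?nnegrE//; lra.
have -> : Phi h / normc (1 - e2pi h) ^+ 2 - J / (4 * pi ^+ 2) * h^-1 =
   Phi h * ((normc (1 - e2pi h) ^+ 2)^-1 - (4 * pi ^+ 2 * h ^+ 2)^-1) +
   (Phi h - h * J) / (4 * pi ^+ 2 * h ^+ 2).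
  rewrite mulrBr mulrBl addrA subrK; congr (_ - _).
  have hn : h != 0 by rewrite gt_eqF.
  have pn : (pi : R) != 0 by rewrite gt_eqF.
  move: (pi : R) pn => p pn; rewrite [J / _]mulrC.
  by field; rewrite hn pn.
apply: (le_trans (ler_normD _ _)); rewrite !normrM.
have t1 : `|Phi h| * `|(normc (1 - e2pi h) ^+ 2)^-1 - (4 * pi ^+ 2 * h ^+ 2)^-1| <= B.
  by rewrite -[leRHS]mulr1 ler_pM// inverse_kernel_approx// hp.
suff t2 : `|Phi h - h * J| * `|(4 * pi ^+ 2 * h ^+ 2)^-1| <=
    eps * h^-1 + (B + `|J|) / h0 ^+ 2 by lra.
rewrite normfV (gtr0_norm q0).
have ep : 0 <= eps * h^-1 by rewrite mulr_ge0 ?invr_ge0 ?(ltW e0) ?(ltW hp).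
have kp : 0 <= (B + `|J|) / h0 ^+ 2 by rewrite divr_ge0 ?addr_ge0 ?sqr_ge0.
have [hh0|hh0] := ltP h h0.
  apply: (@le_trans _ _ (eps * h^-1)); last by rewrite lerDl.
  apply: (@le_trans _ _ (eps * h * (h ^+ 2)^-1)); last first.
    by rewrite le_eqVlt; apply/orP; left; apply/eqP; field; rewrite gt_eqF.
  apply: ler_pM; rewrite ?invr_ge0 ?(ltW q0)//; first by rewrite H// hp.
  by rewrite lef_pV2 ?posrE// exprn_gt0.
apply: (@le_trans _ _ ((B + `|J|) / h0 ^+ 2)); last by rewrite lerDr.
apply: ler_pM; rewrite ?invr_ge0 ?(ltW q0)//.
  rewrite (le_trans (ler_normB _ _))// lerD// normrM (gtr0_norm hp).
  by rewrite ler_piMl//; lra.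
rewrite lef_pV2 ?posrE// ?exprn_gt0// (le_trans _ qh)//.
by rewrite ler_sqr ?nnegrE// ltW.
Qed.

Let quotient_unit (eps : R) : 0 < eps -> exists K : R, forall h : R, 0 < h < 1 ->
  `|Phi h / normc (1 - e2pi h) ^+ 2 - J / (4 * pi ^+ 2) * (h^-1 + (1 - h)^-1)| <=
  eps * (h^-1 + (1 - h)^-1) + K.
Proof.
move=> e0; have [K HK] := quotient_half e0.
pose L := J / (4 * pi ^+ 2); exists (K + `|L| * 2).
have half h : 0 < h <= 2^-1 -> `|Phi h / normc (1 - e2pi h) ^+ 2 - L * (h^-1 + (1 - h)^-1)| <=
    eps * (h^-1 + (1 - h)^-1) + (K + `|L| * 2).
  move=> /andP[h0 h2]; rewrite mulrDr opprD addrA.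
  apply: (le_trans (ler_normB _ _)).
  have h1 : 0 < 1 - h by lra.
  have h1' : (1 - h)^-1 <= 2 by rewrite -[leRHS]invrK lef_pV2 ?posrE//; lra.
  have ip : 0 < (1 - h)^-1 by rewrite invr_gt0.
  have t1 := HK h; rewrite h0 h2 -/L in t1; have {}t1 := t1 isT.
  have t2 : `|L * (1 - h)^-1| <= `|L| * 2.
    by rewrite normrM ler_wpM2l// gtr0_norm.
  have t3 : 0 <= eps * (1 - h)^-1 by rewrite mulr_ge0// ltW.
  rewrite mulrDr; lra.
move=> h /andP[h0 h1]; have [h2|h2] := leP h 2^-1; first by apply: half; rewrite h0.
have := half (1 - h); rewrite Phi_reflect (_ : 1 - (1 - h) = h); last by ring.
have -> : normc (1 - e2pi (1 - h)) = normc (1 - e2pi h).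
  by rewrite e2piD e2pi1 mul1r normc_1Be2piN.
by rewrite [(1 - h)^-1 + _]addrC; apply; apply/andP; split; lra.
Qed.

(** The weight of [b n] in the average [A N] below. *)
Let w (N : nat) (n : int) : R :=
  \sum_(1 <= k < N) normc (1 - e2pi (n%:~R * (k%:R / N%:R) : R)) ^+ 2 /
     normc (1 - e2pi (k%:R / N%:R : R)) ^+ 2.

Let w_ge0 N n : 0 <= w N n.
Proof. by apply: sumr_ge0 => k _; rewrite divr_ge0// sqr_ge0. Qed.

Let w_le N n : (0 < N)%N -> w N n <= N%:R ^+ 2.
Proof.
move=> N0; have NZ : N%:Z != 0 by lia.
have r0 := modz_ge0 n NZ; have rN : (n %% N)%Z < N%:Z by rewrite ltz_pmod.
have nE := divz_eq n N%:Z.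
have rE : (`|(n %% N)%Z|%N)%:Z = (n %% N)%Z by rewrite gez0_abs.
rewrite /w (@sum_fejer_quotients _ _ _ `|(n %% N)%Z|%N)//; last 2 first.
- lia.
- by exists (n %/ N)%Z; rewrite rE.
have : (`|(n %% N)%Z| <= N)%N by lia.
move: `|_|%N => r rN'; rewrite expr2.
by rewrite ler_pM ?subr_ge0 ?ler_nat// lerBlDr lerDl.
Qed.

Let w_pos N (k : nat) : (0 < N)%N -> (k <= N)%N -> w N k%:Z = k%:R * (N%:R - k%:R).
Proof.
move=> N0 kN; rewrite /w (@sum_fejer_quotients _ _ _ k)//.
by exists 0; rewrite mul0r add0r.
Qed.

Let w_neg N (k : nat) : (0 < N)%N -> (k <= N)%N -> w N (- k%:Z) = k%:R * (N%:R - k%:R).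
Proof.
move=> N0 kN; rewrite /w (@sum_fejer_quotients _ _ _ (N - k))//.
- by rewrite natrB// opprB addrCA subrr addr0 mulrC.
- by lia.
- by exists (-1); lia.
Qed.

Let A (N : nat) : R :=
  \sum_(1 <= k < N) Phi (k%:R / N%:R) / normc (1 - e2pi (k%:R / N%:R : R)) ^+ 2.

Let A_cvg N : \sum_(n <- zrange T) b n * w N n @[T --> \oo] --> A N.
Proof.
rewrite (_ : (fun T => _) = fun T => \sum_(1 <= k < N) (normc (1 - e2pi (k%:R / N%:R : R)) ^+ 2)^-1 *
   \sum_(n <- zrange T) b n * normc (1 - e2pi (n%:~R * (k%:R / N%:R))) ^+ 2); last first.
  apply/funext => T; under eq_bigr do rewrite /w mulr_sumr.
  rewrite exchange_big/=; apply: eq_bigr => k _.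
  by rewrite mulr_sumr; apply: eq_bigr => n _; rewrite mulrA mulrC.
rewrite /A; apply: cvg_sum_seq => k.
rewrite [X in _ --> X]mulrC.
by apply: cvgM; [exact: cvg_cst|exact: PhiE].
Qed.

Let C_ge0 : 0 <= C.
Proof. by have := b_decay 0; rewrite expr0n/= mul0r. Qed.

Let inv_sq_tail (N T : nat) : (0 < N)%N -> (N <= T)%N ->
  \sum_(N.+1 <= k < T.+1) (k%:R ^+ 2)^-1 <= N%:R^-1 - T%:R^-1 :> R.
Proof.
move=> N0 NT; rewrite -(subnKC NT); elim: (T - N)%N => [|d IH].
  by rewrite addn0 big_geq// subrr.
rewrite addnS big_nat_recr/=; last by lia.
apply: (le_trans (lerD IH (lexx _))).
have m0 : (0 : R) < (N + d)%:R by rewrite ltr0n; lia.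
rewrite -natr1; move: ((N + d)%:R) m0 => m m0.
have m1 : 0 < m + 1 by lra.
rewrite -subr_ge0.
have -> : N%:R^-1 - (m + 1)^-1 - (N%:R^-1 - m^-1 + ((m + 1) ^+ 2)^-1) = (m * (m + 1) ^+ 2)^-1 .
  have : N%:R^-1 - (m + 1)^-1 - (N%:R^-1 - m^-1 + ((m + 1) ^+ 2)^-1) =
     m^-1 - (m + 1)^-1 - ((m + 1) ^+ 2)^-1 by ring.
  by move=> ->; field; rewrite !gt_eqF.
by rewrite invr_ge0 mulr_ge0 ?sqr_ge0// ltW.
Qed.

(** For [k <= N] the weight [k (N - k)] differs from [N k] by [k ^ 2], which the
    decay of [b] compensates; beyond [N] the weights are at most [N ^ 2], and the
    tail of [b] is [O(1 / N)]. *)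
Let A_approx N : (0 < N)%N ->
  `|A N - N%:R * (2 * \sum_(1 <= k < N.+1) k%:R * b k%:Z)| <= 4 * C * N%:R.
Proof.
move=> N0; set W := _ * (2 * _).
have NR : (0 : R) < N%:R by rewrite ltr0n.
have cvgW : `|\sum_(n <- zrange T) b n * w N n - W| @[T --> \oo] --> `|A N - W|.
  by apply: cvg_norm; apply: cvgB; [exact: A_cvg|exact: cvg_cst].
apply: (cvgr_to_le cvgW); near=> T.
have NT : (N <= T)%N by near: T; exact: nbhs_infty_ge.
have b_dec (k : nat) : k%:R ^+ 2 * b k%:Z <= C by have := b_decay k%:Z; rewrite -pmulrn.
rewrite big_zrange_split (_ : w N 0 = 0); last by rewrite (w_pos (k := 0))// mul0r.
rewrite mulr0 add0r (big_cat_nat (n := N.+1))//=.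
have -> : W = \sum_(1 <= k < N.+1) 2 * N%:R * (k%:R * b k%:Z).
  by rewrite /W mulrA [N%:R * 2]mulrC mulr_sumr.
rewrite addrAC -sumrB; apply: (le_trans (ler_normD _ _)).
have -> : 4 * C * N%:R = 2 * C * N%:R + 2 * C * N%:R by ring.
apply: lerD.
  apply: (le_trans (ler_norm_sum _ _ _)).
  rewrite (_ : 2 * C * N%:R = \sum_(1 <= k < N.+1) 2 * C); last first.
    by rewrite sumr_const_nat subn1/= mulr_natr.
  apply: ler_sum_nat => k /andP[k1 kN].
  rewrite b_even w_pos// w_neg//.
  have -> : b k%:Z * (k%:R * (N%:R - k%:R)) + b k%:Z * (k%:R * (N%:R - k%:R)) -
     2 * N%:R * (k%:R * b k%:Z) = - (2 * (k%:R ^+ 2 * b k%:Z)) by ring.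
  by rewrite normrN ger0_norm ?mulr_ge0 ?sqr_ge0// ler_pM2l.
rewrite ger0_norm; last first.
  by apply: sumr_ge0 => k _; rewrite addr_ge0 ?mulr_ge0.
apply: (@le_trans _ _ (\sum_(N.+1 <= k < T.+1) 2 * C * N%:R ^+ 2 * (k%:R ^+ 2)^-1)).
  apply: ler_sum_nat => k /andP[kN _].
  have kp : (0 : R) < k%:R ^+ 2 by rewrite exprn_gt0// ltr0n; lia.
  rewrite b_even -mulrDr.
  apply: (@le_trans _ _ (b k%:Z * (2 * N%:R ^+ 2))).
    by rewrite ler_wpM2l// mulr_natl mulr2n lerD// w_le.
  rewrite ler_pdivlMr// (_ : b k%:Z * (2 * N%:R ^+ 2) * k%:R ^+ 2 =
    2 * N%:R ^+ 2 * (k%:R ^+ 2 * b k%:Z)); last by ring.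
  by rewrite [leRHS]mulrAC ler_wpM2l// mulr_ge0// sqr_ge0.
rewrite -mulr_sumr.
apply: (@le_trans _ _ (2 * C * N%:R ^+ 2 * N%:R^-1)).
  rewrite ler_wpM2l ?mulr_ge0 ?sqr_ge0//.
  by rewrite (le_trans (inv_sq_tail N0 NT))// lerBlDr lerDl.
by rewrite le_eqVlt; apply/orP; left; apply/eqP; field; rewrite gt_eqF.
Unshelve. all: by end_near. Qed.

(** Weighting the increments over [k / N] by the inverse square kernel makes
    the coefficient [b n] appear with weight about [N |n|] for [|n| < N], while
    the behaviour of [Phi] near [0] and [1] gives [2 N] times a harmonic sum. *)
Lemma log_average_coefficients :
  log_asymp (fun N => \sum_(1 <= k < N.+1) k%:R * b k%:Z) (J / (4 * pi ^+ 2)).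
Proof.
apply: log_asymp_harmonic => eps e0; have [K HK] := quotient_unit e0.
exists ((`|K| + 4 * C) / 2) => N N0.
have NR : (0 : R) < N%:R by rewrite ltr0n.
set L := J / _ in HK *; set S := \sum_(_ <= _ < _) _.
have hA : `|A N - L * (2 * N%:R * harmonic_sum R N)| <=
    eps * (2 * N%:R * harmonic_sum R N) + `|K| * N%:R.
  rewrite -sum_inverse_distances !mulr_sumr -sumrB.
  apply: (le_trans (ler_norm_sum _ _ _)).
  apply: (@le_trans _ _ (\sum_(1 <= k < N) (eps * ((k%:R / N%:R)^-1 + (1 - k%:R / N%:R)^-1) + `|K|))).
    apply: ler_sum_nat => k /andP[k0 kN].
    apply: (le_trans (HK _ _)); last by rewrite lerD2l ler_norm.
    rewrite divr_gt0 ?ltr0n//= ltr_pdivrMr// mul1r ltr_nat//.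
  rewrite big_split/= lerD2l sumr_const_nat -[leLHS]mulr_natr ler_wpM2l// ler_nat.
  by rewrite leq_subr.
have hW := A_approx N0; rewrite -/S in hW.
have h : `|N%:R * (2 * S) - L * (2 * N%:R * harmonic_sum R N)| <=
   eps * (2 * N%:R * harmonic_sum R N) + `|K| * N%:R + 4 * C * N%:R.
  have -> : N%:R * (2 * S) - L * (2 * N%:R * harmonic_sum R N) =
    (A N - L * (2 * N%:R * harmonic_sum R N)) - (A N - N%:R * (2 * S)) by ring.
  by rewrite (le_trans (ler_normB _ _))// lerD.
have N2 : (0 : R) < 2 * N%:R by rewrite mulr_gt0.
rewrite -(ler_pM2l N2) -[X in X * `|_|](gtr0_norm N2) -normrM.
rewrite (_ : 2 * N%:R * (S - L * harmonic_sum R N) =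
  N%:R * (2 * S) - L * (2 * N%:R * harmonic_sum R N)); last by ring.
apply: (le_trans h); rewrite le_eqVlt; apply/orP; left; apply/eqP.
by field.
Qed.

End logarithmic_wiener.

(** * Resonances on hyperbolas *)

Section decaying_weights.
Variable R : realType.
Implicit Types (n p r : int) (k : nat).

(** Working with eighth roots keeps all exponents integral. *)
Definition root8 (k : nat) : R := (k.+1%:R) `^ (8^-1).

Lemma root8_gt0 k : 0 < root8 k.
Proof. by rewrite /root8 powR_gt0. Qed.

Lemma root8X k : root8 k ^+ 8 = k.+1%:R.
Proof.
rewrite /root8 -powR_mulrn ?powR_ge0// -powRrM mulVf// powRr1//.
Qed.

Lemma root8_ge1 k : 1 <= root8 k.
Proof.
rewrite -(ler_pXn2r (n := 8)) ?nnegrE// ?(ltW (root8_gt0 k))//.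
by rewrite root8X expr1n ler1n.
Qed.

Lemma le_root8 k l : (k <= l)%N -> root8 k <= root8 l.
Proof.
move=> kl; rewrite -(ler_pXn2r (n := 8)) ?nnegrE ?(ltW (root8_gt0 _))//.
by rewrite !root8X ler_nat.
Qed.

(** [inv_weight n] is of order [1 / |n|], and [sum_weight n] is the summable weight
    [(1 + |n|)^(-9/8)]. *)
Definition inv_weight n : R := (`|n|%N.+1%:R)^-1.
Definition sum_weight n : R := (root8 `|n|%N ^+ 9)^-1.

Lemma inv_weight_gt0 n : 0 < inv_weight n.
Proof. by rewrite invr_gt0. Qed.

Lemma sum_weight_gt0 n : 0 < sum_weight n.
Proof. by rewrite invr_gt0 exprn_gt0// root8_gt0. Qed.

Lemma inv_weightE n : inv_weight n = (root8 `|n|%N ^+ 8)^-1.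
Proof. by rewrite root8X. Qed.

(** A telescoping majorant for [k ^ (-9/8)], from the mean value inequality for
    [k ^ (-1/8)]. *)
Lemma sum_weightS k : (root8 k.+1 ^+ 9)^-1 <= 8 * ((root8 k)^-1 - (root8 k.+1)^-1).
Proof.
have a0 := root8_gt0 k; have b0 := root8_gt0 k.+1.
have ab := le_root8 (leqnSn k).
have := root8X k.+1; have := root8X k; rewrite -[in X in _ -> X -> _]natr1 => <-.
move: (root8 k) (root8 k.+1) a0 b0 ab => a b a0 b0 ab h.
have h1 : 1 <= 8 * (b - a) * b ^+ 7.
  have : b ^+ 8 - a ^+ 8 = 1 by rewrite h addrAC subrr add0r.
  rewrite subrXX => E; rewrite -[leLHS]E [8 * _]mulrC -mulrA ler_wpM2l ?subr_ge0//.
  apply: (@le_trans _ _ (\sum_(i < 8) b ^+ 7)); last first.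
    by rewrite sumr_const card_ord mulr_natl.
  apply: ler_sum => i _.
  have -> : b ^+ 7 = b ^+ (8.-1 - i) * b ^+ i.
    by rewrite -exprD subnK// -ltnS.
  by apply: ler_wpM2l; [rewrite exprn_ge0// ltW | rewrite lerXn2r ?nnegrE// ltW].
have bn : b != 0 by rewrite gt_eqF.
have an : a != 0 by rewrite gt_eqF.
have -> : 8 * (a^-1 - b^-1) = (8 * (b - a)) / (a * b) by field; rewrite an bn.
rewrite ler_pdivlMr ?mulr_gt0// ler_pdivrMl ?exprn_gt0//.
apply: (@le_trans _ _ (b ^+ 2)); first by rewrite expr2 ler_pM2r.
rewrite -[leLHS]mulr1 (_ : b ^+ 9 * (8 * (b - a)) = b ^+ 2 * (8 * (b - a) * b ^+ 7)); last by ring.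
by rewrite ler_wpM2l// sqr_ge0.
Qed.

Lemma sum_weight_nat (N : nat) : \sum_(0 <= k < N) (root8 k ^+ 9)^-1 <= 9.
Proof.
suff h : \sum_(0 <= k < N.+1) (root8 k ^+ 9)^-1 <= 9 - 8 * (root8 N)^-1.
  apply: (@le_trans _ _ (\sum_(0 <= k < N.+1) (root8 k ^+ 9)^-1)).
    by rewrite big_nat_recr//= lerDl invr_ge0 exprn_ge0// ltW// root8_gt0.
  by rewrite (le_trans h)// lerBlDr lerDl mulr_ge0// invr_ge0 ltW// root8_gt0.
elim: N => [|N IH].
  have r0 : root8 0 = 1 by rewrite /root8 powR1.
  by rewrite big_nat1 r0 expr1n invr1; lra.
rewrite big_nat_recr//=; have := sum_weightS N.
by move: IH; rewrite mulrBr; lra.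
Qed.

Lemma sum_weight_uniq (s : seq int) : uniq s -> \sum_(n <- s) sum_weight n <= 18.
Proof.
move=> us; pose N := (\max_(n <- s) `|n|%N)%N.
apply: (@le_trans _ _ (\sum_(n <- zrange N) sum_weight n)).
  apply: ler_sum_uniq_sub => // [n ns|n]; last exact: ltW (sum_weight_gt0 n).
  by rewrite mem_zrange /N; apply: (@leq_bigmax_seq _ _ xpredT (fun n => `|n|%N)).
rewrite big_zrange_split.
have := sum_weight_nat N.+1; rewrite big_ltn//=.
have h : \sum_(1 <= k < N.+1) (sum_weight k%:Z + sum_weight (- k%:Z)) =
    \sum_(1 <= k < N.+1) (root8 k ^+ 9)^-1 *+ 2.
  by apply: eq_bigr => k _; rewrite /sum_weight abszN absz_nat mulr2n.
rewrite h sumrMnl mulr2n /sum_weight absz0.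
have : 0 <= (root8 0 ^+ 9)^-1 by rewrite invr_ge0 exprn_ge0// ltW// root8_gt0.
lra.
Qed.

(** The larger of [|p|] and [|p + r|] is at least [|r| / 2]: most of its decay is
    converted into decay in [r], and the remaining eighth makes the other factor
    summable. *)
Lemma inv_weight_mul_le (p r : int) :
  inv_weight p * inv_weight (p + r) <=
  2 * (root8 `|r|%N ^+ 7)^-1 * (sum_weight p + sum_weight (p + r)).
Proof.
have : (absz r <= absz p + absz (p + r)%R)%N by lia.
rewrite !inv_weightE /sum_weight.
move: `|p|%N `|(p + r)%R|%N `|r|%N => x y z zxy.
have key (A B Z : R) : 0 < A -> A <= B -> 0 < Z -> Z ^+ 8 <= 2 * B ^+ 8 ->
    (A ^+ 8)^-1 * (B ^+ 8)^-1 <= 2 * (Z ^+ 7)^-1 * (A ^+ 9)^-1.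
  move=> A0 AB Z0 ZB; have B0 := lt_le_trans A0 AB.
  have Z7 : Z ^+ 7 <= 2 * B ^+ 7.
    have [ZB'|BZ] := leP Z B.
      have : Z ^+ 7 <= B ^+ 7 by rewrite lerXn2r ?nnegrE// ltW.
      by have := exprn_ge0 7 (ltW B0); lra.
    rewrite -(ler_pM2l Z0) -exprS (le_trans ZB)//.
    rewrite (_ : 2 * B ^+ 8 = B * (2 * B ^+ 7)); last by ring.
    by rewrite ler_wpM2r// ?mulr_ge0 ?exprn_ge0// ltW.
  rewrite -!invfM -[2]invrK -invfM -invfM lef_pV2 ?posrE ?mulr_gt0 ?invr_gt0 ?exprn_gt0//.
  rewrite -mulrA ler_pdivrMl//.
  apply: (@le_trans _ _ (2 * B ^+ 7 * (A ^+ 9))).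
    by rewrite ler_wpM2r// exprn_ge0// ltW.
  rewrite (_ : 2 * B ^+ 7 * A ^+ 9 = 2 * A ^+ 8 * B ^+ 7 * A); last by ring.
  rewrite (_ : 2 * (A ^+ 8 * B ^+ 8) = 2 * A ^+ 8 * B ^+ 7 * B); last by ring.
  by rewrite ler_wpM2l// !mulr_ge0 ?exprn_ge0// ltW.
have x0 := root8_gt0 x; have y0 := root8_gt0 y; have z0 := root8_gt0 z.
have zz : root8 z ^+ 8 <= root8 x ^+ 8 + root8 y ^+ 8.
  by rewrite !root8X -natrD ler_nat; lia.
have c0 : 0 <= 2 * (root8 z ^+ 7)^-1 by rewrite mulr_ge0// invr_ge0 exprn_ge0// ltW.
have [xy|yx] := leP (root8 x) (root8 y).
  apply: (le_trans (key _ _ _ x0 xy z0 _)).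
    by rewrite (le_trans zz)// mulr_natl mulr2n lerD2r lerXn2r ?nnegrE// ltW.
  by rewrite ler_wpM2l// lerDl invr_ge0 exprn_ge0// ltW.
rewrite mulrC; apply: (le_trans (key _ _ _ y0 (ltW yx) z0 _)).
  by rewrite (le_trans zz)// mulr_natl mulr2n lerD2l lerXn2r ?nnegrE// ltW.
by rewrite ler_wpM2l// lerDr invr_ge0 exprn_ge0// ltW.
Qed.

(** This is [1 / (x y) <= (1 / x + 1 / y) / z] for [z <= x + y]. *)
Lemma inv_weight_mul_sum (p r : int) :
  inv_weight p * inv_weight (p + r) <=
  inv_weight r * (inv_weight p + inv_weight (p + r)).
Proof.
have : (absz r <= absz p + absz (p + r)%R)%N by lia.
rewrite /inv_weight; move: `|p|%N `|(p + r)%R|%N `|r|%N => x y z zxy.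
have : (z.+1%:R : R) <= x.+1%:R + y.+1%:R by rewrite -natrD ler_nat; lia.
have : (0 : R) < x.+1%:R by []. have : (0 : R) < y.+1%:R by [].
have : (0 : R) < z.+1%:R by [].
move: (x.+1%:R) (y.+1%:R) (z.+1%:R) => a b c c0 b0 a0 cab.
have -> : c^-1 * (a^-1 + b^-1) = (a^-1 * b^-1) * ((a + b) / c).
  by field; rewrite !gt_eqF.
rewrite ler_peMr ?mulr_ge0 ?invr_ge0 ?(ltW a0) ?(ltW b0)//.
by rewrite ler_pdivlMr// mul1r.
Qed.

Lemma sum_weight_shift (s : seq int) (r : int) : uniq s ->
  \sum_(p <- s) sum_weight (p + r) <= 18.
Proof.
move=> us; rewrite -(big_map (fun p => p + r) xpredT sum_weight).
by apply: sum_weight_uniq; rewrite map_inj_uniq//; exact: addIr.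
Qed.

Lemma inv_weight_convolution (s : seq int) (c r : int) : uniq s ->
  \sum_(p <- s) inv_weight (p + c) * inv_weight (p + c + r) <=
  72 * (root8 `|r|%N ^+ 7)^-1.
Proof.
move=> us; apply: (@le_trans _ _ (\sum_(p <- s) 2 * (root8 `|r|%N ^+ 7)^-1 *
   (sum_weight (p + c) + sum_weight (p + c + r)))).
  by apply: ler_sum => p _; exact: inv_weight_mul_le.
rewrite -mulr_sumr big_split/=.
have h1 := sum_weight_shift c us; have h2 := sum_weight_shift (c + r) us.
under [X in _ * (_ + X)]eq_bigr do rewrite -addrA.
have c0 : 0 <= (root8 `|r|%N ^+ 7)^-1.
  by rewrite invr_ge0 exprn_ge0// ltW// root8_gt0.
apply: (@le_trans _ _ (2 * (root8 `|r|%N ^+ 7)^-1 * 36)).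
  apply: ler_wpM2l; first exact: mulr_ge0 (ler0n _ _) c0.
  by apply: (le_trans (lerD h1 h2)); rewrite -natrD.
by rewrite le_eqVlt; apply/orP; left; apply/eqP; ring.
Qed.

(** Bounds the amplitude of the frequency [2 m q] in the squared modulus of the
    coefficient of index [m] of the density. *)
Definition quartic_kernel (s : seq int) (m q : int) : R :=
  \sum_(p <- s) inv_weight p * inv_weight (p + m) *
                (inv_weight (p + q) * inv_weight (p + q + m)).

Lemma quartic_kernel_sym s m q : quartic_kernel s m q = quartic_kernel s q m.
Proof.
apply: eq_bigr => p _; rewrite (_ : p + q + m = p + m + q); last by ring.
by ring.
Qed.

Lemma quartic_kernel_ge0 s m q : 0 <= quartic_kernel s m q.
Proof.
by apply: sumr_ge0 => p _; rewrite !mulr_ge0// ltW// inv_weight_gt0.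
Qed.

Definition gap (m q : nat) : nat := minn (minn m q) (`|m%:Z - q%:Z|%N).

(** For the larger index [m], pairing the factors whose arguments differ by [m]
    extracts [1 / m ^ 2]; four sums remain, of products of two weights at
    distance [q], [q + m], [m - q] and [q], all of them at least the gap. *)
Lemma quartic_kernel_le_aux (s : seq int) (m q : nat) : uniq s -> (q <= m)%N ->
  quartic_kernel s m q <= 288 * inv_weight m ^+ 2 * (root8 (gap m q) ^+ 7)^-1.
Proof.
move=> us qm; set d := gap m q.
pose om := inv_weight.
apply: (@le_trans _ _ (\sum_(p <- s) om m ^+ 2 * (om (p + 0) * om (p + 0 + q%:Z) +
   om (p + 0) * om (p + 0 + (q%:Z + m%:Z)) + om (p + m%:Z) * om (p + m%:Z + (q%:Z - m%:Z))
   + om (p + m%:Z) * om (p + m%:Z + q%:Z)))).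
  apply: ler_sum => p _.
  have h1 := inv_weight_mul_sum p m; have h2 := inv_weight_mul_sum (p + q%:Z) m.
  apply: (le_trans (ler_pM _ _ h1 h2)); try by rewrite mulr_ge0// ltW// inv_weight_gt0.
  rewrite !addr0 -/om (_ : p + m%:Z + (q%:Z - m%:Z) = p + q%:Z); last by ring.
  rewrite (_ : p + m%:Z + q%:Z = p + q%:Z + m%:Z); last by ring.
  rewrite (_ : p + (q%:Z + m%:Z) = p + q%:Z + m%:Z); last by ring.
  by rewrite le_eqVlt; apply/orP; left; apply/eqP; ring.
rewrite -mulr_sumr !big_split/=.
have c0 : 0 <= om m ^+ 2 by exact: sqr_ge0.
rewrite (_ : 288 * inv_weight m ^+ 2 * (root8 d ^+ 7)^-1 =
  om m ^+ 2 * (288 * (root8 d ^+ 7)^-1)); last by rewrite /om; ring.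
rewrite ler_wpM2l//.
have mono (r : int) : (d <= `|r|)%N ->
    72 * (root8 `|r|%N ^+ 7)^-1 <= 72 * (root8 d ^+ 7)^-1.
  move=> dr; rewrite ler_wpM2l// lef_pV2 ?posrE ?exprn_gt0 ?root8_gt0//.
  by rewrite lerXn2r ?nnegrE ?(ltW (root8_gt0 _))// le_root8.
have t1 := le_trans (inv_weight_convolution 0 q%:Z us) (mono q%:Z _).
have t2 := le_trans (inv_weight_convolution 0 (q%:Z + m%:Z) us) (mono (q%:Z + m%:Z) _).
have t3 := le_trans (inv_weight_convolution m (q%:Z - m%:Z) us) (mono (q%:Z - m%:Z) _).
have t4 := le_trans (inv_weight_convolution m q%:Z us) (mono q%:Z _).
have {}t1 := t1 ltac:(rewrite /d /gap; lia).
have {}t2 := t2 ltac:(rewrite /d /gap; lia).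
have {}t3 := t3 ltac:(rewrite /d /gap; lia).
have {}t4 := t4 ltac:(rewrite /d /gap; lia).
by rewrite -/om in t1 t2 t3 t4; lra.
Qed.

Lemma gap_sym m q : gap m q = gap q m.
Proof. by rewrite /gap; lia. Qed.

Lemma quartic_kernel_le (s : seq int) (m q : nat) : uniq s ->
  quartic_kernel s m q <= 288 * inv_weight (maxn m q) ^+ 2 * (root8 (gap m q) ^+ 7)^-1.
Proof.
move=> us; have [qm|mq] := leqP q m; first by rewrite quartic_kernel_le_aux.
rewrite quartic_kernel_sym gap_sym.
by rewrite quartic_kernel_le_aux// ltnW.
Qed.

(** Two weights, the first summable along each hyperbola [m q = l], the second
    summable over all pairs, whose product dominates the square of
    [m * quartic_kernel s m q]. *)
Definition fiber_weight (x : nat * nat) : R :=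
  sum_weight x.1 + sum_weight x.2 + sum_weight (x.1%:Z - x.2%:Z).
Definition pair_weight (x : nat * nat) : R :=
  sum_weight x.1 * sum_weight x.2 + sum_weight x.1 * sum_weight (x.1%:Z - x.2%:Z) +
  sum_weight x.2 * sum_weight (x.1%:Z - x.2%:Z).

Lemma weighted_kernel_le (s : seq int) (x : nat * nat) : uniq s ->
  (x.1%:R * quartic_kernel s x.1 x.2) ^+ 2 <=
  288 ^+ 2 * (fiber_weight x * pair_weight x).
Proof.
case: x => m q us /=; have := quartic_kernel_le m q us.
have : 0 <= 288 :> R by exact: ler0n.
move: 288 => K K0 kK; set d := gap m q; set M := maxn m q.
have k0 := quartic_kernel_ge0 s m q.
have h1 : m%:R * quartic_kernel s m q <= K * (inv_weight M * (root8 d ^+ 7)^-1).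
  apply: (@le_trans _ _ (m%:R * (K * inv_weight M ^+ 2 * (root8 d ^+ 7)^-1))).
    exact: ler_wpM2l.
  have : m%:R * inv_weight M <= 1.
    rewrite /inv_weight ler_pdivrMr// mul1r ler_nat /M absz_nat; lia.
  move=> h; rewrite (_ : m%:R * (K * inv_weight M ^+ 2 * (root8 d ^+ 7)^-1) =
    (m%:R * inv_weight M) * (K * (inv_weight M * (root8 d ^+ 7)^-1))); last by ring.
  rewrite ler_piMl// !mulr_ge0// ?invr_ge0 ?exprn_ge0//.
  exact: ltW (root8_gt0 _).
apply: (@le_trans _ _ ((K * (inv_weight M * (root8 d ^+ 7)^-1)) ^+ 2)).
  have h0 : 0 <= m%:R * quartic_kernel s m q by rewrite mulr_ge0.
  by apply: lerXn2r => //; rewrite nnegrE// (le_trans h0 h1).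
rewrite exprMn ler_wpM2l ?sqr_ge0//.
have sd : 0 < root8 d by exact: root8_gt0.
have dM : root8 d <= root8 M by rewrite le_root8// /d /M /gap; lia.
have sM : 0 < root8 M by exact: root8_gt0.
apply: (@le_trans _ _ ((root8 d ^+ 9)^-1 * ((root8 M ^+ 9)^-1 * (root8 d ^+ 9)^-1))).
  rewrite inv_weightE absz_nat -!invfM exprVn.
  rewrite lef_pV2 ?posrE; last 2 first.
  - by rewrite exprn_gt0// mulr_gt0// exprn_gt0.
  - by rewrite mulr_gt0// ?mulr_gt0// exprn_gt0.
  rewrite exprMn -!exprM.
  rewrite (_ : root8 d ^+ 9 * (root8 M ^+ 9 * root8 d ^+ 9) =
    root8 M ^+ 9 * root8 d ^+ 14 * root8 d ^+ 4); last by ring.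
  rewrite (_ : root8 M ^+ (8 * 2) * root8 d ^+ (7 * 2) =
    root8 M ^+ 9 * root8 d ^+ 14 * root8 M ^+ 7); last by ring.
  apply: ler_wpM2l; first by rewrite ?mulr_ge0 ?exprn_ge0 ?(ltW sd) ?(ltW sM).
  apply: (@le_trans _ _ (root8 d ^+ 7)); last by rewrite lerXn2r ?nnegrE ?(ltW sd) ?(ltW sM).
  by rewrite -[7%N]/(4 + 3)%N exprD ler_peMr ?exprn_ge0 ?(ltW sd)// exprn_ege1// root8_ge1.
have w n : 0 <= sum_weight n by exact: ltW (sum_weight_gt0 n).
have sw (n : nat) : sum_weight n%:Z = (root8 n ^+ 9)^-1 by rewrite /sum_weight absz_nat.
apply: ler_pM; rewrite ?mulr_ge0 ?invr_ge0 ?exprn_ge0 ?(ltW sd) ?(ltW sM)//.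
  rewrite /fiber_weight/= -sw.
  have [->|[->|dE]] : d = m \/ d = q \/ d = `|m%:Z - q%:Z|%N by rewrite /d /gap; lia.
  - by rewrite -addrA lerDl addr_ge0.
  - by rewrite addrAC lerDr addr_ge0.
  - by rewrite dE {1}/sum_weight absz_nat -/(sum_weight (m%:Z - q%:Z)) lerDr addr_ge0.
rewrite /pair_weight/= -!sw.
have ww (i j : int) : 0 <= sum_weight i * sum_weight j by rewrite mulr_ge0.
have gE : d = `|m%:Z - q%:Z|%N -> sum_weight d = sum_weight (m%:Z - q%:Z).
  by move=> ->; rewrite {1}/sum_weight absz_nat.
have [[-> ->]|[[-> ->]|[dE [->|->]]]] : (d = m /\ M = q) \/ (d = q /\ M = m) \/
   (d = `|m%:Z - q%:Z|%N /\ (M = m \/ M = q)) by rewrite /d /M /gap; lia.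
- by rewrite mulrC -addrA lerDl addr_ge0.
- by rewrite -addrA lerDl addr_ge0.
- by rewrite gE// addrAC lerDr addr_ge0.
- by rewrite gE// lerDr addr_ge0.
Qed.

(** Cauchy-Schwarz along the fibers of [l]: the product [x i * x j] is at most
    the mean of [al j * be i] and [al i * be j], up to the constant [C]. *)
Lemma fiber_sum_le (T : eqType) (L : eqType) (s : seq T) (l : T -> L)
    (x al be : T -> R) (C A B : R) :
  (forall i, i \in s -> 0 <= x i) -> (forall i, i \in s -> 0 <= al i) ->
  (forall i, i \in s -> 0 <= be i) -> 0 <= C -> 0 <= A ->
  (forall i, i \in s -> x i ^+ 2 <= C * (al i * be i)) ->
  (forall i, i \in s -> \sum_(j <- s | l j == l i) al j <= A) ->
  \sum_(i <- s) be i <= B ->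
  \sum_(i <- s) \sum_(j <- s | l j == l i) x i * x j <= C * A * B.
Proof.
move=> x0 a0 b0 C0 A0 xab hA hB.
pose h i j := C * (al j * be i).
have key i j : i \in s -> j \in s -> x i * x j <= 2^-1 * (h i j + h j i).
  move=> si sj.
  have p1 : 0 <= h i j by rewrite !mulr_ge0 ?a0 ?b0.
  have p2 : 0 <= h j i by rewrite !mulr_ge0 ?a0 ?b0.
  have : (x i * x j) ^+ 2 <= h i j * h j i.
    rewrite exprMn (_ : h i j * h j i = (C * (al i * be i)) * (C * (al j * be j))).
      by rewrite ler_pM ?sqr_ge0// xab.
    by rewrite /h; ring.
  move=> q; rewrite -(ler_pXn2r (n := 2)) ?nnegrE ?mulr_ge0 ?x0 ?addr_ge0//.
  apply: (le_trans q); rewrite exprMn -subr_ge0.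
  rewrite (_ : _ - _ = 2^-1 ^+ 2 * (h i j - h j i) ^+ 2); last by field.
  by rewrite mulr_ge0 ?sqr_ge0.
have sum1 : \sum_(i <- s) \sum_(j <- s | l j == l i) h i j <= C * A * B.
  apply: (@le_trans _ _ (\sum_(i <- s) C * A * be i)).
    rewrite big_seq [leRHS]big_seq; apply: ler_sum => i si.
    under eq_bigr do rewrite /h mulrCA.
    rewrite -mulr_suml mulrA [_ * C]mulrC ler_wpM2r ?b0// ler_wpM2l// hA//.
  by rewrite -mulr_sumr ler_wpM2l// mulr_ge0.
have sum2 : \sum_(i <- s) \sum_(j <- s | l j == l i) h j i =
    \sum_(i <- s) \sum_(j <- s | l j == l i) h i j.
  rewrite (exchange_big_dep xpredT)//=.
  by apply: eq_bigr => i _; apply: eq_bigl => j; rewrite eq_sym.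
apply: (@le_trans _ _ (\sum_(i <- s) \sum_(j <- s | l j == l i) 2^-1 * (h i j + h j i))).
  rewrite big_seq [leRHS]big_seq; apply: ler_sum => i si.
  rewrite big_seq_cond [leRHS]big_seq_cond.
  by apply: ler_sum => j /andP[sj _]; exact: key.
under eq_bigr do rewrite -mulr_sumr big_split/=.
by rewrite -mulr_sumr big_split/= sum2; lra.
Qed.

Definition pair_box (M n : nat) : seq (nat * nat) :=
  [seq (m, q) | m <- iota 1 M, q <- iota 1 n].

Lemma pair_box_uniq (M n : nat) : uniq (pair_box M n).
Proof.
apply: allpairs_uniq; rewrite ?iota_uniq//.
by move=> [? ?] [? ?] _ _ /= [-> ->].
Qed.

Lemma mem_pair_box (M n : nat) x : x \in pair_box M n -> (0 < x.1)%N /\ (0 < x.2)%N.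
Proof.
by move=> /allpairsP[[m q]/= [+ + ->]]; rewrite !mem_iota => /andP[? _] /andP[? _].
Qed.

(** On the hyperbola [m q = l] each of [m], [q] and [m - q] determines the pair,
    so that each of the three sums is a sum of summable weights over distinct
    integers. *)
Lemma fiber_weight_sum (M n : nat) (l : nat) :
  \sum_(x <- pair_box M n | (x.1 * x.2)%N == l) fiber_weight x <= 54.
Proof.
have key (f : nat * nat -> int) :
    (forall x y : nat * nat, (0 < x.1)%N -> (0 < x.2)%N -> (0 < y.1)%N -> (0 < y.2)%N ->
      (x.1 * x.2 = y.1 * y.2)%N -> f x = f y -> x = y) ->
    \sum_(x <- pair_box M n | (x.1 * x.2)%N == l) sum_weight (f x) <= 18.
  move=> inj; rewrite -big_filter -(big_map f xpredT sum_weight).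
  apply: sum_weight_uniq; rewrite map_inj_in_uniq ?filter_uniq ?pair_box_uniq//.
  move=> x y; rewrite !mem_filter => /andP[/eqP xl /mem_pair_box[x1 x2]].
  by move=> /andP[/eqP yl /mem_pair_box[y1 y2]]; apply: inj; rewrite ?xl.
rewrite /fiber_weight !big_split/=.
have h1 : \sum_(x <- pair_box M n | (x.1 * x.2)%N == l) sum_weight x.1%:Z <= 18.
  apply: key => -[a b] [c d]/= a0 _ _ _ + [ac]; rewrite -ac => /eqP.
  by rewrite eqn_pmul2l// => /eqP ->.
have h2 : \sum_(x <- pair_box M n | (x.1 * x.2)%N == l) sum_weight x.2%:Z <= 18.
  apply: key => -[a b] [c d]/= _ b0 _ _ + [bd]; rewrite -bd => /eqP.
  by rewrite eqn_pmul2r// => /eqP ->.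
have h3 : \sum_(x <- pair_box M n | (x.1 * x.2)%N == l) sum_weight (x.1%:Z - x.2%:Z) <= 18.
  apply: (key (fun x => x.1%:Z - x.2%:Z)) => -[a b] [c d]/= a0 b0 c0 d0 e1 e2.
  have {}e2 : (a + d = c + b)%N by lia.
  suff : a = c by move=> ac; congr pair; lia.
  case: (ltngtP a c) => // ac.
    have bd : (b < d)%N by lia.
    by have := ltn_mul ac bd; rewrite e1 ltnn.
  have db : (d < b)%N by lia.
  by have := ltn_mul ac db; rewrite e1 ltnn.
rewrite (_ : 54 = 18 + 18 + 18); last by rewrite -!natrD.
exact: lerD (lerD h1 h2) h3.
Qed.

Lemma pair_weight_sum (M n : nat) : \sum_(x <- pair_box M n) pair_weight x <= 3 * 18 ^+ 2.
Proof.
have w k : 0 <= sum_weight k by exact: ltW (sum_weight_gt0 k).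
have one (s : seq int) (f : nat -> int) (r : nat) : injective f ->
    \sum_(q <- iota 1 r) sum_weight (f q) <= 18.
  move=> inj; rewrite -(big_map f xpredT sum_weight); apply: sum_weight_uniq.
  by rewrite map_inj_uniq ?iota_uniq.
have two (I J : seq nat) (F G : nat -> nat -> int) :
    (forall m, \sum_(q <- J) sum_weight (G m q) <= 18) ->
    (\sum_(m <- I) sum_weight m%:Z <= 18) ->
    \sum_(m <- I) \sum_(q <- J) sum_weight m%:Z * sum_weight (G m q) <= 18 ^+ 2.
  move=> hG hI; apply: (@le_trans _ _ (\sum_(m <- I) sum_weight m%:Z * 18)).
    by apply: ler_sum => m _; rewrite -mulr_sumr ler_wpM2l.
  by rewrite -mulr_suml expr2 ler_wpM2r.
have i1 : injective (fun q : nat => q%:Z) by move=> ? ? [].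
have i2 m : injective (fun q : nat => m%:Z - q%:Z) by move=> q r /=; lia.
have i3 m : injective (fun q : nat => q%:Z - m%:Z) by move=> q r /=; lia.
rewrite /pair_weight /pair_box big_allpairs/=.
under eq_bigr do rewrite !big_split/=.
rewrite !big_split/=.
have h1 := two (iota 1 M) (iota 1 n) (fun=> id) (fun _ q => q%:Z)
  (fun=> one [::] _ n i1) (one [::] _ M i1).
have h2 := two (iota 1 M) (iota 1 n) (fun=> id) (fun m q => m%:Z - q%:Z)
  (fun m => one [::] _ n (i2 m)) (one [::] _ M i1).
have h3 := two (iota 1 n) (iota 1 M) (fun=> id) (fun q m => m%:Z - q%:Z)
  (fun q => one [::] _ M (i3 q)) (one [::] _ n i1).
rewrite exchange_big/= in h3; move: (18 ^+ 2) h1 h2 h3 => B h1 h2 h3.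
rewrite (_ : 3 * B = B + B + B); last by ring.
exact: lerD (lerD h1 h2) h3.
Qed.

(** The left-hand side is the mean square of a sum with frequencies [2 m q]; the
    point is that the bound is uniform in [M], [n] and [s]. *)
Lemma hyperbola_energy (s : seq int) (M n : nat) : uniq s ->
  \sum_(y <- pair_box M n) \sum_(z <- pair_box M n | (z.1 * z.2 == y.1 * y.2)%N)
    y.1%:R * quartic_kernel s y.1 y.2 * (z.1%:R * quartic_kernel s z.1 z.2)
  <= 288 ^+ 2 * 54 * (3 * 18 ^+ 2).
Proof.
move=> us; pose x (y : nat * nat) := y.1%:R * quartic_kernel s y.1 y.2.
have w k : 0 <= sum_weight k by exact: ltW (sum_weight_gt0 k).
apply: (@fiber_sum_le _ _ _ (fun y => y.1 * y.2)%N x fiber_weight pair_weight).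
- by move=> y _; rewrite mulr_ge0 ?quartic_kernel_ge0.
- by move=> y _; apply: addr_ge0; [apply: addr_ge0|]; exact: w.
- by move=> y _; rewrite /pair_weight; do 2?[apply: addr_ge0]; apply: mulr_ge0; exact: w.
- exact: exprn_ge0 (ler0n _ _).
- exact: ler0n.
- by move=> y _; exact: weighted_kernel_le.
- by move=> y _; exact: fiber_weight_sum.
- exact: pair_weight_sum.
Qed.

End decaying_weights.

(** * Truncated evolutions *)

Lemma big_support (V : nmodType) (s s' : seq int) (F : int -> V) :
  uniq s -> uniq s' -> (forall n, F n != 0 -> n \in s) ->
  (forall n, F n != 0 -> n \in s') -> \sum_(n <- s) F n = \sum_(n <- s') F n.
Proof.
move=> us us' h h'.
have nz (r : seq int) : \sum_(n <- r) F n = \sum_(n <- [seq n <- r | F n != 0]) F n.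
  rewrite big_filter [RHS]big_mkcond/=; apply: eq_bigr => n _.
  by case: ifPn => // /negPn/eqP.
rewrite nz [RHS]nz; apply: perm_big; apply: uniq_perm; rewrite ?filter_uniq//.
move=> n; rewrite !mem_filter; case: (boolP (F n != 0)) => //= Fn.
by rewrite h// h'.
Qed.

Lemma big_support_shift (V : nmodType) N (q : int) (F : int -> V) :
  (forall n, F n != 0 -> (`|n| <= N)%N) -> (forall n, F n != 0 -> (`|(n + q)%R| <= N)%N) ->
  \sum_(n <- zrange N) F (n - q) = \sum_(n <- zrange N) F n.
Proof.
move=> F1 F2; rewrite -(big_map (fun n => n - q) xpredT F).
apply: big_support; rewrite ?zrange_uniq//.
- by rewrite map_inj_uniq ?zrange_uniq//; exact: addIr.
- move=> n /F2 nN; apply/mapP; exists (n + q); last by rewrite addrK.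
  by rewrite mem_zrange.
- by move=> n /F1; rewrite mem_zrange.
Qed.

Section correlation.
Variable R : realType.

Definition correlation (N : nat) (f : int -> R[i]) (q : int) : R[i] :=
  \sum_(p <- zrange N) f (p + q) * (f p)^*%C.

(** Squaring out a sum and grouping the products by the difference [q] of the
    indices; this underlies both Weyl differencing and the expansion of the
    critical mass. *)
Lemma sqr_normc_sum_correlation (N : nat) (f : int -> R[i]) :
  (forall n, f n != 0 -> (`|n| <= N)%N) ->
  normc (\sum_(p <- zrange N) f p) ^+ 2 =
  \sum_(p <- zrange N) normc (f p) ^+ 2 +
  2 * complex.Re (\sum_(1 <= q < N.*2.+1) correlation N f q%:Z).
Proof.
move=> fN.
suff : (normc (\sum_(p <- zrange N) f p) ^+ 2)%:C =
    (\sum_(p <- zrange N) normc (f p) ^+ 2)%:C +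
    (\sum_(1 <= q < N.*2.+1) correlation N f q%:Z +
     (\sum_(1 <= q < N.*2.+1) correlation N f q%:Z)^*%C).
  set z := \sum_(1 <= q < _) _; move=> /(congr1 (@complex.Re R)).
  by rewrite !complex_ReD => /= ->; case: z => x y /=; rewrite mulr2n mulrDl mul1r.
rewrite sqr_normc_sum.
have -> : \sum_(i <- zrange N) \sum_(j <- zrange N) f i * (f j)^*%C =
    \sum_(j <- zrange N) \sum_(r <- zrange N.*2) f (j + r) * (f j)^*%C.
  rewrite exchange_big/= big_seq [RHS]big_seq; apply: eq_bigr => j jN.
  rewrite mem_zrange in jN.
  transitivity (\sum_(i <- [seq j + r | r <- zrange N.*2]) f i * (f j)^*%C); last first.
    by rewrite big_map.
  apply: big_support; rewrite ?zrange_uniq//.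
  - by rewrite map_inj_uniq ?zrange_uniq//; exact: addrI.
  - move=> i; rewrite mulf_eq0 negb_or => /andP[/fN iN _]; by rewrite mem_zrange.
  - move=> i; rewrite mulf_eq0 negb_or => /andP[/fN iN _].
    apply/mapP; exists (i - j); last by lia.
    by rewrite mem_zrange; lia.
rewrite exchange_big/= big_zrange_split; congr (_ + _).
  by rewrite realc_sum; apply: eq_bigr => j _; rewrite addr0 mulc_conj.
rewrite big_split/= conjc_sum; congr (_ + _).
apply: eq_bigr => q _; rewrite /correlation conjc_sum.
rewrite -[RHS](@big_support_shift _ N q%:Z).
- apply: eq_bigr => p _.
  by rewrite subrK conjcM conjcK mulrC.
- move=> n; rewrite conjcM conjcK mulf_eq0 negb_or => /andP[_ /fN]; exact.
- move=> n; rewrite conjcM conjcK mulf_eq0 negb_or => /andP[+ _].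
  by rewrite conjc_eq0 => /fN.
Qed.

Lemma fourier_coef_sqr_trigpoly (s : seq int) (c : int -> R[i]) (m : int) : uniq s ->
  fourier_coef (fun x => normc (\sum_(n <- s) c n * e2pi (n%:~R * x)) ^+ 2) m =
  \sum_(p <- s) (if p + m \in s then c (p + m) else 0) * (c p)^*%C.
Proof.
move=> us; rewrite /fourier_coef.
pose J := [seq (n, p) | n <- s, p <- s].
have -> : (fun x => (normc (\sum_(n <- s) c n * e2pi (n%:~R * x)) ^+ 2)%:C *
      e2pi (- (m%:~R * x))) = (fun x => \sum_(z <- J) (c z.1 * (c z.2)^*%C) *
      e2pi ((z.1 - z.2 - m)%:~R * x)).
  apply/funext => x; rewrite sqr_normc_sum big_allpairs mulr_suml.
  apply: eq_bigr => n _; rewrite mulr_suml; apply: eq_bigr => p _ /=.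
  rewrite conjcM -e2piN mulrACA -[LHS]mulrA -!e2piD; congr (_ * e2pi _).
  by rewrite !intrD !mulrNz; ring.
rewrite torus_cintegral_trigpoly big_mkcond big_allpairs exchange_big/=.
apply: eq_bigr => p _; rewrite -big_mkcond/=.
under eq_bigl do rewrite subr_eq add0r subr_eq addrC.
case: ifPn => [ps|pms].
  by rewrite -big_filter filter_pred1_uniq ?big_seq1 // addrC.
rewrite mul0r big_seq_cond big_pred0// => n.
by apply/negP => /andP[ns /eqP nE]; rewrite -nE ns in pms.
Qed.

End correlation.

Section truncated_evolution.
Variable R : realType.
Implicit Types (a : int -> R[i]) (t x : R).

Definition schrodinger_poly a (N : nat) (x t : R) : R[i] :=
  \sum_(n <- zrange N) a n * e2pi (n%:~R * x - n%:~R ^+ 2 * t).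

Lemma schrodinger_partial_sumE (g : R -> R) N x t :
  schrodinger_partial_sum g N x t = schrodinger_poly (fourier_coef g) N x t.
Proof. by rewrite /schrodinger_poly big_zrange. Qed.

Definition truncation (N : nat) a (n : int) : R[i] :=
  if (`|n| <= N)%N then a n else 0.

Lemma truncation_le N a n : normc (truncation N a n) <= normc (a n).
Proof. by rewrite /truncation; case: ifP => // _; rewrite Normc.normc0 normc_ge0. Qed.

Lemma truncation_neq0 N a n : truncation N a n != 0 -> (`|n| <= N)%N.
Proof. by rewrite /truncation; case: ifP => // _; rewrite eqxx. Qed.

Definition density_term N a (m : int) t (p : int) : R[i] :=
  truncation N a (p + m) * (truncation N a p)^*%C * e2pi (- ((2 * p + m) * m)%:~R * t).

Lemma density_term_neq0 N a m t p : density_term N a m t p != 0 ->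
  (`|p| <= N)%N /\ (`|(p + m)%R| <= N)%N.
Proof.
rewrite /density_term !mulf_eq0 !negb_or conjc_eq0 => /andP[/andP[h1 h2] _].
by split; [exact: truncation_neq0 h2 | exact: truncation_neq0 h1].
Qed.

Definition truncated_density a N t x : R := normc (schrodinger_poly a N x t) ^+ 2.

Lemma fourier_coef_truncated_density a N t m :
  fourier_coef (truncated_density a N t) m = \sum_(p <- zrange N) density_term N a m t p.
Proof.
have -> : truncated_density a N t = (fun x => normc (\sum_(n <- zrange N)
    (a n * e2pi (- (n%:~R ^+ 2 * t))) * e2pi (n%:~R * x)) ^+ 2).
  apply/funext => x; rewrite /truncated_density /schrodinger_poly; congr (normc _ ^+ 2).
  by apply: eq_bigr => n _; rewrite addrC e2piD mulrA.
rewrite fourier_coef_sqr_trigpoly ?zrange_uniq// big_seq [RHS]big_seq.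
apply: eq_bigr => p pN; rewrite /density_term /truncation !mem_zrange.
rewrite mem_zrange in pN; rewrite pN; case: ifP => _; last by rewrite !mul0r.
rewrite conjcM -e2piN mulrACA -e2piD; congr (_ * e2pi _).
by rewrite !intrM !intrD !intrM; ring.
Qed.

(** The amplitude of the frequency [- 2 m q] in the squared modulus of the
    coefficient of index [m] of the truncated density. *)
Definition quartic_sum N a (m q : int) : R[i] := \sum_(p <- zrange N)
  truncation N a (p + q + m) * (truncation N a (p + q))^*%C *
  ((truncation N a (p + m))^*%C * truncation N a p).

Lemma correlation_density_term N a m t q :
  correlation N (density_term N a m t) q =
  quartic_sum N a m q * e2pi ((- (2 * m * q))%:~R * t).
Proof.
rewrite /correlation mulr_suml; apply: eq_bigr => p _; rewrite /density_term.
rewrite !conjcM conjcK -e2piN mulrACA -e2piD; congr (_ * e2pi _).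
by rewrite mulrNz !intrM !intrD !intrM !intrD; ring.
Qed.

Lemma quartic_sum_le N a (D : R) (m q : int) :
  (forall n : int, normc (a n) <= D * inv_weight R n) ->
  normc (quartic_sum N a m q) <= D ^+ 4 * quartic_kernel R (zrange N) m q.
Proof.
move=> aD; apply: (le_trans (normc_sum _ _ _)); rewrite /quartic_kernel mulr_sumr.
apply: ler_sum => p _; rewrite !Normc.normcM !normc_conj.
have h n : 0 <= normc (truncation N a n) <= D * inv_weight R n.
  by rewrite normc_ge0 (le_trans (truncation_le _ _ _)).
have /andP[A0 A1] := h (p + q + m); have /andP[B0 B1] := h (p + q).
have /andP[C0 C1] := h (p + m); have /andP[E0 E1] := h p.
apply: (@le_trans _ _ ((D * inv_weight R (p + q + m)) * (D * inv_weight R (p + q)) *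
   ((D * inv_weight R (p + m)) * (D * inv_weight R p)))).
  by apply: ler_pM; rewrite ?mulr_ge0//; apply: ler_pM.
by rewrite le_eqVlt; apply/orP; left; apply/eqP; ring.
Qed.

Definition truncated_mass a N M t : R := \sum_(1 <= m < M.+1)
  m%:R * normc (fourier_coef (truncated_density a N t) m%:Z) ^+ 2.

Definition truncated_mean a N M : R := \sum_(1 <= m < M.+1) m%:R *
  \sum_(p <- zrange N) normc (truncation N a (p + m%:Z)) ^+ 2 * normc (truncation N a p) ^+ 2.

Definition fluctuation a N M t : R[i] := \sum_(z <- pair_box M N.*2)
  (z.1%:R%:C * quartic_sum N a z.1%:Z z.2%:Z) * e2pi ((- (2 * z.1%:Z * z.2%:Z))%:~R * t).

Lemma truncated_massE a N M t :
  truncated_mass a N M t = truncated_mean a N M + 2 * complex.Re (fluctuation a N M t).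
Proof.
rewrite /fluctuation big_allpairs/= complex_Re_sum mulr_sumr.
rewrite /truncated_mass /truncated_mean.
rewrite -[in iota 1 M](subn0 M) -subSS -/(index_iota 1 M.+1) -big_split/=.
apply: eq_bigr => m _.
rewrite fourier_coef_truncated_density sqr_normc_sum_correlation; last first.
  by move=> n /density_term_neq0[].
rewrite mulrDr; congr (_ + _).
  congr (_ * _); apply: eq_bigr => p _.
  by rewrite /density_term !Normc.normcM normc_e2pi normc_conj mulr1 exprMn.
rewrite mulrCA; congr (_ * _).
rewrite -[in iota 1 _](subn0 N.*2) -subSS -/(index_iota 1 N.*2.+1).
have -> : m%:R * complex.Re (\sum_(1 <= q < N.*2.+1)
    correlation N (density_term N a m%:Z t) q%:Z) =
    complex.Re (m%:R%:C * \sum_(1 <= q < N.*2.+1) correlation N (density_term N a m%:Z t) q%:Z).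
  by rewrite complex_ReM /= mul0r subr0.
congr (complex.Re _); rewrite mulr_sumr; apply: eq_bigr => q _.
by rewrite correlation_density_term mulrA.
Qed.

Lemma bounded_cfun_fluctuation a N M : bounded_cfun (fluctuation a N M).
Proof. by apply: bounded_cfun_sum => z; apply: bounded_cfunZ; exact: bounded_cfun_e2piZ. Qed.

Lemma bounded_mfun_truncated_mass a N M : bounded_mfun (truncated_mass a N M).
Proof.
rewrite (funext (truncated_massE a N M)).
apply: bounded_mfunD; first exact: bounded_mfun_cst.
by apply: bounded_mfunZ; exact: (bounded_cfun_fluctuation a N M).1.
Qed.

Lemma torus_integral_truncated_mass a N M :
  torus_integral (truncated_mass a N M) = truncated_mean a N M.
Proof.
rewrite (funext (truncated_massE a N M)).
have bR := (bounded_cfun_fluctuation a N M).1.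
rewrite torus_integralD ?torus_integral_cst ?torus_integralZ//; last 2 first.
- exact: bounded_mfun_cst.
- exact: bounded_mfunZ.
rewrite (_ : torus_integral _ = complex.Re (torus_cintegral (fluctuation a N M)))//.
rewrite torus_cintegral_trigpoly big_seq_cond big1 ?mulr0 ?addr0// => z.
move=> /andP[/mem_pair_box[z1 z2]].
have : (0 < z.1 * z.2)%N by rewrite muln_gt0 z1.
by move=> z12; rewrite oppr_eq0 -mulrA -PoszM mulf_eq0 => /orP[//|/eqP[E]]; rewrite E in z12.
Qed.

(** Different pairs [(m, q)] interact only if they have the same product, by
    orthogonality of the exponentials in [t]. *)
Lemma truncated_variance a N M (D : R) : 0 <= D ->
  (forall n : int, normc (a n) <= D * inv_weight R n) ->
  torus_integral (fun t => (truncated_mass a N M t - truncated_mean a N M) ^+ 2)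
  <= 4 * D ^+ 8 * (288 ^+ 2 * 54 * (3 * 18 ^+ 2)).
Proof.
move=> D0 aD; have bF := bounded_cfun_fluctuation a N M.
apply: (@le_trans _ _ (torus_integral (fun t => 4 * normc (fluctuation a N M t) ^+ 2))).
  apply: le_torus_integral.
  - apply: bounded_mfunX; apply: bounded_mfunB; first exact: bounded_mfun_truncated_mass.
    exact: bounded_mfun_cst.
  - by apply: bounded_mfunZ; exact: bounded_mfun_sqr_normc.
  - move=> t _; rewrite truncated_massE addrAC subrr add0r exprMn -natrX.
    rewrite ler_wpM2l// -[leLHS]real_normK ?num_real// lerXn2r ?nnegrE ?normc_ge0//.
    exact: ler_norm_Re.
rewrite torus_integralZ; last exact: bounded_mfun_sqr_normc.
rewrite -mulrA; apply: ler_wpM2l => //.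
apply: (le_trans (le_torus_integral_sqr_trigpoly _ _ _)).
apply: (le_trans _ (ler_wpM2l (exprn_ge0 8 D0)
   (hyperbola_energy R M N.*2 (zrange_uniq N)))).
rewrite [leRHS]mulr_sumr; apply: ler_sum => y _.
rewrite [in leRHS](eq_bigl (fun z => - (2 * y.1%:Z * y.2%:Z) == - (2 * z.1%:Z * z.2%:Z))); last first.
  by move=> z /=; rewrite eqr_opp -!mulrA; apply/eqP/eqP => h; lia.
rewrite [leRHS]mulr_sumr; apply: ler_sum => z _; rewrite !Normc.normcM !normc_real !normr_nat.
have h (x : nat * nat) : 0 <= x.1%:R * normc (quartic_sum N a x.1%:Z x.2%:Z) <=
    D ^+ 4 * (x.1%:R * quartic_kernel R (zrange N) x.1 x.2).
  rewrite mulr_ge0 ?normc_ge0//= mulrCA ler_wpM2l// quartic_sum_le//.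
have /andP[y0 yD] := h y; have /andP[z0 zD] := h z.
apply: (le_trans (ler_pM y0 z0 yD zD)).
by rewrite le_eqVlt; apply/orP; left; apply/eqP; ring.
Qed.

(** A sum of [1 / (1 + |j|)] over [k] integers is [O(log k)]; an eighth root of [k]
    is a sufficient bound. *)
Lemma inv_weight_sum_le (s : seq int) (k : nat) : uniq s -> (size s <= k)%N ->
  \sum_(j <- s) inv_weight R j <= 19 * root8 R k.
Proof.
move=> us sk; have r0 := root8_gt0 R.
(* entries with [|j| <= k] are compared with the summable weight, the others are
   at most [1 / (k + 1)] *)
have key (j : int) : inv_weight R j <= root8 R k * sum_weight R j + (k.+1%:R)^-1.
  have s0 := sum_weight_gt0 R j.
  have [jk|kj] := leqP `|j| k.
    apply: (@le_trans _ _ (root8 R k * sum_weight R j)); last by rewrite lerDl invr_ge0.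
    apply: (@le_trans _ _ (root8 R `|j|%N * sum_weight R j)).
      rewrite inv_weightE /sum_weight; move: (root8 R _) (r0 `|j|%N) => r r00.
      by rewrite (_ : r * (r ^+ 9)^-1 = (r ^+ 8)^-1)//; field; rewrite gt_eqF.
    by rewrite ler_wpM2r// ?le_root8// ltW.
  apply: (@le_trans _ _ (k.+1%:R^-1)); last by rewrite lerDr mulr_ge0// ltW.
  by rewrite /inv_weight lef_pV2 ?posrE// ler_nat; lia.
apply: (le_trans (ler_sum _ (fun j _ => key j))).
rewrite big_split/= -mulr_sumr.
have h1 := sum_weight_uniq R us.
have h2 : \sum_(j <- s) (k.+1%:R)^-1 <= 1 :> R.
  rewrite big_tnth sumr_const card_ord -[leLHS]mulr_natl ler_pdivrMr// mul1r ler_nat.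
  by rewrite (leq_trans sk).
apply: (@le_trans _ _ (root8 R k * 18 + 1)).
  by apply: lerD => //; rewrite ler_wpM2l// ltW.
by have := root8_ge1 R k; lra.
Qed.

(** Moving the window by one unit changes the sum by two terms, both of them
    [O(1 / |n|)]; adding the [|p|] changes gives a logarithm of [|p|]. *)
Lemma sum_window_le (be : int -> R) (C : R) (M : nat) (p : int) :
  (forall n, `|be n| <= C * inv_weight R n) ->
  `|\sum_(1 <= m < M.+1) be (p + m%:Z) - \sum_(1 <= m < M.+1) be m%:Z|
  <= 38 * C * root8 R `|p|%N.
Proof.
move=> beC; pose A (n : int) := \sum_(1 <= m < M.+1) be (n + m%:Z).
have C0 : 0 <= C.
  have := le_trans (normr_ge0 _) (beC 0).
  by rewrite /inv_weight absz0 invr1 mulr1.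
have stepA n : A (n + 1) - A n = be (n + 1 + M%:Z) - be (n + 1).
  rewrite /A -sumrB.
  rewrite (@telescope_sumr_eq _ 1 M.+1 (fun m => be (n + m%:Z))) => [|//|m _].
    by rewrite (_ : n + M.+1%:Z = n + 1 + M%:Z)//; lia.
  by rewrite (_ : n + 1 + m%:Z = n + m.+1%:Z)//; lia.
have window (f1 f2 : nat -> int) k : injective f1 -> injective f2 ->
    \sum_(0 <= i < k) (`|be (f1 i)| + `|be (f2 i)|) <= 38 * C * root8 R k.
  move=> i1 i2; rewrite big_split/=.
  have one f : injective f -> \sum_(0 <= i < k) `|be (f i)| <= C * (19 * root8 R k).
    move=> fi; apply: (le_trans (ler_sum _ (fun i _ => beC (f i)))).
    rewrite -mulr_sumr -(big_map f xpredT (inv_weight R)) ler_wpM2l//.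
    apply: inv_weight_sum_le; first by rewrite map_inj_uniq ?iota_uniq.
    by rewrite size_map size_iota subn0.
  have := lerD (one _ i1) (one _ i2).
  by rewrite (_ : C * _ + C * _ = 38 * C * root8 R k)//; ring.
have A0 : A 0 = \sum_(1 <= m < M.+1) be m%:Z.
  by apply: eq_bigr => m _; rewrite add0r.
rewrite -A0 -/(A p).
have [k [->|->]] : exists k : nat, p = k%:Z \/ p = - k%:Z.
- by case: p => k; [exists k; left | exists k.+1; right; rewrite NegzE].
- rewrite absz_nat; apply: le_trans (window (fun i => i%:Z + 1 + M%:Z) (fun i => i%:Z + 1) k _ _).
  + rewrite -(@telescope_sumr _ 0 k (fun i => A i%:Z))//.
    apply: (le_trans (ler_norm_sum _ _ _)); apply: ler_sum => i _.
    by rewrite -addn1 PoszD stepA ler_normB.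
  + by move=> i j /=; lia.
  + by move=> i j /=; lia.
- rewrite abszN absz_nat distrC.
  apply: le_trans (window (fun i => - i%:Z + M%:Z) (fun i => - i%:Z) k _ _).
  + rewrite -opprB -(@telescope_sumr _ 0 k (fun i => A (- i%:Z))) ?oppr0//.
    rewrite normrN; apply: (le_trans (ler_norm_sum _ _ _)); apply: ler_sum => i _.
    rewrite distrC (_ : - i%:Z = - i.+1%:Z + 1); last by lia.
    by rewrite stepA ler_normB.
  + by move=> i j /=; lia.
  + by move=> i j /=; lia.
Qed.

(** The factor [m] is written as [(p + m) + (- p)]; the symmetry that exchanges
    [p] and [- (p + m)] shows that both parts have the same sum. *)
Lemma truncated_mean_sym a N M : (forall n : int, normc (a (- n)) = normc (a n)) ->
  let b n := normc (truncation N a n) ^+ 2 in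
  truncated_mean a N M =
  2 * \sum_(p <- zrange N) b p * \sum_(1 <= m < M.+1) (p + m%:Z)%:~R * b (p + m%:Z).
Proof.
move=> aN b.
have bN (n : int) : b (- n) = b n.
  by rewrite /b /truncation abszN; case: ifP => // _; rewrite aN.
have b0 n : b n != 0 -> (`|n| <= N)%N.
  by rewrite /b expf_eq0/= normc_eq0 => /truncation_neq0.
rewrite /truncated_mean mulr_sumr.
under [RHS]eq_bigr do rewrite mulr_sumr mulr_sumr.
rewrite exchange_big/=; apply: eq_bigr => m _; rewrite mulr_sumr.
pose F (p : int) : R := (- p)%:~R * b p * b (- p + m%:Z).
have -> : \sum_(p <- zrange N) m%:R * (b (p + m%:Z) * b p) =
    \sum_(p <- zrange N) (p + m%:Z)%:~R * b (p + m%:Z) * b p +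
    \sum_(p <- zrange N) (- p)%:~R * b p * b (p + m%:Z).
  by rewrite -big_split; apply: eq_bigr => p _ /=; rewrite intrD mulrNz -pmulrn; ring.
have -> : \sum_(p <- zrange N) (- p)%:~R * b p * b (p + m%:Z) =
    \sum_(p <- zrange N) (p + m%:Z)%:~R * b (p + m%:Z) * b p.
  rewrite -big_zrange_opp.
  rewrite -[LHS](@big_support_shift _ N (- m%:Z)).
  - apply: eq_bigr => p _; rewrite !opprK bN opprD.
    by rewrite subrK bN.
  - move=> n; rewrite !mulf_eq0 !negb_or => /andP[/andP[_ bn] _].
    by move: bn; rewrite andbb normc_eq0 => /truncation_neq0; rewrite abszN.
  - move=> n; rewrite !mulf_eq0 !negb_or => /andP[_].
    by rewrite andbb normc_eq0 => /truncation_neq0; rewrite -abszN opprD opprK.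
by rewrite -big_split/=; apply: eq_bigr => p _; ring.
Qed.

(** By [sum_window_le] the inner sum of [truncated_mean_sym] depends on [p] only up
    to an error of slow growth in [|p|], which is summable against [b p]. *)
Lemma truncated_mean_approx a N M (D : R) : 0 <= D ->
  (forall n : int, normc (a n) <= D * inv_weight R n) ->
  (forall n : int, normc (a (- n)) = normc (a n)) -> (M <= N)%N ->
  `|truncated_mean a N M - 2 * (\sum_(p <- zrange N) normc (a p) ^+ 2) *
     \sum_(1 <= m < M.+1) m%:R * normc (a m%:Z) ^+ 2| <= 2 * (D ^+ 4 * (38 * 18)).
Proof.
move=> D0 aD aN MN; rewrite truncated_mean_sym//.
pose b n := normc (truncation N a n) ^+ 2; rewrite -/b.
have bE n : (`|n| <= N)%N -> b n = normc (a n) ^+ 2 by rewrite /b /truncation => ->.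
have b0 n : 0 <= b n by exact: sqr_ge0.
have bD n : b n <= D ^+ 2 * inv_weight R n ^+ 2.
  rewrite -exprMn /b lerXn2r ?nnegrE ?normc_ge0//.
    by rewrite mulr_ge0// ltW// inv_weight_gt0.
  exact: le_trans (truncation_le _ _ _) (aD n).
have -> : \sum_(p <- zrange N) normc (a p) ^+ 2 = \sum_(p <- zrange N) b p.
  by rewrite big_seq [RHS]big_seq; apply: eq_bigr => p; rewrite mem_zrange => /bE.
have -> : \sum_(1 <= m < M.+1) m%:R * normc (a m%:Z) ^+ 2 =
    \sum_(1 <= m < M.+1) m%:Z%:~R * b m%:Z.
  by apply: eq_big_nat => m /andP[_ mM]; rewrite bE ?absz_nat ?(leq_trans _ MN)//.
pose be n : R := n%:~R * b n.
have beD n : `|be n| <= D ^+ 2 * inv_weight R n.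
  rewrite /be normrM (ger0_norm (b0 n)).
  apply: (le_trans (ler_wpM2l (normr_ge0 _) (bD n))).
  rewrite mulrCA ler_wpM2l ?sqr_ge0// expr2 mulrA ler_piMl//.
    by rewrite ltW// inv_weight_gt0.
  rewrite /inv_weight ler_pdivrMr// mul1r.
  by rewrite -intr_norm -abszE -pmulrn ler_nat.
rewrite -mulrA -mulrBr normrM ger0_norm// ler_wpM2l//.
rewrite mulr_suml -sumrB; apply: (le_trans (ler_norm_sum _ _ _)).
apply: (@le_trans _ _ (\sum_(p <- zrange N) D ^+ 4 * 38 * sum_weight R p)).
  apply: ler_sum => p _; rewrite -mulrBr normrM (ger0_norm (b0 p)).
  have r0 := root8_gt0 R `|p|%N; have r1 := root8_ge1 R `|p|%N.
  apply: (le_trans (ler_pM (b0 p) (normr_ge0 _) (bD p) (sum_window_le M p beD))).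
  rewrite [leLHS](_ : _ = D ^+ 4 * 38 * (inv_weight R p ^+ 2 * root8 R `|p|%N)); last by ring.
  rewrite ler_wpM2l ?mulr_ge0 ?exprn_ge0// inv_weightE /sum_weight.
  rewrite -exprVn -exprM -[in leRHS]exprVn.
  rewrite [leLHS](_ : _ = (root8 R `|p|%N)^-1 ^+ 9 * (root8 R `|p|%N)^-1 ^+ 6); last first.
    by rewrite (_ : (8 * 2 = 15.+1)%N)// exprSr mulfVK ?gt_eqF// -exprD.
  rewrite ler_piMr ?exprn_ge0 ?invr_ge0 ?(ltW r0)//.
  by rewrite exprn_ile1 ?invr_ge0 ?(ltW r0)// invf_le1.
rewrite -mulr_sumr mulrA ler_wpM2l ?mulr_ge0 ?exprn_ge0//.
exact: sum_weight_uniq (zrange_uniq N).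
Qed.

End truncated_evolution.

(** * From the truncations to the evolution *)

Section integrable_coefficients.
Variable R : realType.
Local Notation mu := (@lebesgue_measure R).
Local Notation integrable01 f := (mu.-integrable `[0, 1] (EFin \o f)).

Lemma le_normc_ReIm (z : R[i]) : normc z <= `|complex.Re z| + `|complex.Im z|.
Proof.
rewrite -(ler_pXn2r (n := 2)) ?nnegrE ?normc_ge0 ?addr_ge0//.
rewrite sqr_normcE sqrrD !real_normK ?num_real//.
by rewrite -addrA lerD2l lerDr mulrn_wge0// mulr_ge0.
Qed.

Lemma measurable_itv01 : measurable (`[(0 : R), 1] : set (measurableTypeR R)).
Proof. exact: measurable_itv. Qed.
Local Hint Resolve measurable_itv01 : core.

Lemma integrable01B (f1 f2 : R -> R) : integrable01 f1 -> integrable01 f2 ->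
  integrable01 (fun x => f1 x - f2 x).
Proof.
move=> i1 i2; have := integrableB measurable_itv01 i1 i2.
by apply: eq_integrable.
Qed.

Lemma integrable01M (f h : R -> R) : integrable01 f -> bounded_mfun h ->
  integrable01 (fun x => f x * h x).
Proof.
move=> i1 [mh [C hC]].
have := @integrableMl _ _ _ mu _ measurable_itv01 _ h i1 (measurable_funS measurableT (@subsetT _ _) mh).
have b : [bounded h x | x in `[(0:R), 1]].
  exists C; split; first exact: num_real.
  by move=> M CM x _ /=; rewrite (le_trans (hC x))// ltW.
by move=> /(_ b); apply: eq_integrable.
Qed.

(** At a fixed time the truncated densities converge to the density in [L^1], and
    this bound transfers the convergence to the Fourier coefficients. *)
Lemma normc_fourier_coefB_le (f1 f2 : R -> R) (m : int) :
  integrable01 f1 -> integrable01 f2 ->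
  normc (fourier_coef f1 m - fourier_coef f2 m) <=
  2 * \int[mu]_(x in `[0, 1]) `|f1 x - f2 x|.
Proof.
move=> i1 i2; have i12 := integrable01B i1 i2.
have i12n := integrable_norm i12.
have part (h : R -> R) : bounded_mfun h -> (forall x, `|h x| <= 1) ->
    `|\int[mu]_(x in `[0, 1]) (f1 x * h x) - \int[mu]_(x in `[0, 1]) (f2 x * h x)| <=
    \int[mu]_(x in `[0, 1]) `|f1 x - f2 x|.
  move=> bh h1; rewrite -RintegralB//; try exact: integrable01M.
  have ih := integrable01B (integrable01M i1 bh) (integrable01M i2 bh).
  apply: (le_trans (le_normr_Rintegral measurable_itv01 ih)).
  apply: le_Rintegral => //; first exact: integrable_norm.
  by move=> x _; rewrite -mulrBl normrM ler_piMr.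
pose c (x : R) : R := cos (2 * pi * (- (m%:~R * x))).
pose s (x : R) : R := sin (2 * pi * (- (m%:~R * x))).
have [bc bs] : bounded_cfun (fun x : R => e2pi (- (m%:~R * x))) by exact: bounded_cfun_e2piN.
apply: (le_trans (le_normc_ReIm _)); rewrite mulr_natl mulr2n.
have E (f : R -> R) : fourier_coef f m =
    (\int[mu]_(x in `[0, 1]) (f x * c x)) +i* (\int[mu]_(x in `[0, 1]) (f x * s x)).
  rewrite /fourier_coef /torus_cintegral; congr (_ +i* _); apply: eq_Rintegral => x _.
    by rewrite complex_ReM /= mul0r subr0.
  by rewrite complex_ImM /= mul0r addr0.
rewrite !E; apply: lerD.
  by rewrite [complex.Re _]/=; apply: part => // x; exact: cos_max.
by rewrite [complex.Im _]/=; apply: part => // x; exact: sin_max.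
Qed.

(** [2 |z - w| |w|] is at most [|z - w|^2 / d + d |w|^2]. The factor [d] is meant
    to be small, so that closeness in [L^2] of two functions gives closeness in
    [L^1] of their squared moduli. *)
Lemma sqr_normc_perturb (z w : R[i]) (d : R) : 0 < d ->
  `|normc z ^+ 2 - normc w ^+ 2| <= (1 + d^-1) * normc (z - w) ^+ 2 + d * normc w ^+ 2.
Proof.
move=> d0; have h := ler_normcB z w.
have zw : normc z <= normc (z - w) + normc w.
  by rewrite -{1}(subrK w z) le_normcD.
move: (normc_ge0 z) (normc_ge0 w) (normc_ge0 (z - w)) h zw.
move: (normc z) (normc w) (normc (z - w)) => a b c a0 b0 c0 h zw.
rewrite subr_sqr normrM (ger0_norm (addr_ge0 a0 b0)).
apply: (@le_trans _ _ (c * (c + 2 * b))).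
  by apply: ler_pM => //; [rewrite addr_ge0|lra].
rewrite -subr_ge0 (_ : _ - _ = d * (d^-1 * c - b) ^+ 2); last by field; rewrite gt_eqF.
by rewrite mulr_ge0 ?sqr_ge0// ltW.
Qed.

End integrable_coefficients.

Section evolution.
Variable R : realType.
Local Notation mu := (@lebesgue_measure R).
Local Notation integrable01 f := (mu.-integrable `[0, 1] (EFin \o f)).
Let I01 := @measurable_itv01 R.
Local Hint Resolve I01 : core.
Variables (g T : R -> R) (V : R).
Hypothesis pg : periodic g 1.
Hypothesis gT : variation_majorant g T V.
Variable u : R -> R -> R[i].
Hypothesis gu : schrodinger_evolution g u.

Let bg : bounded_mfun g := bv_bounded_mfun pg gT.
Let a := fourier_coef g.
Let B := torus_integral (fun x => g x ^+ 2).

Lemma bounded_cfun_schrodinger_poly (c : int -> R[i]) N (t : R) :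
  bounded_cfun (fun x => schrodinger_poly c N x t).
Proof. exact: bounded_cfun_trigpoly. Qed.

Lemma bounded_mfun_truncated_density (c : int -> R[i]) N (t : R) :
  bounded_mfun (truncated_density c N t).
Proof. exact/bounded_mfun_sqr_normc/bounded_cfun_schrodinger_poly. Qed.

Lemma torus_integral_truncated_density (c : int -> R[i]) N (t : R) :
  torus_integral (truncated_density c N t) = \sum_(p <- zrange N) normc (c p) ^+ 2.
Proof.
have := fourier_coef_truncated_density c N t 0.
rewrite /fourier_coef; under eq_fun do rewrite mul0r oppr0 e2pi0 mulr1.
rewrite torus_cintegral_real => h; have {h} := congr1 (@complex.Re R) h.
rewrite /= => ->; rewrite complex_Re_sum big_seq [RHS]big_seq.
apply: eq_bigr => p; rewrite mem_zrange => pN.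
rewrite /density_term addr0 mulr0 oppr0 mul0r e2pi0 mulr1 mulc_conj.
by rewrite /truncation pN.
Qed.

Lemma sum_sqr_coef_le N : \sum_(p <- zrange N) normc (a p) ^+ 2 <= B.
Proof.
apply: (le_trans (bessel (bounded_cfun_real bg) (zrange_uniq N))).
apply: le_torus_integral.
- by apply: bounded_mfun_sqr_normc; exact: bounded_cfun_real.
- exact: bounded_mfunX.
- by move=> x _; rewrite normc_real real_normK ?num_real.
Qed.

Lemma measurable_sqr_normc (F : R -> R[i]) (D : set (measurableTypeR R)) :
  measurable_fun D (fun x => complex.Re (F x)) ->
  measurable_fun D (fun x => complex.Im (F x)) ->
  measurable_fun D (fun x => normc (F x) ^+ 2).
Proof.
move=> mr mi; under eq_fun do rewrite sqr_normcE.
by apply: measurable_funD; apply: measurable_funX.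
Qed.

Let defect N t x := normc (u x t - schrodinger_poly a N x t) ^+ 2.

Let measurable_defect N t : measurable_fun `[(0 : R), 1] (defect N t).
Proof.
have [_ mr mi _] := gu t; have [[sr _] [si _]] := bounded_cfun_schrodinger_poly a N t.
apply: measurable_sqr_normc.
  have -> : (fun x => complex.Re (u x t - schrodinger_poly a N x t)) =
     (fun x => complex.Re (u x t) - complex.Re (schrodinger_poly a N x t)).
    by apply/funext => x; case: (u x t); case: (schrodinger_poly _ _ _ _).
  by apply: measurable_funB => //; exact: measurable_funS measurableT (@subsetT _ _) sr.
have -> : (fun x => complex.Im (u x t - schrodinger_poly a N x t)) =
   (fun x => complex.Im (u x t) - complex.Im (schrodinger_poly a N x t)).
  by apply/funext => x; case: (u x t); case: (schrodinger_poly _ _ _ _).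
by apply: measurable_funB => //; exact: measurable_funS measurableT (@subsetT _ _) si.
Qed.

Let defect_cvg t : (\forall N \near \oo, integrable01 (defect N t)) /\
  torus_integral (defect N t) @[N --> \oo] --> 0.
Proof.
have [_ _ _ h] := gu t.
have {}h : (\int[mu]_(x in `[0%R, 1%R]) (defect N t x)%:E)%E @[N --> \oo] --> 0%E.
  move: h; apply: cvg_trans; apply: near_eq_cvg; apply: nearW => N.
  by apply: eq_integral => x _; rewrite schrodinger_partial_sumE.
have /fine_cvgP[hf hc] := h.
split; last exact: hc.
near=> N; apply/integrableP; split.
  by apply/measurable_EFinP; exact: measurable_defect.
under eq_integral do rewrite /= ger0_norm ?sqr_ge0//.
suff : (\int[mu]_(x in `[0%R, 1%R]) (defect N t x)%:E)%E \is a fin_num.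
  by rewrite ge0_fin_numE// integral_ge0// => x _; rewrite lee_fin sqr_ge0.
by near: N.
Unshelve. all: by end_near. Qed.

Let perturb N t x (d : R) : 0 < d ->
  `|density u t x - truncated_density a N t x| <=
  (1 + d^-1) * defect N t x + d * truncated_density a N t x.
Proof. exact: sqr_normc_perturb. Qed.

Let measurable_density t : measurable_fun `[(0 : R), 1] (density u t).
Proof. by have [_ mr mi _] := gu t; exact: measurable_sqr_normc. Qed.

Let integrable_truncated N t : integrable01 (truncated_density a N t).
Proof. exact: bounded_mfun_integrable (bounded_mfun_truncated_density a N t). Qed.

Let integrable_bound N t (d : R) : integrable01 (defect N t) ->
  integrable01 (fun x => (1 + d^-1) * defect N t x + d * truncated_density a N t x).
Proof.
move=> i1.
have := integrableD I01 (integrableZl I01 (1 + d^-1) i1)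
  (integrableZl I01 d (integrable_truncated N t)).
by apply: eq_integrable.
Qed.

Lemma integrable_density t : integrable01 (density u t).
Proof.
have [[N _ h] _] := defect_cvg t; have {}h := h N (leqnn N).
have idiff : integrable01 (fun x => density u t x - truncated_density a N t x).
  apply: le_integrable (integrable_bound 1 h) => //.
  - apply/measurable_EFinP; apply: measurable_funB; first exact: measurable_density.
    exact: measurable_funS measurableT (@subsetT _ _) (bounded_mfun_truncated_density a N t).1.
  - move=> x _; rewrite /= lee_fin (le_trans (perturb N t x ltr01))// ler_norm//.
have := integrableD I01 idiff (integrable_truncated N t).
by apply: eq_integrable => // x _; rewrite /= -EFinD subrK.
Qed.

Lemma density_L1_cvg t :
  \int[mu]_(x in `[0, 1]) `|density u t x - truncated_density a N t x| @[N --> \oo] --> 0.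
Proof.
have [h1 h2] := defect_cvg t.
have B0 : 0 <= B by apply: torus_integral_ge0 => x; exact: sqr_ge0.
apply/cvgrPdist_le => e e0.
pose d := e / (2 * (B + 1)).
have d0 : 0 < d by rewrite divr_gt0// mulr_gt0// ltr_wpDl.
have c0 : 0 < 1 + d^-1 by rewrite addr_gt0// invr_gt0.
near=> N; rewrite sub0r normrN.
have iN : integrable01 (defect N t) by near: N.
have idiff := integrable01B (integrable_density t) (integrable_truncated N t).
rewrite ger0_norm; last by apply: Rintegral_ge0 => //.
apply: (@le_trans _ _ (\int[mu]_(x in `[0, 1])
   ((1 + d^-1) * defect N t x + d * truncated_density a N t x))).
  apply: le_Rintegral => //; [exact: integrable_norm|exact: integrable_bound|].
  by move=> x _; exact: perturb.
rewrite RintegralD//; last 2 first.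
- by have := integrableZl I01 (1 + d^-1) iN; apply: eq_integrable.
- by have := integrableZl I01 d (integrable_truncated N t); apply: eq_integrable.
rewrite !RintegralZl// -/(torus_integral (truncated_density a N t)).
rewrite torus_integral_truncated_density.
have /ler_wpM2l : \sum_(p <- zrange N) normc (a p) ^+ 2 <= B + 1.
  by rewrite (le_trans (sum_sqr_coef_le N))// lerDl.
move=> /(_ d (ltW d0)) hB.
have hD : (1 + d^-1) * torus_integral (defect N t) <= e / 2.
  rewrite -ler_pdivlMl// ltW//; apply: le_lt_trans (ler_norm _) _.
  have : `|0 - torus_integral (defect N t)| < (1 + d^-1)^-1 * (e / 2).
    near: N; apply: cvgr_dist_lt => //.
    by rewrite mulr_gt0 ?invr_gt0// divr_gt0.
  by rewrite sub0r normrN.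
apply: (le_trans (lerD hD hB)).
rewrite /d (_ : e / (2 * (B + 1)) * (B + 1) = e / 2); last first.
  by field; rewrite gt_eqF// ltr_wpDl.
by rewrite -splitr.
Unshelve. all: by end_near. Qed.

Lemma fourier_coef_density_cvg t (m : int) :
  normc (fourier_coef (density u t) m - fourier_coef (truncated_density a N t) m)
  @[N --> \oo] --> 0.
Proof.
apply: (@squeeze_cvgr _ _ _ _ (cst 0)
  (fun N => 2 * \int[mu]_(x in `[0, 1]) `|density u t x - truncated_density a N t x|)).
- apply: nearW => N; rewrite normc_ge0/=.
  exact: normc_fourier_coefB_le (integrable_density t) (integrable_truncated N t).
- exact: cvg_cst.
- rewrite -[X in _ --> X](mulr0 2); apply: cvgM; first exact: cvg_cst.
  exact: density_L1_cvg.
Qed.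

Lemma critical_mass_cvg M t :
  truncated_mass a N M t @[N --> \oo] --> critical_mass u M t.
Proof.
apply: cvg_sum_seq => m; apply: cvgM; first exact: cvg_cst.
rewrite expr2; under eq_fun do rewrite expr2.
suff h : normc (fourier_coef (truncated_density a N t) m) @[N --> \oo] -->
    normc (fourier_coef (density u t) m) by exact: cvgM.
apply/cvgrPdist_le => e e0.
have /cvgrPdist_le/(_ e e0) := fourier_coef_density_cvg t m.
apply: filterS => N; rewrite sub0r normrN; apply: le_trans.
by rewrite (le_trans (ler_normcB _ _))// ler_norm.
Qed.

(** The Fourier coefficients of a nonnegative function are at most its mean, here
    at most the mean of [g ^ 2]. *)
Lemma truncated_mass_bound M : exists C : R, forall N t, `|truncated_mass a N M t| <= C.
Proof.
exists (\sum_(1 <= m < M.+1) m%:R * B ^+ 2) => N t.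
have B0 : 0 <= B by apply: torus_integral_ge0 => x; exact: sqr_ge0.
rewrite ger0_norm; last by apply: sumr_ge0 => m _; rewrite mulr_ge0 ?sqr_ge0.
apply: ler_sum => m _; rewrite ler_wpM2l// lerXn2r ?nnegrE ?normc_ge0//.
have bt := bounded_mfun_truncated_density a N t.
apply: (le_trans (le_normc_fourier_coef _ bt)).
apply: le_trans (sum_sqr_coef_le N).
rewrite -(torus_integral_truncated_density a N t) le_torus_integral//.
  exact: bounded_mfun_norm.
by move=> x _; rewrite ger0_norm ?sqr_ge0.
Qed.

Lemma critical_mass_integral_cvg M : bounded_mfun (critical_mass u M) /\
  truncated_mean a N M @[N --> \oo] --> torus_integral (critical_mass u M).
Proof.
have [C hC] := truncated_mass_bound M.
have [] := @cvg_torus_integral R (fun N => truncated_mass a N M) (critical_mass u M) C _ hC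
  (@critical_mass_cvg M).
  by move=> N; exact: (bounded_mfun_truncated_mass a N M).1.
move=> h1 h2; split => //.
by move: h2; apply: cvg_trans; apply: near_eq_cvg; apply: nearW => N;
  rewrite torus_integral_truncated_mass.
Qed.

Let mean M := torus_integral (critical_mass u M).

Lemma fourier_coef_inv_weight : exists2 D : R, 0 <= D &
  forall n : int, normc (a n) <= D * inv_weight R n.
Proof.
pose A := torus_integral (fun x => `|g x|).
have A0 : 0 <= A by exact: torus_integral_ge0.
exists (V + A); first by rewrite addr_ge0// (majorant_mass_ge0 gT).
move=> n; rewrite /inv_weight ler_pdivlMr// -natr1 mulrDr mulr1 lerD//.
  by rewrite pmulrn abszE; exact: fourier_coef_decay pg gT n.
exact: le_normc_fourier_coef.
Qed.

Let coef_sym (n : int) : normc (a (- n)) = normc (a n).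
Proof. by rewrite /a fourier_coefN// normc_conj. Qed.

Lemma critical_mass_mean_approx : exists K : R, forall M,
  `|mean M - 2 * B * \sum_(1 <= m < M.+1) m%:R * normc (a m%:Z) ^+ 2| <= K.
Proof.
have [D D0 aD] := fourier_coef_inv_weight.
exists (2 * (D ^+ 4 * (38 * 18))) => M.
set S := \sum_(1 <= m < _) _.
have h : `|truncated_mean a N M - 2 * (\sum_(p <- zrange N) normc (a p) ^+ 2) * S|
    @[N --> \oo] --> `|mean M - 2 * B * S|.
  apply: cvg_norm; apply: cvgB; first exact: (critical_mass_integral_cvg M).2.
  apply: cvgMl; apply: cvgMr; exact: (parseval_bv pg gT).
apply: (@closed_cvg _ _ \oo eventually_filter _ (fun x => x <= 2 * (D ^+ 4 * (38 * 18))) _ _ _ h).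
  exact: closed_le.
near=> N; apply: truncated_mean_approx => //.
by near: N; exact: nbhs_infty_ge.
Unshelve. all: by end_near. Qed.

Lemma critical_mass_variance : exists K : R, forall M,
  torus_integral (fun t => (critical_mass u M t - mean M) ^+ 2) <= K.
Proof.
have [D D0 aD] := fourier_coef_inv_weight.
set K := 4 * D ^+ 8 * (288 ^+ 2 * 54 * (3 * 18 ^+ 2)).
exists K => M; have [C hC] := truncated_mass_bound M.
have hmean N : `|truncated_mean a N M| <= C.
  rewrite -torus_integral_truncated_mass.
  have bm := bounded_mfun_truncated_mass a N M.
  apply: (le_trans (le_norm_torus_integral bm)).
  rewrite -[leRHS](torus_integral_cst C) le_torus_integral//.
  - exact: bounded_mfun_norm.
  - exact: bounded_mfun_cst.
have [_ hm] := critical_mass_integral_cvg M.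
have h1 N : measurable_fun [set: R] (fun t => (truncated_mass a N M t - truncated_mean a N M) ^+ 2).
  apply: (bounded_mfunX _ _).1; apply: bounded_mfunB.
    exact: bounded_mfun_truncated_mass.
  exact: bounded_mfun_cst.
have h2 N t : `|(truncated_mass a N M t - truncated_mean a N M) ^+ 2| <= (C + C) ^+ 2.
  rewrite ger0_norm ?sqr_ge0// -[leLHS]real_normK ?num_real//.
  rewrite lerXn2r ?nnegrE ?addr_ge0 ?(le_trans _ (hmean N))//.
  by rewrite (le_trans (ler_normB _ _))// lerD.
have h3 t : (truncated_mass a N M t - truncated_mean a N M) ^+ 2 @[N --> \oo] -->
    (critical_mass u M t - mean M) ^+ 2.
  rewrite expr2; under eq_fun do rewrite expr2.
  by apply: cvgM; apply: cvgB => //; exact: critical_mass_cvg.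
have [_ h] := cvg_torus_integral h1 h2 h3.
apply: (@closed_cvg _ _ \oo eventually_filter _ (fun x => x <= K) _ _ _ h).
  exact: closed_le.
by apply: nearW => N; exact: truncated_variance.
Qed.

End evolution.

(** * Mean, variance and almost everywhere growth of the critical mass *)

Section almost_everywhere.
Variable R : realType.
Local Notation mu := (@lebesgue_measure R).

(** The Borel-Cantelli argument in the form used below: summable means force
    pointwise decay. *)
Lemma ae_cvg0_of_summable (F : nat -> R -> R) (C : R) :
  (forall k, bounded_mfun (F k)) -> (forall k x, 0 <= F k x) ->
  (forall n, \sum_(0 <= k < n) torus_integral (F k) <= C) ->
  {ae mu, forall x : R, 0 <= x <= 1 -> F k x @[k --> \oo] --> 0}.
Proof.
move=> bF F0 FC; pose f k (x : measurableTypeR R) := (F k x)%:E.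
have mD : measurable (`[0, 1] : set (measurableTypeR R)) by exact: measurable_itv.
have mf k : measurable_fun (`[0, 1] : set (measurableTypeR R)) (f k).
  by apply/measurable_EFinP; exact: measurable_funS measurableT (@subsetT _ _) (bF k).1.
have f0 k x : (0 <= f k x)%E by rewrite lee_fin.
have intf : (\int[mu]_(x in `[0%R, 1%R]) (\sum_(k <oo) f k x) <= C%:E)%E.
  rewrite integral_nneseries//.
  apply: lime_le.
    by apply: is_cvg_nneseries => k _ _; apply: integral_ge0 => x _; exact: f0.
  apply: nearW => n.
  rewrite (eq_bigr (fun k => (torus_integral (F k))%:E)); last first.
    by move=> k _; rewrite torus_integralE.
  by rewrite sumEFin lee_fin.
have iF : mu.-integrable `[0, 1] (fun x => (\sum_(k <oo) f k x)%E).
  apply/integrableP; split.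
    by apply: ge0_emeasurable_sum => // k x _ _; exact: f0.
  rewrite (eq_integral (fun x => (\sum_(k <oo) f k x)%E)).
    exact: le_lt_trans intf (ltry _).
  by move=> x _; rewrite gee0_abs// nneseries_ge0.
have := integrable_ae mD iF.
apply: (@filterS _ _ (ae_filter_ringOfSetsType _)) => x h x01.
have {h x01}h : (\sum_(k <oo) f k x)%E \is a fin_num.
  by apply: h; rewrite /= in_itv.
apply: cvg_series_cvg_0; apply: nondecreasing_is_cvgn.
  by apply/nondecreasing_seqP => n; rewrite seriesSr lerDl F0.
exists (fine (\sum_(k <oo) f k x)%E) => _ [n _ <-].
rewrite -lee_fin fineK// /series/= -sumEFin.
exact: (@nneseries_lim_ge _ (f^~ x) xpredT 0%N n (fun k _ _ => f0 k x)).
Qed.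

Lemma ln2_ge_half : 2^-1 <= ln (2 : R).
Proof. by have := @ln_succ_ge R 1 isT; rewrite ln1 subr0. Qed.

(** Between two consecutive powers of [2] the logarithm varies by [ln 2] only, and
    monotonicity confines [v]. *)
Lemma log_asymp_dyadic (v : nat -> R) (L : R) : 0 <= L ->
  (forall m n, (m <= n)%N -> v m <= v n) ->
  (forall eps : R, 0 < eps -> exists C : R, forall k,
     `|v (2 ^ k)%N - L * ln (2 ^ k)%N%:R| <= eps * ln (2 ^ k)%N%:R + C) ->
  log_asymp v L.
Proof.
move=> L0 vm H eps e0; have [C HC] := H eps e0.
exists (C + (L + eps) * ln 2) => N N0.
have /andP[kN Nk] := @trunc_log_bounds 2 N isT N0.
set k := trunc_log 2 N in kN Nk.
have lnS : ln (2 ^ k.+1)%N%:R = ln 2 + ln (2 ^ k)%N%:R :> R.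
  by rewrite expnS natrM lnM ?posrE// ltr0n expn_gt0.
have l1 : ln (2 ^ k)%N%:R <= ln N%:R :> R.
  by rewrite ler_ln ?posrE ?ltr0n ?expn_gt0// ler_nat.
have l2 : ln N%:R <= ln (2 ^ k.+1)%N%:R :> R.
  by rewrite ler_ln ?posrE ?ltr0n ?expn_gt0// ler_nat ltnW.
have l20 : 0 <= ln (2 : R) by exact: ln_nat_ge0.
have /ler_normlP[h1 _] := HC k; have /ler_normlP[_ h2] := HC k.+1.
have v1 := vm _ _ kN; have v2 := vm _ _ (ltnW Nk).
have m1 := ler_wpM2l L0 l1; have m2 := ler_wpM2l L0 l2.
have m3 := ler_wpM2l (ltW e0) l1.
have m4 := mulr_ge0 L0 l20; have m5 := mulr_ge0 (ltW e0) l20.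
rewrite lnS !mulrDr in h2 m2; rewrite mulrDl.
by apply/ler_normlP; split; lra.
Qed.

Lemma sum_inv_square (n : nat) : \sum_(0 <= k < n) (k.+1%:R ^+ 2)^-1 <= 2 :> R.
Proof.
suff h : \sum_(0 <= k < n.+1) (k.+1%:R ^+ 2)^-1 <= 2 - n.+1%:R^-1 :> R.
  apply: (@le_trans _ _ (\sum_(0 <= k < n.+1) (k.+1%:R ^+ 2)^-1)).
    by rewrite big_nat_recr//= lerDl invr_ge0 sqr_ge0.
  by rewrite (le_trans h)// lerBlDr lerDl invr_ge0.
elim: n => [|n IH]; first by rewrite big_nat1 expr1n invr1; lra.
rewrite big_nat_recr//=; apply: (le_trans (lerD IH (lexx _))).
have : (0 : R) < n.+1%:R by []. 
rewrite -[n.+2%:R]natr1; move: (n.+1%:R) => x x0.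
rewrite -subr_ge0 (_ : _ - _ = (x * (x + 1) ^+ 2)^-1); last first.
  by field; rewrite !gt_eqF//; lra.
by rewrite invr_ge0 mulr_ge0 ?sqr_ge0// ltW.
Qed.

End almost_everywhere.

Section critical_mass_laws.
Variable R : realType.
Local Notation mu := (@lebesgue_measure R).
Variables (g T : R -> R) (V : R).
Hypothesis pg : periodic g 1.
Hypothesis gT : variation_majorant g T V.
Variable u : R -> R -> R[i].
Hypothesis gu : schrodinger_evolution g u.

Let bg : bounded_mfun g := bv_bounded_mfun pg gT.
Let a := fourier_coef g.
Let B := torus_integral (fun x => g x ^+ 2).
Let mean M := torus_integral (critical_mass u M).

Lemma bounded_mfun_critical_mass M : bounded_mfun (critical_mass u M).
Proof. exact: (critical_mass_integral_cvg pg gT gu M).1. Qed.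

Lemma critical_mass_nondecreasing t (m n : nat) : (m <= n)%N ->
  critical_mass u m t <= critical_mass u n t.
Proof.
move=> mn; rewrite /critical_mass (@big_cat_nat _ _ _ m.+1 1 n.+1)//= lerDl.
by apply: sumr_ge0 => k _; rewrite mulr_ge0// sqr_ge0.
Qed.

Lemma truncated_density_time_periodic N t :
  truncated_density a N (t + 1) = truncated_density a N t.
Proof.
apply/funext => x; rewrite /truncated_density /schrodinger_poly; congr (normc _ ^+ 2).
apply: eq_bigr => n _; congr (_ * _).
by rewrite mulrDr mulr1 opprD addrA e2piD -rmorphXn -rmorphN/= e2pi_int mulr1.
Qed.

Lemma critical_mass_periodic M : periodic (critical_mass u M) 1.
Proof.
move=> t; have h1 := @critical_mass_cvg _ _ _ _ pg gT _ gu M (t + 1).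
have h2 := @critical_mass_cvg _ _ _ _ pg gT _ gu M t.
rewrite -(cvg_lim (@Rhausdorff R) h1) -(cvg_lim (@Rhausdorff R) h2).
congr (lim (_ @ \oo)); apply/funext => N; rewrite /truncated_mass.
by rewrite truncated_density_time_periodic.
Qed.

Lemma kappa_ge0 : 0 <= kappa g.
Proof.
rewrite /kappa divr_ge0 ?mulr_ge0 ?sqr_ge0 ?pi_ge0//.
  by apply: (@torus_integral_ge0 _ (fun x => g x ^+ 2)) => x; exact: sqr_ge0.
by rewrite fine_ge0// esum_ge0// => x _; rewrite lee_fin sqr_ge0.
Qed.

(** The constant is [2 |g|^2 * (S / (4 pi^2))], with [S] the sum of the squared
    jumps. *)
Lemma mean_log_asymp : log_asymp mean (kappa g).
Proof.
have [_ J] := sqr_modulus_cvg pg gT; set S := fine _ in J.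
have [_ [G hG]] := bg; have G0 : 0 <= G by exact: le_trans (normr_ge0 _) (hG 0).
have h : log_asymp (fun N => \sum_(1 <= k < N.+1) k%:R * normc (a k%:Z) ^+ 2)
    (S / (4 * pi ^+ 2)).
  apply: (@log_average_coefficients _ (fun n => normc (a n) ^+ 2) (sqr_modulus g) S (V ^+ 2)
    ((G + G) ^+ 2)).
  - by move=> n; exact: sqr_ge0.
  - by move=> n; rewrite /a fourier_coefN// normc_conj.
  - move=> n; rewrite -[X in X * _]real_normK ?num_real// -intr_norm -exprMn.
    rewrite lerXn2r ?nnegrE ?mulr_ge0 ?normc_ge0 ?ler0z//.
      exact: majorant_mass_ge0 gT.
    by rewrite mulrC; exact: fourier_coef_decay pg gT n.
  - by move=> h; exact: (@parseval_increments _ _ _ _ pg gT).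
  - exact: J.
  - move=> h; rewrite ger0_norm; last by apply: torus_integral_ge0 => x; exact: sqr_ge0.
    rewrite -[leRHS](@torus_integral_cst R) le_torus_integral//.
    + apply: bounded_mfunX; apply: bounded_mfunB => //.
      exact: (bounded_mfun_shift (- h)).
    + exact: bounded_mfun_cst.
    + move=> x _; rewrite -[leLHS]real_normK ?num_real// lerXn2r ?nnegrE ?addr_ge0//.
      by rewrite (le_trans (ler_normB _ _))// lerD.
have [K hK] := critical_mass_mean_approx pg gT gu.
have -> : kappa g = 2 * B * (S / (4 * pi ^+ 2)).
  rewrite /kappa -/S -/(torus_integral (fun x => g x ^+ 2)) -/B.
  have p0 : (pi : R) != 0 by rewrite lt0r_neq0 ?pi_gt0.
  move: (pi : R) p0 => q q0; field; exact: q0.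
apply: (@log_asymp_bounded _ _ _ _ K (@log_asympZ _ _ _ (2 * B) h)) => N _.
exact: hK.
Qed.

Lemma mean_cvg : mean N / ln N%:R @[N --> \oo] --> kappa g.
Proof. exact: (@log_asymp_cvg _ _ _ mean_log_asymp). Qed.

Local Notation P := (uniform_prob (@ltr01 R)).

Lemma critical_mass_expectation M : ('E_P[critical_mass u M] = (mean M)%:E)%E.
Proof.
by rewrite unlock integral_uniform_torus//; exact: bounded_mfun_critical_mass.
Qed.

Lemma expectation_asymptotics : exists eps : nat -> R, eps @ \oo --> 0 /\
  \forall M \near \oo,
    ('E_P[critical_mass u M] = ((kappa g + eps M) * ln M%:R)%:E)%E.
Proof.
exists (fun M => mean M / ln M%:R - kappa g); split.
  by rewrite -(subrr (kappa g)); apply: cvgB; [exact: mean_cvg|exact: cvg_cst].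
near=> M; rewrite critical_mass_expectation addrC subrK divfK//.
rewrite gt_eqF// ln_gt0// ltr1n; near: M; exact: nbhs_infty_gt.
Unshelve. all: by end_near. Qed.

Lemma variance_asymptotics : exists C : R,
  \forall M \near \oo, ('V_P[critical_mass u M] <= (C * ln M%:R)%:E)%E.
Proof.
have [K hK] := critical_mass_variance pg gT gu.
have K0 : 0 <= K by apply: le_trans (hK 0%N); apply: torus_integral_ge0 => t; exact: sqr_ge0.
exists K; near=> M.
have lM : 1 <= ln (M%:R : R) by near: M; move/cvgryPge : (@cvg_ln_nat R); apply.
rewrite /variance unlock critical_mass_expectation/=.
have -> : (critical_mass u M \- cst (mean M)) * (critical_mass u M \- cst (mean M)) =
    (fun t => (critical_mass u M t - mean M) ^+ 2).
  by apply/funext => t; rewrite expr2.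
rewrite unlock integral_uniform_torus; last first.
  by apply: bounded_mfunX; apply: bounded_mfunB;
    [exact: bounded_mfun_critical_mass|exact: bounded_mfun_cst].
by rewrite lee_fin (le_trans (hK M))// ler_peMr.
Unshelve. all: by end_near. Qed.

Lemma ae_dyadic_fluctuation : {ae mu, forall t : R, 0 <= t <= 1 ->
  (k.+1%:R ^+ 2)^-1 * (critical_mass u (2 ^ k)%N t - mean (2 ^ k)%N) ^+ 2 @[k --> \oo] --> 0}.
Proof.
have [K hK] := critical_mass_variance pg gT gu.
have K0 : 0 <= K by apply: le_trans (hK 0%N); apply: torus_integral_ge0 => t; exact: sqr_ge0.
pose F k t := (k.+1%:R ^+ 2)^-1 * (critical_mass u (2 ^ k)%N t - mean (2 ^ k)%N) ^+ 2.
have bF0 k : bounded_mfun (fun t => (critical_mass u (2 ^ k)%N t - mean (2 ^ k)%N) ^+ 2).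
  by apply: bounded_mfunX; apply: bounded_mfunB;
    [exact: bounded_mfun_critical_mass|exact: bounded_mfun_cst].
apply: (@ae_cvg0_of_summable R F (2 * K)).
- by move=> k; exact: bounded_mfunZ.
- by move=> k x; rewrite mulr_ge0 ?sqr_ge0// invr_ge0 sqr_ge0.
- move=> n; apply: (@le_trans _ _ (\sum_(0 <= k < n) (k.+1%:R ^+ 2)^-1 * K)).
    apply: ler_sum => k _; rewrite torus_integralZ// ler_wpM2l ?invr_ge0 ?sqr_ge0//.
  by rewrite -mulr_suml ler_wpM2r// sum_inv_square.
Qed.

Lemma ae_critical_mass_log_asymp :
  {ae mu, forall t : R, log_asymp (critical_mass u ^~ t) (kappa g)}.
Proof.
apply: ae_periodic.
- by move=> t; under eq_fun do rewrite -(critical_mass_periodic _ t).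
- by move=> t; under eq_fun do rewrite (critical_mass_periodic _ t).
have := ae_dyadic_fluctuation.
apply: (@filterS _ _ (ae_filter_ringOfSetsType _)) => t h t01; have {h}h := h t01.
apply: log_asymp_dyadic; [exact: kappa_ge0|by move=> m n; exact: critical_mass_nondecreasing|].
move=> eps e0; have e4 : 0 < eps / 4 by rewrite divr_gt0.
have [C1 hC1] := mean_log_asymp e4.
have e16 : 0 < (eps / 4) ^+ 2 by rewrite exprn_gt0.
have [k0 _ hk0] : \forall k \near \oo,
   (k.+1%:R ^+ 2)^-1 * (critical_mass u (2 ^ k)%N t - mean (2 ^ k)%N) ^+ 2 <= (eps / 4) ^+ 2.
  have /cvgrPdist_le/(_ _ e16) := h.
  apply: filterS => k; rewrite sub0r normrN; apply: le_trans; exact: ler_norm.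
pose C2 := \sum_(k < k0) `|critical_mass u (2 ^ k)%N t - mean (2 ^ k)%N|.
have d k : `|critical_mass u (2 ^ k)%N t - mean (2 ^ k)%N| <= eps / 4 * (k%:R + 1) + C2.
  rewrite natr1; have [kk0|kk0] := ltnP k k0.
    rewrite /C2 (bigD1 (Ordinal kk0))//= addrCA lerDl addr_ge0// ?sumr_ge0//.
    by rewrite mulr_ge0// ltW.
  have := hk0 k kk0; rewrite mulrC ler_pdivrMr ?exprn_gt0// -exprMn => hh.
  have C20 : 0 <= C2 by apply: sumr_ge0.
  apply: (@le_trans _ _ (eps / 4 * k.+1%:R)); last by rewrite lerDl.
  rewrite -(ler_pXn2r (n := 2)) ?nnegrE ?(mulr_ge0 (ltW e4))//.
  by rewrite real_normK ?num_real.
exists (C1 + C2 + eps / 4) => k.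
have lnk : ln (2 ^ k)%N%:R = k%:R * ln 2 :> R.
  by rewrite natrX lnXn// mulr_natl.
have := d k; have := hC1 (2 ^ k)%N; rewrite expn_gt0/= => /(_ isT) h1 h2.
have := lerD h1 h2; rewrite addrC; move/(le_trans (ler_normD _ _)).
rewrite addrA subrK => /le_trans; apply.
rewrite mulrDr mulr1.
have : k%:R <= 2 * ln (2 ^ k)%N%:R :> R.
  have := ler_wpM2l (ler0n R k) (ln2_ge_half R); rewrite lnk; lra.
move=> /(ler_wpM2l (ltW e4)); have := mulr_ge0 (ltW e4) (ln_nat_ge0 R (2 ^ k)).
lra.
Qed.

End critical_mass_laws.

(** * Weyl sums at almost every time *)

Section weyl_sums.
Variable R : realType.
Implicit Types (c d : nat -> R) (z : R[i]).

(** Summation by parts: multiplied by [1 - z], the sum telescopes up to the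
    decrements of [d], whose total is at most [d 0]. *)
Lemma abel_bound d z n : (forall i, d i.+1 <= d i) -> (forall i, 0 <= d i) ->
  normc z = 1 -> normc (\sum_(i < n) (d i)%:C * z ^+ i) * normc (1 - z) <= 2 * d 0%N.
Proof.
move=> dd d0 z1; pose A m := (\sum_(i < m) (d i)%:C * z ^+ i) * (1 - z).
have zi i : normc (z ^+ i) = 1 by rewrite normcX z1 expr1n.
have E m : normc (A m + (d m)%:C * z ^+ m) <= 2 * d 0%N - d m.
  elim: m => [|m IH].
    rewrite /A big_ord0 mul0r add0r expr0 mulr1 normc_real ger0_norm//; lra.
  have -> : A m.+1 + (d m.+1)%:C * z ^+ m.+1 =
      A m + (d m)%:C * z ^+ m + (d m.+1 - d m)%:C * z ^+ m.+1.
    rewrite /A big_ord_recr/= mulrDl realcB exprS.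
    move: (\sum_(i < m) _) (z ^+ m) => x y; ring.
  apply: (le_trans (le_normcD _ _)); rewrite Normc.normcM zi mulr1 normc_real.
  rewrite ler0_norm ?subr_le0//; lra.
rewrite -Normc.normcM -/(A n) -[A n](addrK ((d n)%:C * z ^+ n)).
apply: (le_trans (le_normcD _ _)); rewrite normcN Normc.normcM zi mulr1 normc_real.
by rewrite ger0_norm//; have := E n; lra.
Qed.

Definition fejer (J : nat) z : R := J%:R^-1 * normc (\sum_(i < J) z ^+ i) ^+ 2.

Lemma fejer_ge0 J z : 0 <= fejer J z.
Proof. by rewrite mulr_ge0 ?sqr_ge0 ?invr_ge0. Qed.

Lemma normc_expB1 z n : normc z = 1 -> normc (z ^+ n - 1) <= n%:R * normc (1 - z).
Proof.
move=> z1; elim: n => [|n IH]; first by rewrite expr0 subrr Normc.normc0 mul0r.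
rewrite (_ : z ^+ n.+1 - 1 = z ^+ n * (z - 1) + (z ^+ n - 1)); last by rewrite exprSr; ring.
apply: (le_trans (le_normcD _ _)); rewrite Normc.normcM normcX z1 expr1n mul1r normcB_sym.
by rewrite -natr1 mulrDl mul1r addrC lerD2r.
Qed.

(** If [|1 - z| <= 1 / J] the powers [z ^ i] with [i < J] stay close enough to [1]
    for the geometric sum to be at least [J / 2]. *)
Lemma fejer_ge (J : nat) z : (0 < J)%N -> normc z = 1 -> normc (1 - z) <= J%:R^-1 ->
  J%:R / 4 <= fejer J z.
Proof.
move=> J0 z1 zJ; have Jp : 0 < J%:R :> R by rewrite ltr0n.
have gauss n : \sum_(i < n) (i%:R : R) <= n%:R ^+ 2 / 2.
  elim: n => [|n IH]; first by rewrite big_ord0 expr0n/= mul0r.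
  by rewrite big_ord_recr/= -natr1; move: IH; have := ler0n R n; nra.
have h : J%:R / 2 <= normc (\sum_(i < J) z ^+ i).
  have : normc (\sum_(i < J) z ^+ i - J%:R%:C) <= J%:R / 2.
    have -> : \sum_(i < J) z ^+ i - J%:R%:C = \sum_(i < J) (z ^+ i - 1).
      by rewrite sumrB sumr_const card_ord; congr (_ - _); rewrite rmorph_nat.
    apply: (le_trans (normc_sum _ _ _)).
    apply: (@le_trans _ _ (\sum_(i < J) i%:R * J%:R^-1)).
      apply: ler_sum => i _; apply: (le_trans (normc_expB1 _ z1)).
      by rewrite ler_wpM2l.
    rewrite -mulr_suml ler_pdivrMr//; apply: (le_trans (gauss J)).
    by rewrite expr2 mulrAC.
  have := ler_normcB (\sum_(i < J) z ^+ i) J%:R%:C.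
  by rewrite normc_real (ger0_norm (ler0n _ J)) => /ler_normlP[h1 _] h2; lra.
rewrite /fejer ler_pdivlMl// (_ : J%:R * (J%:R / 4) = (J%:R / 2) ^+ 2); last by field.
by rewrite lerXn2r ?nnegrE ?normc_ge0// divr_ge0.
Qed.

(** A bound on a geometric sum of [2 ^ k] terms is of the order of the smaller of
    [2 ^ k] and [2 / |1 - z|]. The Fejér kernel of length [2 ^ j] is at least of
    the order of [2 ^ j] if [|1 - z| <= 2 ^ - j], and one of the [j <= k] is the
    right scale. Unlike the minimum, the sum of the kernels is a trigonometric
    polynomial of explicit mean. *)
Lemma fejer_dominates (k : nat) z (b : R) : normc z = 1 -> b <= 2 ^+ k ->
  b * normc (1 - z) <= 2 -> b <= 16 * \sum_(j < k.+1) fejer (2 ^ j) z.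
Proof.
move=> z1 bk bz.
have pw (j : nat) : 0 < (2 : R) ^+ j by rewrite exprn_gt0.
have top (j : nat) : normc (1 - z) <= (2 ^+ j)^-1 -> 2 ^+ j <= 4 * fejer (2 ^ j) z.
  move=> h; have := @fejer_ge (2 ^ j) z; rewrite expn_gt0/= natrX => /(_ isT z1 h).
  by rewrite ler_pdivrMr// mulrC.
have S0 m : 0 <= \sum_(j < m) fejer (2 ^ j) z by apply: sumr_ge0 => j _; exact: fejer_ge0.
have [small|big] := leP (normc (1 - z)) (2 ^+ k)^-1.
  apply: (le_trans bk); apply: (le_trans (top k small)).
  rewrite big_ord_recr/= mulrDr; have := S0 k; have := fejer_ge0 (2 ^ k) z; lra.
have claim m : (2 ^+ m)^-1 < normc (1 - z) ->
    2 <= 16 * (\sum_(j < m.+1) fejer (2 ^ j) z) * normc (1 - z).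
  elim: m => [|m IH] hm.
    have F1 : fejer (2 ^ 0) z = 1.
      by rewrite /fejer expn0 invr1 mul1r big_ord1 expr0 Normc.normc1 expr1n.
    by rewrite big_ord1 F1 mulr1; move: hm; rewrite expr0 invr1; lra.
  have [hm2|hm2] := leP (normc (1 - z)) (2 ^+ m)^-1; last first.
    apply: (le_trans (IH hm2)); rewrite ler_wpM2r ?normc_ge0//.
    by rewrite [in leRHS]big_ord_recr/= mulrDr lerDl mulr_ge0 ?fejer_ge0.
  apply: (@le_trans _ _ (4 * 2 ^+ m * normc (1 - z))).
    rewrite exprS invfM in hm.
    have h2 : 2 * 2 ^+ m * (2^-1 * (2 ^+ m)^-1) = 1 :> R by field; rewrite gt_eqF.
    have : 2 * 2 ^+ m * (2^-1 * (2 ^+ m)^-1) <= 2 * 2 ^+ m * normc (1 - z).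
      by rewrite ler_wpM2l ?mulr_ge0// ?ltW// ltW.
    by rewrite h2; lra.
  rewrite ler_wpM2r ?normc_ge0//.
  have := top m hm2; rewrite 2!big_ord_recr/= => h.
  have := S0 m; have := fejer_ge0 (2 ^ m.+1) z; lra.
have zp : 0 < normc (1 - z) by apply: lt_trans big; rewrite invr_gt0.
by have := le_trans bz (claim k big); rewrite ler_pM2r.
Qed.

Lemma big_zrange_nat (V : nmodType) N (F : int -> V) : (forall n, F (Negz n) = 0) ->
  \sum_(n <- zrange N) F n = \sum_(i < N.+1) F i%:Z.
Proof.
move=> F0; rewrite big_zrange_split big_ord_recl; congr (_ + _).
rewrite big_add1 big_mkord; apply: eq_bigr => i _.
by rewrite -NegzE F0 addr0.
Qed.

Definition weyl_majorant (k : nat) (t : R) : R := \sum_(1 <= q < 2 ^ k)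
  \sum_(j < k.+1) fejer (2 ^ j) (e2pi (- (2 * q%:R * t))).

(** The frequencies of the block start at [N]. *)
Definition weyl_sum c (N : nat) (y t : R) : R[i] :=
  \sum_(i < N) (c i)%:C * e2pi ((N + i)%:R * y - (N + i)%:R ^+ 2 * t).

(** Weyl differencing, followed by partial summation in the inner sums. *)
Lemma weyl_sum_bound c (k : nat) (y t : R) : (forall i, c i.+1 <= c i) ->
  (forall i, 0 <= c i) -> (forall i, (2 ^ k <= i)%N -> c i = 0) ->
  normc (weyl_sum c (2 ^ k) y t) ^+ 2 <=
  c 0%N ^+ 2 * (2 ^+ k + 32 * weyl_majorant k t).
Proof.
move=> cd c0 cN; set N := (2 ^ k)%N.
have N0 : (0 < N)%N by rewrite expn_gt0.
have cmono i j : (i <= j)%N -> c j <= c i.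
  by move=> ij; apply: (homo_leq (r := fun x y => y <= x)) ij => // x1 x2 x3 /[swap]; exact: le_trans.
pose f (p : int) : R[i] := if p is Posz i then
  (c i)%:C * e2pi ((N + i)%:R * y - (N + i)%:R ^+ 2 * t) else 0.
have fN p : f p != 0 -> (`|p| <= N)%N.
  case: p => [i|i]; rewrite /f ?eqxx// mulf_eq0 negb_or => /andP[ci _].
  rewrite absz_nat leqNgt; apply/negP => Ni.
  by move: ci; rewrite cN ?eqxx// ltnW.
have -> : weyl_sum c N y t = \sum_(p <- zrange N) f p.
  by rewrite big_zrange_nat// big_ord_recr/= cN// mul0r addr0.
rewrite sqr_normc_sum_correlation//.
have diag : \sum_(p <- zrange N) normc (f p) ^+ 2 <= c 0%N ^+ 2 * 2 ^+ k.
  rewrite big_zrange_nat; last by move=> n; rewrite /f Normc.normc0 expr0n.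
  rewrite big_ord_recr/= cN// mul0r Normc.normc0 expr0n addr0.
  rewrite (_ : 2 ^+ k = N%:R); last by rewrite natrX.
  rewrite -[N in N%:R]card_ord mulr_natr -sumr_const; apply: ler_sum => i _.
  rewrite Normc.normcM normc_e2pi mulr1 normc_real ger0_norm//.
  by rewrite lerXn2r ?nnegrE// cmono.
(* the correlation at distance [q] is a geometric sum of ratio [e2pi (- 2 q t)]
   with nonincreasing weights *)
have off (q : nat) : (0 < q)%N -> complex.Re (correlation N f q%:Z) <=
    c 0%N ^+ 2 * (16 * \sum_(j < k.+1) fejer (2 ^ j) (e2pi (- (2 * q%:R * t)))).
  move=> q0; set z := e2pi _; have z1 : normc z = 1 by rewrite normc_e2pi.
  pose d i := c (i + q)%N * c i.
  have d0 i : 0 <= d i by rewrite mulr_ge0.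
  have -> : correlation N f q%:Z = e2pi (q%:R * (y - 2 * N%:R * t) - q%:R ^+ 2 * t) *
      \sum_(i < N) (d i)%:C * z ^+ i.
    rewrite /correlation big_zrange_nat; last by move=> n; rewrite /f conjc0 mulr0.
    rewrite big_ord_recr/= [c N]cN// mul0r conjc0 mulr0 addr0 mulr_sumr; apply: eq_bigr => i _.
    rewrite conjcM -e2piN /d realcM.
    rewrite mulrACA -e2piD (_ : (c i)%:C^*%C = (c i)%:C); last by rewrite /conjc/= oppr0.
    rewrite mulrCA; congr (_ * _); rewrite /z -e2piMn -e2piD; congr e2pi.
    by rewrite !natrD; ring.
  have cc : 0 <= c 0%N ^+ 2 by exact: sqr_ge0.
  have dle i : d i <= c 0%N ^+ 2 by rewrite expr2 ler_pM// cmono.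
  set S := \sum_(i < N) _.
  apply: (le_trans (ler_norm _)); apply: (le_trans (ler_norm_Re _)).
  rewrite Normc.normcM normc_e2pi mul1r.
  have S1 : normc S <= c 0%N ^+ 2 * 2 ^+ k.
    apply: (le_trans (normc_sum _ _ _)).
    rewrite (_ : 2 ^+ k = N%:R); last by rewrite natrX.
    rewrite -[N in N%:R]card_ord mulr_natr -sumr_const; apply: ler_sum => i _.
    by rewrite Normc.normcM normcX z1 expr1n mulr1 normc_real ger0_norm.
  have S2 : normc S * normc (1 - z) <= 2 * c 0%N ^+ 2.
    apply: (@le_trans _ _ (2 * d 0%N)); last by rewrite ler_wpM2l.
    by apply: abel_bound => // i; rewrite /d ler_pM// addSn.
  have [c00|c00] := eqVneq (c 0%N) 0.
    by move: S1; rewrite c00 expr0n/= !mul0r.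
  have cp : 0 < c 0%N ^+ 2 by rewrite exprn_gt0// lt_neqAle eq_sym c00 c0.
  rewrite -ler_pdivrMl//; apply: fejer_dominates => //.
    by rewrite ler_pdivrMl.
  by rewrite -mulrA ler_pdivrMl// [leRHS]mulrC.
rewrite mulrDr; apply: lerD => //.
rewrite complex_Re_sum.
have -> : \sum_(1 <= q < N.*2.+1) complex.Re (correlation N f q%:Z) =
    \sum_(1 <= q < N) complex.Re (correlation N f q%:Z).
  rewrite (@big_cat_nat _ _ _ N)//=; last by rewrite -addnn; lia.
  rewrite [X in _ + X]big_nat_cond [X in _ + X]big1 ?addr0// => q.
  rewrite andbT => /andP[Nq _]; rewrite /correlation big1// => p _.
  case: p => i; rewrite /f ?conjc0 ?mulr0//.
  by rewrite -PoszD cN ?mul0r// (leq_trans Nq)// leq_addl.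
apply: (@le_trans _ _ (2 * \sum_(1 <= q < N) c 0%N ^+ 2 *
   (16 * \sum_(j < k.+1) fejer (2 ^ j) (e2pi (- (2 * q%:R * t)))))).
  rewrite ler_wpM2l// big_nat_cond [leRHS]big_nat_cond; apply: ler_sum => q.
  by rewrite andbT => /andP[q0 _]; exact: off.
rewrite -mulr_sumr -mulr_sumr /weyl_majorant le_eqVlt; apply/orP; left; apply/eqP.
by ring.
Qed.

Lemma fejerE (J : nat) (q : nat) (t : R) : fejer J (e2pi (- (2 * q%:R * t))) =
  J%:R^-1 * normc (\sum_(i <- iota 0 J) 1 * e2pi ((- (2 * q%:Z * i%:Z))%:~R * t)) ^+ 2.
Proof.
congr (_ * normc _ ^+ 2); rewrite -(big_mkord xpredT (fun i => e2pi (- (2 * q%:R * t)) ^+ i)).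
rewrite /index_iota subn0; apply: eq_bigr => i _; rewrite mul1r -e2piMn; congr e2pi.
by rewrite mulrNz !intrM -!pmulrn; ring.
Qed.

Lemma bounded_mfun_fejer (J q : nat) :
  bounded_mfun (fun t : R => fejer J (e2pi (- (2 * q%:R * t)))).
Proof.
under eq_fun do rewrite fejerE.
apply: bounded_mfunZ; apply: bounded_mfun_sqr_normc.
by apply: bounded_cfun_sum => i; apply: bounded_cfunZ; exact: bounded_cfun_e2piZ.
Qed.

(** The exponents [2 q i] are distinct, so that only the [J] diagonal terms have a
    nonzero mean. *)
Lemma torus_integral_fejer (J q : nat) : (0 < J)%N -> (0 < q)%N ->
  torus_integral (fun t : R => fejer J (e2pi (- (2 * q%:R * t)))) <= 1.
Proof.
move=> J0 q0; under eq_fun do rewrite fejerE.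
rewrite torus_integralZ; last first.
  apply: bounded_mfun_sqr_normc.
  by apply: bounded_cfun_sum => i; apply: bounded_cfunZ; exact: bounded_cfun_e2piZ.
rewrite ler_pdivrMl ?ltr0n// mulr1.
apply: (le_trans (le_torus_integral_sqr_trigpoly _ _ _)).
rewrite (eq_big_seq (fun=> 1)).
  by rewrite big_const_seq count_predT size_iota iter_addr_0.
move=> i iJ; rewrite (eq_bigl (pred1 i)); last first.
  move=> j /=; rewrite eqr_opp -!mulrA; apply/eqP/eqP => [|-> //].
  by move/mulfI => /(_ isT)/mulfI; rewrite eqz_nat -lt0n => /(_ q0)[].
by rewrite -big_filter filter_pred1_uniq ?iota_uniq// big_seq1 Normc.normc1 mulr1.
Qed.

Lemma bounded_mfun_weyl_majorant k : bounded_mfun (weyl_majorant k).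
Proof.
by apply: bounded_mfun_sum => q; apply: bounded_mfun_sum => j; exact: bounded_mfun_fejer.
Qed.

Lemma weyl_majorant_ge0 k t : 0 <= weyl_majorant k t.
Proof. by do 2 apply: sumr_ge0 => ? _; exact: fejer_ge0. Qed.

Lemma torus_integral_weyl_majorant k :
  torus_integral (weyl_majorant k) <= 2 ^+ k * k.+1%:R.
Proof.
rewrite /weyl_majorant torus_integral_sum; last first.
  by move=> q; apply: bounded_mfun_sum => j; exact: bounded_mfun_fejer.
apply: (@le_trans _ _ (\sum_(1 <= q < 2 ^ k) k.+1%:R)).
  rewrite big_nat_cond [leRHS]big_nat_cond; apply: ler_sum => q.
  rewrite andbT => /andP[q0 _]; rewrite torus_integral_sum; last first.
    by move=> j; exact: bounded_mfun_fejer.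
  apply: (@le_trans _ _ (\sum_(j < k.+1) 1)); last by rewrite sumr_const card_ord.
  by apply: ler_sum => j _; apply: torus_integral_fejer; rewrite ?expn_gt0.
rewrite big_const_nat iter_addr_0 -[leLHS]mulr_natl ler_wpM2r//.
by rewrite -natrX ler_nat leq_subr.
Qed.

Lemma weyl_majorant_periodic k : periodic (weyl_majorant k) 1.
Proof.
move=> t; apply: eq_bigr => q _; apply: eq_bigr => j _; congr fejer.
rewrite mulrDr mulr1 opprD e2piD (_ : - (2 * q%:R) = (- (2 * q%:Z))%:~R :> R).
  by rewrite e2pi_int mulr1.
by rewrite mulrNz intrM -!pmulrn.
Qed.

(** The mean of [weyl_majorant k] is at most [2 ^ k (k + 1)]; two more powers of
    [k + 1] make the exceptional deviations summable in [k]. *)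
Definition weyl_regular (t : R) : Prop := exists C : R, forall k,
  weyl_majorant k t <= C * 2 ^+ k * k.+1%:R ^+ 3.

Lemma ae_weyl_regular : {ae @lebesgue_measure R, forall t, weyl_regular t}.
Proof.
apply: ae_periodic.
- by move=> t [C hC]; exists C => k; rewrite weyl_majorant_periodic.
- by move=> t [C hC]; exists C => k; rewrite -weyl_majorant_periodic.
pose w k : R := (2 ^+ k * k.+1%:R ^+ 3)^-1.
have w0 k : 0 < w k by rewrite invr_gt0 mulr_gt0// exprn_gt0.
have := @ae_cvg0_of_summable R (fun k t => w k * weyl_majorant k t) 2.
case/(_ _ _ _)/Wrap.
- by move=> k; apply: bounded_mfunZ; exact: bounded_mfun_weyl_majorant.
- by move=> k x; rewrite mulr_ge0 ?weyl_majorant_ge0// ltW.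
- move=> n; apply: le_trans (sum_inv_square R n); apply: ler_sum => k _.
  rewrite torus_integralZ; last exact: bounded_mfun_weyl_majorant.
  rewrite ler_pdivrMl ?mulr_gt0 ?exprn_gt0//.
  apply: (le_trans (torus_integral_weyl_majorant k)).
  rewrite le_eqVlt; apply/orP; left; apply/eqP; field.
  by rewrite addrC natr1 pnatr_eq0.
apply: (@filterS _ _ (ae_filter_ringOfSetsType _)) => t h t01; have {h t01}h := h t01.
have /cvgrPdist_le/(_ _ ltr01)[K _ hK] := h.
exists (1 + \sum_(k < K) w k * weyl_majorant k t) => k.
have S0 : 0 <= \sum_(k < K) w k * weyl_majorant k t.
  by apply: sumr_ge0 => i _; rewrite mulr_ge0 ?weyl_majorant_ge0// ltW.
rewrite -mulrA -ler_pdivrMr ?mulr_gt0 ?exprn_gt0// mulrC -/(w k).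
have [kK|Kk] := ltnP k K.
  rewrite (bigD1 (Ordinal kK))//= addrCA lerDl addr_ge0// sumr_ge0// => i _.
  by rewrite mulr_ge0 ?weyl_majorant_ge0// ltW.
have := hK k Kk; rewrite /= sub0r normrN ger0_norm; last first.
  by rewrite mulr_ge0 ?weyl_majorant_ge0// ltW.
by move=> /le_trans; apply; rewrite lerDl.
Qed.

End weyl_sums.

Section weyl_bounds.
Variable R : realType.

(** The left-hand side is the mean of [f] against a trigonometric polynomial. *)
Lemma fourier_coef_duality (f : R -> R) (J : Type) (s : seq J) (l : J -> int)
    (z : J -> R[i]) (M : R) : bounded_mfun f ->
  (forall y, normc (\sum_(i <- s) z i * e2pi (- ((l i)%:~R * y))) <= M) ->
  normc (\sum_(i <- s) z i * fourier_coef f (l i)) <=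
  M * torus_integral (fun x => `|f x|).
Proof.
move=> bf hM.
have bi i : bounded_cfun (fun y : R => z i * ((f y)%:C * e2pi (- ((l i)%:~R * y)))).
  apply: bounded_cfunZ; apply: bounded_cfunM; first exact: bounded_cfun_real.
  exact: bounded_cfun_e2piN.
have -> : \sum_(i <- s) z i * fourier_coef f (l i) = torus_cintegral
    (fun y => \sum_(i <- s) z i * ((f y)%:C * e2pi (- ((l i)%:~R * y)))).
  rewrite torus_cintegral_sum//; apply: eq_bigr => i _.
  rewrite torus_cintegralZ//; apply: bounded_cfunM; first exact: bounded_cfun_real.
  exact: bounded_cfun_e2piN.
have bS := bounded_cfun_sum s xpredT bi.
apply: (le_trans (le_normc_torus_cintegral bS)).
rewrite -torus_integralZ; last exact: bounded_mfun_norm.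
apply: le_torus_integral; first exact: bounded_mfun_normc.
  by apply: bounded_mfunZ; exact: bounded_mfun_norm.
move=> y _; under eq_bigr do rewrite mulrCA.
by rewrite -mulr_sumr Normc.normcM normc_real mulrC ler_wpM2r.
Qed.

(** Monotone weights are allowed because the inverse of the multiplier of an
    increment is such a weight, see [dyadic_block_sup]. *)
Definition antitone_weight (N : nat) (c : nat -> R) : Prop :=
  [/\ forall i, c i.+1 <= c i, forall i, 0 <= c i & forall i, (N <= i)%N -> c i = 0].

Definition weyl_bounded (A t : R) : Prop := forall k c y, antitone_weight (2 ^ k) c ->
  normc (weyl_sum c (2 ^ k) y t) <= c 0%N * (A * Num.sqrt 2 ^+ k * k.+1%:R ^+ 2).

Lemma weyl_sum_reverse c N (y t : R) : weyl_sum c N y (- t) = (weyl_sum c N (- y) t)^*%C.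
Proof.
rewrite /weyl_sum conjc_sum; apply: eq_bigr => i _.
rewrite conjcM -e2piN (_ : (c i)%:C^*%C = (c i)%:C); last by rewrite /conjc/= oppr0.
by congr (_ * e2pi _); ring.
Qed.

(** The sums at [- t] are conjugate to sums at [t]. They are needed for the
    negative frequencies of the evolution. *)
Lemma weyl_regular_bounded t : weyl_regular t ->
  exists A : R, [/\ 0 <= A, weyl_bounded A t & weyl_bounded A (- t)].
Proof.
move=> [C hC]; have C0 : 0 <= C.
  have := le_trans (weyl_majorant_ge0 0 t) (hC 0%N).
  by rewrite expr0 expr1n !mulr1.
pose A := 1 + 32 * C; have A1 : 1 <= A by rewrite /A lerDl mulr_ge0.
have A0 := le_trans ler01 A1.
have key : weyl_bounded A t.
  move=> k c y [cd c0 cN]; have := weyl_sum_bound y t cd c0 cN.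
  set W := normc _; set S := Num.sqrt 2; move=> h.
  have S2 : S ^+ 2 = 2 by rewrite sqr_sqrtr.
  have S0 : 0 <= S by exact: sqrtr_ge0.
  have W0 : 0 <= W by exact: normc_ge0.
  have rhs0 : 0 <= c 0%N * (A * S ^+ k * k.+1%:R ^+ 2) by rewrite !mulr_ge0 ?exprn_ge0.
  rewrite -(ler_pXn2r (n := 2)) ?nnegrE// (le_trans h)// exprMn ler_wpM2l ?sqr_ge0//.
  rewrite !exprMn [(S ^+ k) ^+ 2]exprAC S2.
  have k1 : 1 <= k.+1%:R :> R by rewrite ler1n.
  have p0 : 0 < (2 : R) ^+ k by rewrite exprn_gt0.
  have hk := hC k.
  apply: (@le_trans _ _ (A * (2 ^+ k * k.+1%:R ^+ 3))).
    have -> : A * (2 ^+ k * k.+1%:R ^+ 3) = 2 ^+ k * k.+1%:R ^+ 3 +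
        32 * (C * 2 ^+ k * k.+1%:R ^+ 3) by rewrite /A; ring.
    apply: lerD.
      by rewrite ler_peMr ?(ltW p0)// exprn_ege1.
    by rewrite ler_wpM2l.
  rewrite mulrA; apply: ler_pM.
  - by rewrite mulr_ge0 ?(ltW p0).
  - by rewrite exprn_ge0.
  - by rewrite ler_wpM2r ?(ltW p0)// expr2 ler_peMr.
  - by rewrite -exprD ler_weXn2l.
exists A; split => // k c y hc.
by rewrite weyl_sum_reverse normc_conj key.
Qed.

End weyl_bounds.

(** * Dyadic blocks of the evolution *)

Section dyadic_blocks.
Variable R : realType.
Variables (g T : R -> R) (V : R).
Hypothesis pg : periodic g 1.
Hypothesis gT : variation_majorant g T V.
Let bg : bounded_mfun g := bv_bounded_mfun pg gT.
Let a := fourier_coef g.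

Definition dyadic_block (k : nat) (x t : R) : R[i] := \sum_(i < 2 ^ k)
  a (2 ^ k + i)%N%:Z * e2pi ((2 ^ k + i)%N%:R * x - (2 ^ k + i)%N%:R ^+ 2 * t).

Let bounded_increment h : bounded_mfun (fun x => g (x + h) - g x).
Proof. by apply: bounded_mfunB => //; exact: bounded_mfun_shift. Qed.

(** Increments of [g] are small in [L^1]; the Weyl sum is the dual object. *)
Lemma increment_duality (k : nat) (c : nat -> R) (w : R[i]) (y h t A : R) :
  weyl_bounded A t -> antitone_weight (2 ^ k) c -> normc w = 1 ->
  normc (\sum_(i < 2 ^ k) w * (c i)%:C *
     e2pi ((2 ^ k + i)%N%:R * y - (2 ^ k + i)%N%:R ^+ 2 * t) *
     fourier_coef (fun x => g (x + h) - g x) (2 ^ k + i)%N%:Z) <=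
  c 0%N * (A * Num.sqrt 2 ^+ k * k.+1%:R ^+ 2) * (V * `|h|).
Proof.
move=> hA hc w1; set M := c 0%N * _.
have M0 : 0 <= M by apply: le_trans (hA k c 0 hc); exact: normc_ge0.
apply: (@le_trans _ _ (M * torus_integral (fun x => `|g (x + h) - g x|))); last first.
  by rewrite ler_wpM2l// (bv_L1_modulus pg gT).
apply: (@fourier_coef_duality _ _ _ _ (fun i : 'I_(2 ^ k) => (2 ^ k + i)%N%:Z)) => // z.
apply: le_trans (hA k c (y - z) hc).
rewrite (_ : \sum_(i <- _) _ = w * weyl_sum c (2 ^ k) (y - z) t).
  by rewrite Normc.normcM w1 mul1r.
rewrite mulr_sumr; apply: eq_bigr => i _; rewrite -!mulrA; congr (_ * (_ * _)).
by rewrite -e2piD -pmulrn; congr e2pi; ring.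
Qed.

Lemma dyadic_block_increment k (x h t A : R) : weyl_bounded A t ->
  normc (dyadic_block k (x + h) t - dyadic_block k x t) <=
  A * V * k.+1%:R ^+ 2 * Num.sqrt 2 ^+ k * `|h|.
Proof.
move=> hA; pose c (i : nat) : R := (i < 2 ^ k)%N%:R.
have hc : antitone_weight (2 ^ k) c.
  split => [i|i|i]; rewrite /c ?ler0n//; last by rewrite leqNgt => /negbTE ->.
  by rewrite ler_nat; case: (ltnP i.+1 (2 ^ k)) => // /ltnW ->.
have := @increment_duality k c 1 x h t A hA hc (Normc.normc1 _).
have -> : c 0%N = 1 by rewrite /c expn_gt0.
rewrite mul1r; have -> : A * Num.sqrt 2 ^+ k * k.+1%:R ^+ 2 * (V * `|h|) =
    A * V * k.+1%:R ^+ 2 * Num.sqrt 2 ^+ k * `|h| by ring.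
apply: le_trans; rewrite le_eqVlt; apply/orP; left; apply/eqP; congr normc.
rewrite -sumrB; apply: eq_bigr => i _; rewrite (fourier_coef_increment pg gT).
rewrite /c ltn_ord mul1r mul1r -/a -pmulrn.
have -> : (2 ^ k + i)%N%:R * (x + h) - (2 ^ k + i)%N%:R ^+ 2 * t =
   ((2 ^ k + i)%N%:R * x - (2 ^ k + i)%N%:R ^+ 2 * t) + (2 ^ k + i)%N%:R * h by ring.
by rewrite e2piD; ring.
Qed.

(** The multiplier of an increment of step [h] at the frequency [n] is, with
    [s = n h], the real factor [2 sin (pi s)] up to a constant and a phase that
    amounts to a translation by [h / 2]. *)
Lemma e2piB1 (s : R) : e2pi s - 1 = 'i%C * (2 * sin (pi * s))%:C * e2pi (s / 2).
Proof.
have h : 2 * pi * (s / 2) = pi * s by field.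
rewrite /e2pi h (_ : 2 * pi * s = pi * s + pi * s); last by ring.
move: (pi * s) => b; rewrite cosD sinD; apply: eqc_Re_Im.
  rewrite complex_ReD !complex_ReM !complex_ImM /= !(mul0r, mulr0, mul1r, addr0, sub0r, add0r).
  by have := cos2Dsin2 b; rewrite !expr2 oppr0 mul0r; lra.
by rewrite complex_ImD !complex_ImM !complex_ReM /= oppr0; ring.
Qed.

(** On the frequencies of a dyadic block the multiplier [e2pi (n h) - 1], with
    [h] a quarter of the corresponding wavelength, has an inverse with
    monotone modulus. *)
Lemma dyadic_block_sup k (x t A : R) : 0 <= A -> weyl_bounded A t ->
  normc (dyadic_block k x t) <= A * V * k.+1%:R ^+ 2 / Num.sqrt 2 ^+ k.
Proof.
move=> A0 hA; have V0 := majorant_mass_ge0 gT.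
(* for [n] in the block, [1/4 <= n h <= 1/2], where the sine of [pi n h] increases *)
pose h : R := (2 ^+ k.+2)^-1.
pose th (i : nat) : R := (2 ^ k + i)%N%:R * h.
have p0 : 0 < (2 : R) ^+ k by rewrite exprn_gt0.
have h0 : 0 < h by rewrite invr_gt0 exprn_gt0.
have thE i : th i = 4^-1 + i%:R * h.
  by rewrite /th natrD natrX mulrDl /h !exprS; congr (_ + _); field; rewrite gt_eqF.
have thle i : (i < 2 ^ k)%N -> 4^-1 <= th i <= 2^-1.
  move=> ik; rewrite thE lerDl mulr_ge0 ?(ltW h0)//=.
  have : i%:R * h <= 4^-1.
    have -> : 4^-1 = 2 ^+ k * h by rewrite /h !exprS; field; rewrite gt_eqF.
    by rewrite ler_wpM2r ?(ltW h0)// -natrX ler_nat ltnW.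
  lra.
have p2 : 2 <= pi :> R by exact: pi_ge2.
have pi0 : 0 < pi :> R by exact: pi_gt0.
have sinth i : (i < 2 ^ k)%N -> 6^-1 <= sin (pi * th i).
  move=> /thle/andP[t1 t2]; apply: le_trans (sin_ge_third _); first by nra.
  have p4 := pi_lt4 R; apply/andP; split; nra.
pose c (i : nat) : R := if (i < 2 ^ k)%N then (2 * sin (pi * th i))^-1 else 0.
have cpos i : (i < 2 ^ k)%N -> 0 < 2 * sin (pi * th i).
  by move=> /sinth s; rewrite mulr_gt0// (lt_le_trans _ s)// invr_gt0.
have hc : antitone_weight (2 ^ k) c.
  split => [i|i|i]; rewrite /c; last by rewrite leqNgt => /negbTE ->.
  - case: ifPn => [i1|_]; last by case: ifPn => // /cpos; rewrite invr_ge0 => /ltW.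
    rewrite (ltnW i1) lef_pV2 ?posrE ?cpos ?(ltnW i1)// ler_pM2l//.
    have /andP[a1 a2] := thle _ i1; have /andP[b1 b2] := thle _ (ltnW i1).
    have tt : th i <= th i.+1 by rewrite !thE lerD2l ler_wpM2r ?(ltW h0)// ler_nat.
    move: tt; rewrite le_eqVlt => /predU1P[->//|tt].
    by rewrite ltW// ltr_sin ?in_itv/=; [nra| |]; apply/andP; split; nra.
  - by case: ifPn => // /cpos; rewrite invr_ge0 => /ltW.
have := @increment_duality k c (- 'i%C) (x - h / 2) h t A hA hc _.
have -> : normc (- 'i%C : R[i]) = 1.
  by rewrite normcN; apply/eqP; rewrite -sqrp_eq1 ?normc_ge0// sqr_normcE/= expr0n/= add0r expr1n.
move=> /(_ erefl) H.
have {H}H : normc (dyadic_block k x t) <=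
    c 0%N * (A * Num.sqrt 2 ^+ k * k.+1%:R ^+ 2) * (V * `|h|).
  apply: le_trans H; rewrite le_eqVlt; apply/orP; left; apply/eqP; congr normc.
  apply: eq_bigr => i _; rewrite (fourier_coef_increment pg gT) -/a -pmulrn -/(th i).
  have si := cpos i (ltn_ord i).
  rewrite e2piB1 /c ltn_ord.
  have -> : (2 ^ k + i)%N%:R * (x - h / 2) - (2 ^ k + i)%N%:R ^+ 2 * t =
     ((2 ^ k + i)%N%:R * x - (2 ^ k + i)%N%:R ^+ 2 * t) - th i / 2 by rewrite /th; ring.
  rewrite [e2pi (_ - th i / 2)]e2piB.
  set E := e2pi (_ - _ * t); set F := e2pi (th i / 2); set s := 2 * sin _.
  rewrite [RHS](_ : _ = a (2 ^ k + i)%N%:Z * E * (- ('i%C * 'i%C)) *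
    ((s^-1)%:C * s%:C) * (F * F^*%C)); last by ring.
  rewrite e2pi_conjK -realcM mulVf ?gt_eqF// -expr2 sqr_i opprK.
  by rewrite !mulr1.
apply: (le_trans H).
have c3 : c 0%N <= 3.
  rewrite /c expn_gt0/=; have := sinth 0%N; rewrite expn_gt0/= => /(_ isT) s6.
  rewrite invf_ple ?posrE ?cpos ?expn_gt0//; lra.
have S0 : 0 < Num.sqrt 2 :> R by rewrite sqrtr_gt0.
have SS : Num.sqrt 2 ^+ k * Num.sqrt 2 ^+ k = 2 ^+ k :> R.
  by rewrite -exprMn -expr2 sqr_sqrtr.
rewrite (ger0_norm (ltW h0)).
have -> : c 0%N * (A * Num.sqrt 2 ^+ k * k.+1%:R ^+ 2) * (V * h) =
   (c 0%N / 4) * (A * V * k.+1%:R ^+ 2 / Num.sqrt 2 ^+ k).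
  rewrite /h !exprS -SS; field.
  by rewrite gt_eqF// exprn_gt0.
rewrite ler_piMl//; last by lra.
by rewrite !mulr_ge0// ?invr_ge0 ?exprn_ge0// ltW.
Qed.

Lemma sum_dyadic (U : nmodType) (F : nat -> U) (K : nat) :
  \sum_(1 <= n < 2 ^ K) F n = \sum_(k < K) \sum_(i < 2 ^ k) F (2 ^ k + i)%N.
Proof.
elim: K => [|K IH]; first by rewrite expn0 big_geq// big_ord0.
rewrite big_ord_recr/= -IH (@big_cat_nat _ _ _ (2 ^ K))/=; last 2 first.
- by rewrite expn_gt0.
- by rewrite leq_exp2l.
congr (_ + _); rewrite -[in LHS](add0n (2 ^ K)%N) expnS mul2n -addnn big_addn addnK.
by rewrite big_mkord; apply: eq_bigr => i _; rewrite addnC.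
Qed.

(** Since [g] is real, the part of the evolution of negative frequencies at the
    time [t] is the conjugate of the part of positive frequencies at [- t]. *)
Definition paired_block (t : R) (k : nat) (x : R) : R[i] :=
  dyadic_block k x t + (dyadic_block k x (- t))^*%C.

Lemma schrodinger_poly_blocks (K : nat) (x t : R) :
  schrodinger_poly a (2 ^ K).-1 x t = a 0 + \sum_(k < K) paired_block t k x.
Proof.
rewrite /schrodinger_poly big_zrange_split mul0r expr0n/= mul0r subrr e2pi0 mulr1.
rewrite prednK ?expn_gt0// sum_dyadic; congr (_ + _); apply: eq_bigr => k _.
rewrite /paired_block /dyadic_block conjc_sum -big_split; apply: eq_bigr => i _ /=.
rewrite -pmulrn; congr (_ + _).
rewrite /a fourier_coefN// conjcM; congr (_ * _); rewrite -e2piN; congr e2pi.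
by rewrite mulrNz -pmulrn; ring.
Qed.

Lemma paired_block_sup (t A : R) k x : 0 <= A -> weyl_bounded A t -> weyl_bounded A (- t) ->
  normc (paired_block t k x) <= 2 * A * V * k.+1%:R ^+ 2 / Num.sqrt 2 ^+ k.
Proof.
move=> A0 h1 h2; apply: (le_trans (le_normcD _ _)); rewrite normc_conj.
have := lerD (dyadic_block_sup k x A0 h1) (dyadic_block_sup k x A0 h2).
by move=> /le_trans; apply; rewrite le_eqVlt; apply/orP; left; apply/eqP; ring.
Qed.

Lemma paired_block_increment (t A : R) k x h : weyl_bounded A t -> weyl_bounded A (- t) ->
  normc (paired_block t k (x + h) - paired_block t k x) <=
  2 * A * V * k.+1%:R ^+ 2 * Num.sqrt 2 ^+ k * `|h|.
Proof.
move=> h1 h2; rewrite /paired_block opprD addrACA.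
rewrite -[X in _ + (_ + X)]conjcN.
have -> : (dyadic_block k (x + h) (- t))^*%C + (- dyadic_block k x (- t))^*%C =
   (dyadic_block k (x + h) (- t) - dyadic_block k x (- t))^*%C by rewrite rmorphD.
apply: (le_trans (le_normcD _ _)); rewrite normc_conj.
have := lerD (dyadic_block_increment k x h h1) (dyadic_block_increment k x h h2).
by move=> /le_trans; apply; rewrite le_eqVlt; apply/orP; left; apply/eqP; ring.
Qed.

End dyadic_blocks.

(** * Hölder regularity of the density *)

Section lacunary_series.
Variable R : realType.

(** Cumulative sums of the coefficients correspond to division by [1 - q]. *)
Lemma geometric_cumulative (b : nat -> R) (q : R) n :
  (1 - q) * \sum_(k < n) (\sum_(i < k.+1) b i) * q ^+ k + (\sum_(i < n) b i) * q ^+ n =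
  \sum_(k < n) b k * q ^+ k.
Proof.
elim: n => [|n IH]; first by rewrite !big_ord0 mulr0 mul0r addr0.
rewrite [RHS]big_ord_recr/= -IH big_ord_recr/= [\sum_(i < n.+1) b i]big_ord_recr/= exprS.
by ring.
Qed.

(** The squares are dominated by twofold cumulative sums of ones. *)
Lemma square_geometric_bounded (q : R) : 0 <= q < 1 -> exists2 C : R, 0 <= C &
  forall n, \sum_(k < n) k.+1%:R ^+ 2 * q ^+ k <= C.
Proof.
move=> /andP[q0 q1]; have p0 : 0 < 1 - q by rewrite subr_gt0.
pose B1 k : R := \sum_(i < k.+1) 1; pose B2 k : R := \sum_(i < k.+1) B1 i.
have cumul (b : nat -> R) n : (forall i, 0 <= b i) ->
    (1 - q) * \sum_(k < n) (\sum_(i < k.+1) b i) * q ^+ k <= \sum_(k < n) b k * q ^+ k.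
  move=> b0; rewrite -geometric_cumulative lerDl mulr_ge0 ?exprn_ge0//.
  by apply: sumr_ge0 => i _.
have B1E k : B1 k = k.+1%:R by rewrite /B1 sumr_const card_ord.
have B2ge k : k.+1%:R ^+ 2 <= 2 * B2 k.
  rewrite /B2; elim: k => [|k IH]; first by rewrite big_ord1 B1E expr1n mulr1 ler1n.
  rewrite big_ord_recr/= mulrDr B1E; move: IH; rewrite -[k.+2%:R]natr1.
  by have := ler0n R k.+1; move: (k.+1%:R) => y y0; nra.
exists (2 * (1 - q) ^- 3); first by rewrite mulr_ge0 ?invr_ge0 ?exprn_ge0 ?ltW.
move=> n; apply: (@le_trans _ _ (2 * \sum_(k < n) B2 k * q ^+ k)).
  by rewrite mulr_sumr; apply: ler_sum => k _; rewrite mulrA ler_wpM2r ?exprn_ge0.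
rewrite ler_wpM2l// -[leRHS]mulr1 ler_pdivlMl ?exprn_gt0//.
have h1 := cumul B1 n; have h2 := cumul (fun=> 1) n (fun=> ler01).
have h3 : (1 - q) * \sum_(k < n) q ^+ k <= 1.
  by rewrite -[1 - q]opprB mulNr -subrX1 opprB lerBlDr lerDl exprn_ge0.
have {}h2 : (1 - q) * \sum_(k < n) B1 k * q ^+ k <= \sum_(k < n) q ^+ k.
  by apply: (le_trans h2); apply: ler_sum => k _; rewrite mul1r.
have {}h1 : (1 - q) * \sum_(k < n) B2 k * q ^+ k <= \sum_(k < n) B1 k * q ^+ k.
  by apply: h1 => i; rewrite B1E.
rewrite exprSr expr2 -mulrA; apply: le_trans h3; rewrite -mulrA ler_pM2l//.
by rewrite -[leLHS]mulrA; apply: le_trans h2; rewrite ler_pM2l.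
Qed.

Lemma min_le_powR (d x y s : R) : 0 <= d -> d <= x -> d <= y -> 0 < s < 1 ->
  d <= x `^ (1 - s) * y `^ s.
Proof.
move=> d0 dx dy /andP[s0 s1].
have s1' : 0 <= 1 - s by rewrite subr_ge0 ltW.
have -> : d = d `^ (1 - s) * d `^ s.
  by rewrite -powRD ?subrK ?powRr1// oner_eq0.
by apply: ler_pM; rewrite ?powR_ge0//; apply: ge0_ler_powR => //;
  rewrite ?nnegrE ?(ltW s0)// (le_trans d0).
Qed.

Lemma powRXn (x s : R) k : 0 <= x -> (x ^+ k) `^ s = (x `^ s) ^+ k.
Proof. by move=> x0; rewrite -powR_mulrn// -powRrM mulrC powRrM powR_mulrn// powR_ge0. Qed.

Lemma sqr_normcB_le (z w : R[i]) (M : R) : normc z <= M -> normc w <= M ->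
  `|normc z ^+ 2 - normc w ^+ 2| <= 2 * M * normc (z - w).
Proof.
move=> zM wM; rewrite subr_sqr normrM mulrC ler_pM//; last exact: ler_normcB.
by rewrite ger0_norm ?addr_ge0 ?normc_ge0// mulrDl mul1r lerD.
Qed.

Variables (P : nat -> R -> R[i]) (z0 : R[i]) (D : R).
Local Notation r := (Num.sqrt 2 : R).
Hypothesis D0 : 0 <= D.
Hypothesis P_sup : forall k x, normc (P k x) <= D * k.+1%:R ^+ 2 / r ^+ k.
Hypothesis P_lip : forall k x y,
  normc (P k y - P k x) <= D * k.+1%:R ^+ 2 * r ^+ k * `|y - x|.

Let r0 : 0 < r. Proof. by rewrite sqrtr_gt0. Qed.
Let r1 : 1 < r.
Proof. by rewrite -(ltr_pXn2r (n := 2)) ?nnegrE ?(ltW r0)// expr1n sqr_sqrtr// ltr1n. Qed.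
Let S K x := z0 + \sum_(k < K) P k x.

Let Sbounded : exists2 M : R, 0 <= M & forall K x, normc (S K x) <= M.
Proof.
have [|C C0 hC] := @square_geometric_bounded r^-1.
  by rewrite invr_ge0 (ltW r0)/= invf_lt1.
exists (normc z0 + D * C); first by rewrite addr_ge0 ?normc_ge0// mulr_ge0.
move=> K x; apply: (le_trans (le_normcD _ _)); rewrite lerD2l.
apply: (le_trans (normc_sum _ _ _)).
apply: (@le_trans _ _ (D * \sum_(k < K) k.+1%:R ^+ 2 * r^-1 ^+ k)).
  by rewrite mulr_sumr; apply: ler_sum => k _; rewrite exprVn mulrA P_sup.
by rewrite ler_wpM2l.
Qed.

(** Interpolation between the bound on the size of a block and the bound on
    its increments. *)
Let Shoelder (s : R) : 0 < s < 2^-1 -> exists2 C : R, 0 <= C &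
  forall K x y, normc (S K y - S K x) <= C * `|y - x| `^ s.
Proof.
move=> /andP[s0 s2]; have s1 : 0 < s < 1 by rewrite s0 (lt_trans s2)// invf_lt1// ltr1n.
(* the ratio [2 ^ (s - 1/2)] of the interpolated bounds *)
pose q := r^-1 `^ (1 - s) * r `^ s.
have q01 : 0 <= q < 1.
  rewrite mulr_ge0 ?powR_ge0//= /q -powR_inv1 ?(ltW r0)// -powRrM mulN1r powRN.
  rewrite mulrC ltr_pdivrMr ?powR_gt0// mul1r.
  have -> : r `^ (1 - s) = r `^ s * r `^ (1 - 2 * s).
    rewrite -powRD; first by congr (_ `^ _); ring.
    by rewrite (lt0r_neq0 r0) implybT.
  rewrite ltr_pMr ?powR_gt0//.
  have e0 : 0 < 1 - 2 * s by lra.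
  have p1 : 1 `^ (1 - 2 * s) = 1 :> R by rewrite powR1.
  rewrite -[ltLHS]p1; apply: gt0_ltr_powR; rewrite ?nnegrE ?(ltW r0)//.
have [C C0 hC] := square_geometric_bounded q01.
exists (2 * D * C); first by rewrite !mulr_ge0.
move=> K x y; rewrite /S opprD addrACA subrr add0r -sumrB.
apply: (le_trans (normc_sum _ _ _)).
apply: (@le_trans _ _ (\sum_(k < K) 2 * D * `|y - x| `^ s * (k.+1%:R ^+ 2 * q ^+ k))).
  apply: ler_sum => k _; set E := 2 * D * k.+1%:R ^+ 2.
  have E0 : 0 <= E by rewrite !mulr_ge0 ?exprn_ge0.
  have rk : 0 < r ^+ k by rewrite exprn_gt0.
  set d := normc _.
  have d1 : d <= E * r^-1 ^+ k.
    apply: (le_trans (le_normcD _ _)); rewrite normcN exprVn.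
    apply: (le_trans (lerD (P_sup k y) (P_sup k x))).
    by rewrite /E le_eqVlt; apply/orP; left; apply/eqP; ring.
  have d2 : d <= E * (r ^+ k * `|y - x|).
    apply: (le_trans (P_lip k x y)); rewrite -mulrA ler_wpM2r//.
    by rewrite /E -!mulrA mulr_natl mulr2n lerDl mulr_ge0.
  have [E00|E00] := eqVneq E 0.
    apply: (@le_trans _ _ 0); first by move: d1; rewrite E00 mul0r.
    by rewrite !mulr_ge0 ?exprn_ge0 ?powR_ge0//; case/andP: q01.
  have Ep : 0 < E by rewrite lt_neqAle eq_sym E00.
  have : d / E <= (r^-1 ^+ k) `^ (1 - s) * (r ^+ k * `|y - x|) `^ s.
    apply: min_le_powR => //.
    - by rewrite divr_ge0 ?normc_ge0.
    - by rewrite ler_pdivrMr// mulrC.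
    - by rewrite ler_pdivrMr// mulrC.
  rewrite ler_pdivrMr// => /le_trans; apply.
  rewrite powRM ?(ltW rk)// !powRXn ?invr_ge0 ?(ltW r0)// /q exprMn /E.
  by rewrite le_eqVlt; apply/orP; left; apply/eqP; ring.
rewrite -mulr_sumr -[leRHS]mulrA [C * _]mulrC [leRHS]mulrA ler_wpM2l//.
by rewrite !mulr_ge0 ?powR_ge0.
Qed.

(** The limit is taken for the squared moduli, as real sequences; the bounds on
    the partial sums are uniform and pass to it. *)
Lemma lacunary_density : exists v : R -> R, exists M : R,
  [/\ forall x, normc (S K x) ^+ 2 @[K --> \oo] --> v x,
      forall K x, normc (S K x) ^+ 2 <= M &
      forall s : R, 0 < s < 2^-1 -> exists C : R,
        forall x y, `|v x - v y| <= C * `|x - y| `^ s].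
Proof.
have [M M0 hM] := Sbounded.
have cv x : cvgn (fun K => normc (S K x) ^+ 2).
  pose w K := normc (S K x) ^+ 2; rewrite -/w.
  have -> : w = (fun n => w 0%N + series (telescope w) n).
    by apply/funext => n; rewrite -eq_sum_telescope.
  apply: is_cvgD; first exact: is_cvg_cst.
  apply: normed_cvg; apply: nondecreasing_is_cvgn.
    by apply/nondecreasing_seqP => n; rewrite /= !seriesEnat/= big_nat_recr//= lerDl.
  have [|C C0 hC] := @square_geometric_bounded r^-1.
    by rewrite invr_ge0 (ltW r0)/= invf_lt1.
  exists (2 * M * (D * C)) => _ [n _ <-].
  apply: (@le_trans _ _ (\sum_(0 <= k < n) `|telescope w k|)) => //.
  rewrite big_mkord.
  apply: (@le_trans _ _ (2 * M * (D * \sum_(k < n) k.+1%:R ^+ 2 * r^-1 ^+ k))).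
    rewrite 2!mulr_sumr; apply: ler_sum => k _.
    rewrite /telescope /w; apply: (le_trans (sqr_normcB_le (hM _ _) (hM _ _))).
    rewrite ler_wpM2l ?mulr_ge0// /S opprD addrACA subrr add0r.
    by rewrite big_ord_recr/= addrAC subrr add0r exprVn mulrA P_sup.
  by rewrite !ler_wpM2l ?mulr_ge0.
exists (fun x => lim (normc (S K x) ^+ 2 @[K --> \oo])), (M ^+ 2); split.
- by move=> x; exact: cv.
- by move=> K x; rewrite lerXn2r ?nnegrE ?normc_ge0.
- move=> s hs; have [C C0 hC] := Shoelder hs; exists (2 * M * C) => x y.
  have h : `|normc (S K x) ^+ 2 - normc (S K y) ^+ 2| @[K --> \oo] -->
      `|lim (normc (S K x) ^+ 2 @[K --> \oo]) - lim (normc (S K y) ^+ 2 @[K --> \oo])|.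
    by apply: cvg_norm; apply: cvgB; exact: cv.
  apply: (@closed_cvg _ _ \oo eventually_filter _
    (fun z => z <= 2 * M * C * `|x - y| `^ s) _ _ _ h); first exact: closed_le.
  apply: nearW => K; apply: (le_trans (sqr_normcB_le (hM _ _) (hM _ _))).
  by rewrite -[leRHS]mulrA ler_wpM2l ?mulr_ge0.
Qed.

End lacunary_series.

Section density_regularity.
Variable R : realType.
Local Notation mu := (@lebesgue_measure R).
Variables (g T : R -> R) (V : R).
Hypothesis pg : periodic g 1.
Hypothesis gT : variation_majorant g T V.
Variable u : R -> R -> R[i].
Hypothesis gu : schrodinger_evolution g u.
Let a := fourier_coef g.

Lemma hoelder_continuous (v : R -> R) (C s : R) : 0 < s ->
  (forall x y, `|v x - v y| <= C * `|x - y| `^ s) -> continuous v.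
Proof.
move=> s0 hv x; apply/cvgrPdist_le => e e0.
have C1 : 0 < `|C| + 1 by rewrite ltr_wpDl.
pose d : R := (e / (`|C| + 1)) `^ s^-1.
have d0 : 0 < d by rewrite powR_gt0// divr_gt0.
have ds : d `^ s = e / (`|C| + 1).
  by rewrite /d -powRrM mulVf ?gt_eqF// powRr1// divr_ge0// ltW.
apply/nbhs_ballP; exists d => //= y xy; apply: (le_trans (hv x y)).
apply: (@le_trans _ _ ((`|C| + 1) * (d `^ s))); last first.
  by rewrite ds mulrCA divff ?mulr1// gt_eqF.
apply: (@le_trans _ _ ((`|C| + 1) * `|x - y| `^ s)).
  by rewrite ler_wpM2r ?powR_ge0// (le_trans (ler_norm _))// lerDl.
rewrite ler_wpM2l ?(ltW C1)//; apply: ge0_ler_powR; rewrite ?nnegrE ?(ltW s0) ?(ltW d0)//.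
exact: ltW xy.
Qed.

Lemma pow2_pred_cvg : (2 ^ K).-1 @[K --> \oo] --> \oo.
Proof.
apply/cvgnyPge => A; near=> K.
have : (A <= K)%N by near: K; exact: nbhs_infty_ge.
by have := ltn_expl K (isT : (1 < 2)%N); case: (2 ^ K)%N => // n /=; lia.
Unshelve. all: by end_near. Qed.

(** The truncations at [2 ^ K - 1] are the partial sums of a lacunary series of
    blocks and converge everywhere; as they also converge to the density in
    [L^1], the two limits agree almost everywhere. *)
Lemma density_hoelder_version t : weyl_regular t -> exists v : R -> R,
  [/\ bounded_mfun v, periodic v 1, {ae mu, forall x, density u t x = v x} &
      forall s : R, 0 < s < 2^-1 -> exists C : R,
        forall x y, `|v x - v y| <= C * `|x - y| `^ s].
Proof.
move=> /weyl_regular_bounded[A [A0 h1 h2]].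
have V0 := majorant_mass_ge0 gT.
have [|k x|k x y|v [M [hv hM hs]]] := @lacunary_density R (paired_block g t) (a 0) (2 * A * V).
- by rewrite !mulr_ge0.
- exact: (paired_block_sup pg gT k x A0 h1 h2).
- have := paired_block_increment pg gT k x (y - x) h1 h2.
  by rewrite (_ : x + (y - x) = y)//; ring.
pose w K := truncated_density a (2 ^ K).-1 t.
have wE K x : w K x = normc (a 0 + \sum_(k < K) paired_block g t k x) ^+ 2.
  by rewrite /w /truncated_density (schrodinger_poly_blocks pg gT).
have bw K : bounded_mfun (w K) by exact: bounded_mfun_truncated_density.
have wv x : w K x @[K --> \oo] --> v x.
  by under eq_fun do rewrite wE; exact: hv.
have wM K x : `|w K x| <= M by rewrite ger0_norm ?sqr_ge0// wE.
have [bv _] := cvg_torus_integral (fun K => (bw K).1) wM wv.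
have vM x : `|v x| <= M.
  apply: (@closed_cvg _ _ \oo eventually_filter _ (fun z => z <= M) _ _ _
    (cvg_norm (@wv x))); first exact: closed_le.
  exact: nearW.
have pv : periodic v 1.
  move=> x; rewrite -(cvg_lim (@Rhausdorff R) (@wv (x + 1))) -(cvg_lim (@Rhausdorff R) (@wv x)).
  congr (lim (_ @ \oo)); apply/funext => K; congr (normc _ ^+ 2).
  apply: eq_bigr => n _; congr (_ * _).
  by rewrite mulrDr mulr1 addrAC e2piD e2pi_int mulr1.
exists v; split => //.
apply: ae_periodic.
- move=> x; have [pu _ _ _] := gu t.
  by rewrite pv /density pu.
- move=> x; have [pu _ _ _] := gu t.
  by rewrite pv /density pu.
have I01 := @measurable_itv01 R.
have iu := integrable_density gu t.
have iv : mu.-integrable `[0, 1] (EFin \o v) by exact: bounded_mfun_integrable.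
have iw K : mu.-integrable `[0, 1] (EFin \o w K) by exact: bounded_mfun_integrable.
have c1 : \int[mu]_(x in `[0, 1]) `|density u t x - w K x| @[K --> \oo] --> 0.
  exact: (cvg_comp _ _ pow2_pred_cvg (@density_L1_cvg _ _ _ _ pg gT _ gu t)).
have c2 : torus_integral (fun x => `|w K x - v x|) @[K --> \oo] --> 0.
  rewrite -[X in _ --> X](@torus_integral_cst R).
  have mF K : measurable_fun [set: R] (fun x => `|w K x - v x|).
    by apply: (bounded_mfun_norm _).1; exact: bounded_mfunB.
  have hF K x : `| `|w K x - v x| | <= M + M.
    by rewrite normr_id (le_trans (ler_normB _ _))// lerD.
  have cF x : `|w K x - v x| @[K --> \oo] --> (0 : R).
    rewrite -[X in _ --> X](normr0 R) -(subrr (v x)).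
    by apply: cvg_norm; apply: cvgB; [exact: wv|exact: cvg_cst].
  exact: (cvg_torus_integral mF hF cF).2.
have c12 : \int[mu]_(x in `[0, 1]) `|density u t x - w K x| +
    torus_integral (fun x => `|w K x - v x|) @[K --> \oo] --> (0 : R).
  by rewrite -[X in _ --> X](addr0 0); exact: cvgD.
have I0 : \int[mu]_(x in `[0, 1]) `|density u t x - v x| <= 0.
  have h K : \int[mu]_(x in `[0, 1]) `|density u t x - v x| <=
      \int[mu]_(x in `[0, 1]) `|density u t x - w K x| + torus_integral (fun x => `|w K x - v x|).
    have i1 := integrable_norm (integrable01B iu (iw K)).
    have i2 := integrable_norm (integrable01B (iw K) iv).
    rewrite /torus_integral -RintegralD//; apply: le_Rintegral => //.
    - exact: integrable_norm (integrable01B iu iv).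
    - by have := integrableD I01 i1 i2; apply: eq_integrable.
    - by move=> x _; rewrite -(subrKA (w K x)) ler_normD.
  apply: (@closed_cvg _ _ \oo eventually_filter _
    (fun z => \int[mu]_(x in `[0, 1]) `|density u t x - v x| <= z) _ _ _ c12).
    exact: closed_ge.
  exact: nearW.
have iuv := integrable01B iu iv.
have E0 : (\int[mu]_(x in `[0%R, 1%R]) `|(density u t x - v x)%:E|)%E = 0%E.
  have fn := integrable_fin_num I01 (integrable_norm iuv).
  rewrite -[LHS]fineK//; congr EFin; apply/eqP; rewrite eq_le; apply/andP; split => //.
  by rewrite fine_ge0// integral_ge0.
have mE : measurable_fun `[(0 : R), 1] (fun x => (density u t x - v x)%:E).
  by have /integrableP[] := iuv.
have := (ae_eq_integral_abs mu I01 mE).1 E0.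
apply: (@filterS _ _ (ae_filter_ringOfSetsType _)) => x h x01.
have xI : `[0, 1]%classic x by rewrite /= in_itv.
by have := EFin_inj (h xI) => /eqP; rewrite subr_eq0 => /eqP.
Qed.

End density_regularity.

(** * Critical mass and smoothness *)

Section almost_everywhere_equality.
Variable R : realType.
Local Notation mu := (@lebesgue_measure R).
Local Notation integrable01 f := (mu.-integrable `[0, 1] (EFin \o f)).

Lemma ae_shift (P : R -> Prop) (c : R) :
  {ae mu, forall x, P x} -> {ae mu, forall x, P (x + c)}.
Proof.
move=> [N [mN N0 PN]]; exists (((fun x => x + c) : R -> measurableTypeR R) @^-1` N); split.
- by rewrite -[X in measurable X]setTI; apply: (@measurable_funD _ _ _ _ id (cst c)).
- by have := lebesgue_measure_shift c mN; rewrite N0.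
- by move=> x /= Px; exact: PN.
Qed.

Lemma ae_eq_fourier_coef (f1 f2 : R -> R) (m : int) : integrable01 f1 -> integrable01 f2 ->
  {ae mu, forall x, f1 x = f2 x} -> fourier_coef f1 m = fourier_coef f2 m.
Proof.
move=> i1 i2 f12; apply/eqP; rewrite -subr_eq0 -normc_eq0 eq_le normc_ge0 andbT.
apply: (le_trans (normc_fourier_coefB_le m i1 i2)).
have I01 := @measurable_itv01 R.
have i12 := integrable01B i1 i2.
have mE : measurable_fun `[(0 : R), 1] (fun x => (f1 x - f2 x)%:E).
  by have /integrableP[] := i12.
have h : (\int[mu]_(x in `[0%R, 1%R]) `|(f1 x - f2 x)%:E|)%E = 0%E.
  apply/(ae_eq_integral_abs mu I01 mE); move: f12.
  by apply: (@filterS _ _ (ae_filter_ringOfSetsType _)) => x -> _; rewrite subrr.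
have -> : \int[mu]_(x in `[0, 1]) `|f1 x - f2 x| =
   fine (\int[mu]_(x in `[0%R, 1%R]) `|(f1 x - f2 x)%:E|)%E by [].
by rewrite h mulr0.
Qed.

End almost_everywhere_equality.

Section critical_regularity.
Variable R : realType.
Local Notation mu := (@lebesgue_measure R).

(** Half of the square of the homogeneous [H^(1/2)] seminorm of a real function,
    truncated at the frequency [M]. *)
Definition half_mass (f : R -> R) (M : nat) : R :=
  \sum_(1 <= m < M.+1) m%:R * normc (fourier_coef f m%:Z) ^+ 2.

Lemma log_asymp_unbounded (y : nat -> R) (L K : R) : 0 < L -> log_asymp y L ->
  ~ (forall M, y M <= K).
Proof.
move=> L0 yL yK; have L2 : 0 < L / 2 by rewrite divr_gt0.
have [C hC] := yL _ L2.
have /cvgryPgt/(_ ((K + C) / (L / 2)))[N _ hN] := @cvg_ln_nat R.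
have := hN N.+1 (leqnSn N); rewrite /= ltr_pdivrMr// => h.
have := hC N.+1 isT; move=> /ler_normlP[h1 _]; have := yK N.+1.
have : L * ln N.+1%:R = L / 2 * ln N.+1%:R + L / 2 * ln N.+1%:R by rewrite -mulrDl -splitr.
rewrite mulrC in h; lra.
Qed.

Lemma half_mass_le_sobolev (f : R -> R) : in_sobolev (1 / 2) f ->
  exists K : R, forall M, half_mass f M <= K.
Proof.
move=> [_]; set E := (\esum_(m in _) _)%E => Eoo.
have E0 : (0 <= E)%E.
  by apply: esum_ge0 => m _; rewrite lee_fin mulr_ge0 ?powR_ge0 ?sqr_ge0.
have Ef : E \is a fin_num by rewrite ge0_fin_numE.
exists (fine E) => M; rewrite -lee_fin fineK//.
pose s := [seq m%:Z | m <- iota 1 M].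
have us : uniq s by rewrite map_inj_uniq ?iota_uniq// => x y [].
apply: esum_ge; exists [set` s]; first by split => //; exact: finite_seq.
rewrite -fsbig_seq// sumEFin lee_fin big_map /half_mass.
rewrite -[in leRHS](subn0 M) -subSS -/(index_iota 1 M.+1).
apply: ler_sum => m _; rewrite ler_wpM2r ?sqr_ge0//.
have -> : m%:R = (m%:R ^+ 2) `^ (1 / 2) :> R.
  by rewrite -powR_mulrn// -powRrM (_ : 2 * (1 / 2) = 1) ?powRr1//; field.
apply: ge0_ler_powR; rewrite ?nnegrE ?powR_ge0//.
by rewrite -pmulrn lerDr.
Qed.

Lemma iter_difference_alternating (r : nat) (z : R[i]) :
  \sum_(k < r.+1) ((-1) ^+ (r - k) * 'C(r, k)%:R : R)%:C * z ^+ k = (z - 1) ^+ r.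
Proof.
rewrite addrC exprDn; apply: eq_bigr => k _.
rewrite realcM -[RHS]mulr_natr [RHS]mulrAC; congr (_ * _ * _); last by rewrite rmorph_nat.
by rewrite rmorphXn rmorphN rmorph1.
Qed.

(** The coefficients of the difference have sum zero if [0 < r]. *)
Lemma iter_difference_increments (r : nat) (h : R) (f : R -> R) (x : R) : (0 < r)%N ->
  iter_difference r h f x =
  \sum_(k < r.+1) (-1) ^+ (r - k) * 'C(r, k)%:R * (f (x + k%:R * h) - f x).
Proof.
move=> r0; rewrite /iter_difference.
under [RHS]eq_bigr do rewrite mulrBr.
rewrite sumrB -mulr_suml.
suff -> : \sum_(k < r.+1) (-1) ^+ (r - k) * 'C(r, k)%:R = 0 :> R by rewrite mul0r subr0.
have := iter_difference_alternating r 1.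
rewrite subrr expr0n eqn0Ngt r0/= => /(congr1 (@complex.Re R)).
rewrite complex_Re_sum /= => h0; rewrite -[RHS]h0; apply: eq_bigr => k _.
by rewrite expr1n mulr1.
Qed.

Lemma bounded_mfun_iter_difference (r : nat) (h : R) (f : R -> R) : bounded_mfun f ->
  bounded_mfun (iter_difference r h f).
Proof.
move=> bf; apply: bounded_mfun_sum => k; apply: bounded_mfunZ.
exact: bounded_mfun_shift.
Qed.

Lemma fourier_coef_iter_difference (r : nat) (h : R) (f : R -> R) (n : int) :
  bounded_mfun f -> periodic f 1 ->
  fourier_coef (iter_difference r h f) n = (e2pi (n%:~R * h) - 1) ^+ r * fourier_coef f n.
Proof.
move=> bf pf; rewrite -iter_difference_alternating mulr_suml.
have bs k := bounded_mfun_shift (k * h) bf.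
rewrite fourier_coefE /cfourier_coef.
have -> : (fun x => (iter_difference r h f x)%:C * e2pi (- (n%:~R * x))) =
   (fun x => \sum_(k < r.+1) ((-1) ^+ (r - k) * 'C(r, k)%:R : R)%:C *
      ((f (x + k%:R * h))%:C * e2pi (- (n%:~R * x)))).
  apply/funext => x; rewrite /iter_difference realc_sum mulr_suml.
  by apply: eq_bigr => k _; rewrite realcM mulrA.
rewrite torus_cintegral_sum; last first.
  move=> k; apply: bounded_cfunZ; apply: bounded_cfun_coef.
  exact: bounded_cfun_real.
apply: eq_bigr => k _; rewrite torus_cintegralZ; last first.
  by apply: bounded_cfun_coef; exact: bounded_cfun_real.
have := fourier_coef_shift n (k%:R * h) bf pf.
rewrite {1}/fourier_coef => ->; rewrite -mulrA; congr (_ * (_ * _)).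
by rewrite -e2piMn; congr e2pi; ring.
Qed.

Variables (v : R -> R).
Hypothesis bv : bounded_mfun v.
Hypothesis pv : periodic v 1.
Hypothesis hv : forall s : R, 0 < s < 2^-1 -> exists C : R,
  forall x y, `|v x - v y| <= C * `|x - y| `^ s.

Lemma iter_difference_hoelder (r : nat) (s : R) : (0 < r)%N -> 0 < s < 2^-1 ->
  exists2 C : R, 0 <= C & forall h x : R, 0 <= h -> `|iter_difference r h v x| <= C * h `^ s.
Proof.
move=> r0 hs; have [C hC] := hv hs; have /andP[s0 _] := hs.
have C0 : 0 <= C.
  have := le_trans (normr_ge0 _) (hC 1 0); rewrite subr0 normr1.
  have -> : 1 `^ s = 1 :> R by rewrite powR1.
  by rewrite mulr1.
exists (\sum_(k < r.+1) 'C(r, k)%:R * (C * r%:R `^ s)).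
  by apply: sumr_ge0 => k _; rewrite !mulr_ge0 ?powR_ge0.
move=> h x h0; rewrite iter_difference_increments// mulr_suml.
apply: (le_trans (ler_norm_sum _ _ _)); apply: ler_sum => k _.
rewrite !normrM normrX normrN1 expr1n mul1r normr_nat -mulrA ler_wpM2l//.
apply: (le_trans (hC _ _)); rewrite -mulrA ler_wpM2l// -powRM//.
apply: ge0_ler_powR; rewrite ?nnegrE ?mulr_ge0 ?(ltW s0)//.
rewrite addrAC subrr add0r ger0_norm ?mulr_ge0// ler_wpM2r// ler_nat.
by rewrite -ltnS ltn_ord.
Qed.

(** A dyadic block of frequencies is seen by the differences of step
    [2 ^ (- k - 2)], whose multiplier is bounded below there. The mean square of
    these differences is at most the product of their uniform bound, by Hölder
    continuity, and their mean modulus; this leaves a geometric factor once the two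
    exponents add up to more than [1]. *)
Lemma half_mass_bounded (r : nat) (sigma D : R) (k0 : nat) : (0 < r)%N -> 2^-1 < sigma ->
  (forall k, (k0 <= k)%N ->
    torus_integral (fun x => `|iter_difference r (2 ^+ k.+2)^-1 v x|) <=
    D * (2 ^+ k.+2)^-1 `^ sigma) ->
  exists K : R, forall M, half_mass v M <= K.
Proof.
move=> r0 sg HD.
have D0 : 0 <= D.
  rewrite leNgt; apply/negP => Dn; have := HD k0 (leqnn _); rewrite leNgt => /negP; apply.
  apply: (@lt_le_trans _ _ 0).
    by rewrite pmulr_llt0// powR_gt0// invr_gt0 exprn_gt0.
  exact: torus_integral_ge0.
(* less than [1/2], and large enough for [1 < s + sigma] *)
pose s := Num.max 4^-1 (3 / 4 - sigma / 2).
have hs : 0 < s < 2^-1.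
  rewrite /s lt_max gt_max invr_gt0 ltr0n/=; apply/andP; split; lra.
have ss : 1 < s + sigma.
  have : 3 / 4 - sigma / 2 <= s by rewrite /s le_max lexx orbT.
  lra.
have [C C0 hC] := iter_difference_hoelder r0 hs.
pose F (m : nat) : R := m%:R * normc (fourier_coef v m%:Z) ^+ 2.
have F0 m : 0 <= F m by rewrite mulr_ge0 ?sqr_ge0.
pose B k := \sum_(i < 2 ^ k) F (2 ^ k + i)%N.
have B0 k : 0 <= B k by apply: sumr_ge0.
pose h k : R := (2 ^+ k.+2)^-1.
have h0 k : 0 < h k by rewrite invr_gt0 exprn_gt0.
pose e := s + sigma - 1; have e0 : 0 < e by rewrite subr_gt0.
pose E := 4 ^+ r ^+ 2 * (C * D).
have E0 : 0 <= E by rewrite !mulr_ge0 ?exprn_ge0.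
have block k : (k0 <= k)%N -> B k <= E * h k `^ e.
  move=> kk.
  have bI : bounded_mfun (iter_difference r (h k) v) by exact: bounded_mfun_iter_difference.
  have I1 : torus_integral (fun x => iter_difference r (h k) v x ^+ 2) <=
      C * h k `^ s * (D * h k `^ sigma).
    apply: (@le_trans _ _ (C * h k `^ s *
        torus_integral (fun x => `|iter_difference r (h k) v x|))); last first.
      by rewrite ler_wpM2l ?mulr_ge0 ?powR_ge0//; exact: HD.
    rewrite -torus_integralZ; last exact: bounded_mfun_norm.
    apply: le_torus_integral; first exact: bounded_mfunX.
      by apply: bounded_mfunZ; exact: bounded_mfun_norm.
    move=> x _; rewrite -real_normK ?num_real// expr2 ler_wpM2r//.
    by apply: hC; exact: ltW.
  pose bs := [seq (2 ^ k + i)%N%:Z | i <- iota 0 (2 ^ k)].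
  have ubs : uniq bs by rewrite map_inj_uniq ?iota_uniq// => i j [] /addnI.
  have := bessel (bounded_cfun_real bI) ubs.
  have -> : torus_integral (fun x => normc (iter_difference r (h k) v x)%:C ^+ 2) =
     torus_integral (fun x => iter_difference r (h k) v x ^+ 2).
    by apply: eq_torus_integral => x _; rewrite normc_real real_normK ?num_real.
  move=> /le_trans/(_ I1); rewrite big_map => H.
  have p0 : (0 : R) < 2 ^+ k by rewrite exprn_gt0.
  have hk4 : h k = 4^-1 / 2 ^+ k by rewrite /h !exprS; field; rewrite gt_eqF.
  have double_le (i : nat) : (i < 2 ^ k)%N -> (2 ^ k + i <= 2 * 2 ^ k)%N.
    by move=> ik; rewrite mul2n -addnn leq_add2l ltnW.
  have lower (i : nat) : (i < 2 ^ k)%N -> (4^-1) ^+ r ^+ 2 * normc (fourier_coef v (2 ^ k + i)%N%:Z) ^+ 2 <=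
      normc (cfourier_coef (fun x => (iter_difference r (h k) v x)%:C) (2 ^ k + i)%N%:Z) ^+ 2.
    move=> ik; rewrite -fourier_coefE fourier_coef_iter_difference// Normc.normcM exprMn.
    rewrite ler_wpM2r ?sqr_ge0// lerXn2r ?nnegrE ?normc_ge0 ?exprn_ge0 ?invr_ge0//.
    rewrite normcX lerXn2r ?nnegrE ?normc_ge0 ?invr_ge0//.
    have t1 : 4^-1 <= (2 ^ k + i)%N%:Z%:~R * h k.
      by rewrite -pmulrn hk4 mulrCA ler_peMr ?invr_ge0// ler_pdivlMr// mul1r -natrX ler_nat leq_addr.
    have t2 : (2 ^ k + i)%N%:Z%:~R * h k <= 2^-1.
      rewrite -pmulrn hk4 mulrCA; apply: (@le_trans _ _ (4^-1 * 2)); last by lra.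
      by rewrite ler_wpM2l ?invr_ge0// ler_pdivrMr// -natrX -natrM ler_nat double_le.
    rewrite normcB_sym; apply: le_trans (normc_1Be2pi_ge _); last first.
      by rewrite ger0_norm// (le_trans _ t1)// invr_ge0.
    by rewrite (le_trans t1)// ler_norm.
  rewrite /B; apply: (@le_trans _ _ (\sum_(i <- iota 0 (2 ^ k)) (2 * 2 ^+ k) * 4 ^+ r ^+ 2 *
     normc (cfourier_coef (fun x => (iter_difference r (h k) v x)%:C) (2 ^ k + i)%N%:Z) ^+ 2)).
    rewrite -(big_mkord xpredT (fun i => F (2 ^ k + i)%N)) /index_iota subn0.
    rewrite big_seq [leRHS]big_seq; apply: ler_sum => i; rewrite mem_iota add0n => /andP[_ ik].
    have l4 := lower i ik.
    rewrite /F -[leRHS]mulrA; apply: ler_pM; rewrite ?sqr_ge0//.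
      by rewrite -natrX -natrM ler_nat double_le.
    by move: l4; rewrite !exprVn ler_pdivrMl ?exprn_gt0.
  rewrite -mulr_sumr; apply: (le_trans (ler_wpM2l _ H)).
    by rewrite !mulr_ge0 ?exprn_ge0.
  have hE : h k `^ s * h k `^ sigma = h k * h k `^ e.
    rewrite -{3}[h k]powRr1 ?(ltW (h0 k))// -!powRD ?(gt_eqF (h0 k)) ?implybT//.
    by congr (_ `^ _); rewrite /e; ring.
  rewrite [leLHS](_ : _ = 2 * 2 ^+ k * h k * (E * h k `^ e)); last first.
    rewrite [LHS](_ : _ = 2 * 2 ^+ k * E * (h k `^ s * h k `^ sigma)); last by rewrite /E; ring.
    by rewrite hE; ring.
  rewrite ler_piMl ?mulr_ge0 ?powR_ge0// hk4.
  rewrite (_ : 2 * 2 ^+ k * _ = 2^-1); last by field; rewrite gt_eqF.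
  lra.
pose q : R := 2^-1 `^ e.
have q01 : 0 <= q < 1.
  rewrite powR_ge0/= /q; have p1 : 1 `^ e = 1 :> R by rewrite powR1.
  rewrite -[ltRHS]p1; apply: gt0_ltr_powR; rewrite ?nnegrE//; lra.
have hq k : h k `^ e <= q ^+ k.
  have -> : q ^+ k = (2^-1 ^+ k) `^ e by rewrite powRXn.
  apply: ge0_ler_powR; rewrite ?nnegrE ?exprn_ge0 ?(ltW e0) ?(ltW (h0 k))//.
  by rewrite /h exprVn lef_pV2 ?posrE ?exprn_gt0//; apply: ler_weXn2l; [rewrite ler1n|exact: leqW (leqnSn k)].
have [G G0 hG] := square_geometric_bounded q01.
pose B' := \sum_(k < k0) B k.
exists (B' + E * G) => M.
apply: (@le_trans _ _ (\sum_(1 <= m < 2 ^ M.+1) F m)).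
  rewrite /half_mass -/(F _) [leRHS](@big_cat_nat _ _ _ M.+1)//=; last first.
    by rewrite ltnW// ltn_expl.
  by rewrite lerDl; apply: sumr_ge0.
rewrite sum_dyadic.
apply: (@le_trans _ _ (\sum_(k < M.+1) ((if (k < k0)%N then B k else 0) + E * (k.+1%:R ^+ 2 * q ^+ k)))).
  apply: ler_sum => k _; rewrite -/(B k).
  have qk : 0 <= q ^+ k by rewrite exprn_ge0//; case/andP: q01.
  case: ltnP => kk; first by rewrite lerDl mulr_ge0// mulr_ge0// sqr_ge0.
  rewrite add0r (le_trans (block k kk))// ler_wpM2l// (le_trans (hq k))//.
  by rewrite ler_peMl// exprn_ege1// ler1n.
rewrite big_split/= -mulr_sumr; apply: lerD; last by apply: (ler_wpM2l E0); exact: hG.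
rewrite -(big_mkord xpredT (fun k => if (k < k0)%N then B k else 0)) -big_mkcond/=.
rewrite /B' -(big_mkord xpredT B).
have -> : \sum_(0 <= i < M.+1 | (i < k0)%N) B i = \sum_(0 <= i < minn M.+1 k0) B i.
  by rewrite [RHS](big_nat_widen _ _ M.+1) ?geq_minl//; apply: congr_big_nat => // i /andP[_ iM];
    rewrite leq_min iM.
rewrite [leRHS](@big_cat_nat _ _ _ (minn M.+1 k0))//= ?geq_minr// lerDl.
by apply: sumr_ge0.
Qed.

End critical_regularity.

(** * Box dimension of the graph *)

Section graph_covers.
Variable R : realType.
Local Notation mu := (@lebesgue_measure R).

(** By comparison of lengths: the interval is covered by the intervals of length
    [2 d] around the entries of [s]. *)
Lemma interval_cover_length (s : seq R) (d al be : R) : 0 < d -> al <= be ->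
  (forall y, al <= y <= be -> exists2 z, z \in s & `|z - y| < d) ->
  be - al <= 2 * d * (size s)%:R.
Proof.
move=> d0 ab H; pose F (k : nat) : set (measurableTypeR R) := `](nth 0 s k - d), (nth 0 s k + d)[%classic.
have mA : measurable (`[al, be]%classic : set (measurableTypeR R)) by exact: measurable_itv.
have sub : `[al, be]%classic `<=` \big[setU/set0]_(k < size s) F k.
  move=> y /=; rewrite in_itv/= => /H[z zs zy].
  rewrite -bigcup_mkord; exists (index z s); first by rewrite /= index_mem.
  rewrite /F /= in_itv/= nth_index//; move: zy; rewrite ltr_norml => /andP[h1 h2].
  by apply/andP; split; lra.
have h : (mu `[al, be]%classic <= \sum_(k < size s) mu (F k))%E.
  by apply: content_subadditive => // k _; exact: measurable_itv.
move: h; rewrite lebesgue_measure_itv/= lte_fin.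
have -> : (\sum_(k < size s) mu (F k) = (\sum_(k < size s) 2 * d)%:E)%E.
  rewrite -sumEFin; apply: eq_bigr => k _; rewrite lebesgue_measure_itv/= lte_fin.
  rewrite (_ : nth 0 s k - d < nth 0 s k + d = true); last by lra.
  by rewrite -EFinB; congr EFin; ring.
rewrite sumr_const card_ord mulr_natr; case: ltP => [_|ba _].
  by rewrite -EFinB lee_fin.
by rewrite (@le_trans _ _ 0) ?subr_le0// mulrn_wge0// mulr_ge0// ltW.
Qed.

Lemma torus_integral_indic_le (a b : R) : a <= b ->
  torus_integral (\1_(`]a, b[%classic) : R -> R) <= b - a.
Proof.
move=> ab; rewrite /torus_integral /Rintegral integral_indic//.
have h : (mu (`]a, b[%classic `&` `[0%R, 1%R]%classic) <= (b - a)%:E)%E.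
  apply: (@le_trans _ _ (mu `]a, b[%classic)).
    apply: le_measure; rewrite ?inE; [exact: measurableI|exact: measurable_itv|].
    by move=> x [].
  rewrite lebesgue_measure_itv/= lte_fin; case: ltP => // _.
  by rewrite lee_fin subr_ge0.
rewrite -lee_fin fineK// ge0_fin_numE//; exact: le_lt_trans h (ltry _).
Qed.

Variable v : R -> R.
Hypothesis cv : continuous v.

(** Between [x] and [x + d] the graph passes through every height between
    [v x] and [v (x + d)], hence the balls whose centers lie above a
    neighbourhood of [x] cover this whole range of heights. *)
Lemma cover_increment (n : nat) (c : 'I_n -> R * R) (d x : R) : 0 < d ->
  torus_graph v `<=` \bigcup_i ball (c i) d -> 0 <= x -> x + d <= 1 ->
  `|v (x + d) - v x| <=
  \sum_(i < n) 2 * d * \1_(`](c i).1 - 2 * d, (c i).1 + 2 * d[%classic) x.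
Proof.
move=> d0 cov x0 x1.
pose al := Num.min (v x) (v (x + d)); pose be := Num.max (v x) (v (x + d)).
have ab : al <= be by rewrite /al /be ge_min !le_max !lexx.
have -> : `|v (x + d) - v x| = be - al.
  by rewrite /al /be; case: (leP (v x) (v (x + d))) => h;
    [rewrite ger0_norm ?subr_ge0|rewrite ltr0_norm ?subr_lt0// opprB].
pose near (i : 'I_n) := (c i).1 - 2 * d < x < (c i).1 + 2 * d.
pose s := [seq (c i).2 | i <- enum 'I_n & near i].
apply: (@le_trans _ _ (2 * d * (size s)%:R)).
  apply: interval_cover_length => // y yab.
  have [z] : exists2 z, z \in `[x, x + d] & v z = y.
    apply: IVT; [by rewrite lerDl ltW| |exact: yab].
    exact: continuous_subspaceT.
  rewrite in_itv/= => /andP[xz zx] vz.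
  have [|i _ /= [b1 b2]] := cov (z, y).
    exists z; first by rewrite /= in_itv/= (le_trans x0 xz) (le_trans zx x1).
    by rewrite vz.
  exists (c i).2; last exact: b2.
  apply/mapP; exists i => //; rewrite mem_filter mem_enum andbT /near.
  move: b1; rewrite /ball/= ltr_norml => /andP[h1 h2]; apply/andP; split; lra.
rewrite -mulr_sumr ler_wpM2l ?mulr_ge0 ?(ltW d0)//.
rewrite /s size_map size_filter -sum1_count natr_sum big_enum_cond/=.
rewrite big_mkcond/=; apply: ler_sum => i _.
rewrite /near indicE; case: ifPn => // h.
by rewrite mem_set//= in_itv/=.
Qed.

Hypothesis pv : periodic v 1.

Lemma cover_L1_increment (n : nat) (c : 'I_n -> R * R) (d M : R) : 0 < d -> d <= 1 ->
  bounded_mfun v -> (forall x, `|v x| <= M) ->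
  torus_graph v `<=` \bigcup_i ball (c i) d ->
  torus_integral (fun x => `|iter_difference 1 d v x|) <= 8 * (n%:R * d ^+ 2) + 4 * M * d.
Proof.
move=> d0 d1 bv vM cov.
have M0 : 0 <= M by exact: le_trans (vM 0).
have E x : iter_difference 1 d v x = v (x + d) - v x.
  rewrite /iter_difference !big_ord_recl big_ord0/= /bump/= !mul0r mul1r addr0.
  by rewrite subn0 expr1 bin0 mulr1 mulN1r addn0 bin1 !mul1r addr0 addrC.
pose F x : R := \sum_(i < n) 2 * d * \1_(`](c i).1 - 2 * d, (c i).1 + 2 * d[%classic) x.
(* [G] accounts for the increments that leave the interval [[0, 1]] *)
pose G x : R := 2 * M * \1_(`](1 - d), (1 + d)[%classic) x.
have bF : bounded_mfun F.
  by apply: bounded_mfun_sum => i; apply: bounded_mfunZ; exact: bounded_mfun_indic.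
have bG : bounded_mfun G by apply: bounded_mfunZ; exact: bounded_mfun_indic.
have ind0 (A : set R) x : 0 <= (\1_A x : R) by rewrite indicE.
have F0 x : 0 <= F x.
  by apply: sumr_ge0 => i _; rewrite !mulr_ge0// ltW.
apply: (@le_trans _ _ (torus_integral (fun x => F x + G x))).
  apply: le_torus_integral; [|exact: bounded_mfunD|].
    by apply: bounded_mfun_norm; exact: bounded_mfun_iter_difference.
  move=> x /andP[x0 x1]; rewrite E; have [xd|xd] := leP (x + d) 1.
    apply: (le_trans (cover_increment d0 cov x0 xd)); rewrite -/(F x) lerDl.
    by rewrite !mulr_ge0.
  apply: (@le_trans _ _ (G x)); last by rewrite lerDr.
  rewrite /G indicE mem_set/=; last by rewrite in_itv/=; apply/andP; split; lra.
  by rewrite mulr1 (le_trans (ler_normB _ _))// mulrDl mul1r lerD.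
rewrite torus_integralD//; apply: lerD.
  rewrite torus_integral_sum; last by move=> i; apply: bounded_mfunZ; exact: bounded_mfun_indic.
  apply: (@le_trans _ _ (\sum_(i < n) 8 * d ^+ 2)); last first.
    by rewrite sumr_const card_ord -mulr_natr le_eqVlt; apply/orP; left; apply/eqP; ring.
  apply: ler_sum => i _; rewrite torus_integralZ; last exact: bounded_mfun_indic.
  have := @torus_integral_indic_le ((c i).1 - 2 * d) ((c i).1 + 2 * d).
  have -> : (c i).1 - 2 * d <= (c i).1 + 2 * d by lra.
  move=> /(_ isT)/(ler_wpM2l (ltW d0)); rewrite -mulrA; nra.
rewrite torus_integralZ; last exact: bounded_mfun_indic.
have := @torus_integral_indic_le (1 - d) (1 + d).
have -> : 1 - d <= 1 + d by lra.
move=> /(_ isT)/(ler_wpM2l M0); rewrite -mulrA; nra.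
Qed.

(** Above each interval of length [d] the graph stays in a strip of height
    [O(d ^ s)], which takes [O(d ^ (s - 1))] balls; there are [O(1 / d)] such
    intervals. *)
Lemma hoelder_cover (C s d : R) : 0 <= C -> 0 < s < 1 -> 0 < d <= 1 ->
  (forall x y, `|v x - v y| <= C * `|x - y| `^ s) ->
  exists n : nat, exists c : 'I_n -> R * R,
    [/\ torus_graph v `<=` \bigcup_i ball (c i) d, (0 < n)%N &
        n%:R <= (4 * C + 2) * d `^ (s - 2)].
Proof.
move=> C0 /andP[s0 s1] /andP[d0 d1] hv.
pose rho := C * d `^ s; have rho0 : 0 <= rho by rewrite mulr_ge0 ?powR_ge0.
pose n1 := (Num.truncn d^-1).+1; pose n2 := (Num.truncn (2 * rho / d)).+1.
pose c (k : 'I_(n1 * n2)) : R * R :=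
  ((k %/ n2)%N%:R * d, v ((k %/ n2)%N%:R * d) - rho + (k %% n2)%N%:R * d).
exists (n1 * n2)%N, c; split.
- move=> _ [x /= x01 <-]; move: x01; rewrite in_itv/= => /andP[x0 x1].
  pose i := Num.truncn (x / d).
  have xd0 : 0 <= x / d by rewrite divr_ge0// ltW.
  have /andP[i1 i2] := truncn_itv xd0; rewrite -/i in i1 i2.
  rewrite ler_pdivlMr// in i1; rewrite ltr_pdivrMr// -natr1 mulrDl mul1r in i2.
  have in1 : (i < n1)%N.
    by rewrite ltnS; apply: le_truncn; rewrite ler_pdivrMr// mulVf// gt_eqF.
  have osc : `|v x - v (i%:R * d)| <= rho.
    apply: (le_trans (hv _ _)); rewrite ler_wpM2l//; apply: ge0_ler_powR;
      rewrite ?nnegrE ?(ltW s0) ?(ltW d0)//.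
    rewrite ger0_norm ?subr_ge0//; lra.
  move: osc => /ler_normlP[h1 h2].
  pose w := v x - v (i%:R * d) + rho; have w0 : 0 <= w by rewrite /w; lra.
  pose j := Num.truncn (w / d).
  have wd0 : 0 <= w / d by rewrite divr_ge0// ltW.
  have /andP[j1 j2] := truncn_itv wd0; rewrite -/j in j1 j2.
  rewrite ler_pdivlMr// in j1; rewrite ltr_pdivrMr// -natr1 mulrDl mul1r in j2.
  have jn2 : (j < n2)%N.
    rewrite ltnS; apply: le_truncn; rewrite ler_pM2r ?invr_gt0// /w; lra.
  have kn : (i * n2 + j < n1 * n2)%N.
    by apply: (@leq_trans (i.+1 * n2)); [rewrite mulSn addnC ltn_add2r|rewrite leq_mul2r in1 orbT].
  exists (Ordinal kn) => //; rewrite /c /= divnMDl// divn_small// addn0 modnMDl modn_small//.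
  split; rewrite /ball/= ltr_norml; apply/andP; split; rewrite /w in j1 j2; lra.
- by rewrite muln_gt0.
- rewrite natrM.
  have t1 : n1%:R <= 2 / d.
    rewrite /n1 -natr1; have := truncn_le d^-1; rewrite invr_ge0 (ltW d0) => h.
    have : 1 <= d^-1 by rewrite invf_ge1.
    lra.
  have dd : 1 <= d `^ s / d.
    rewrite ler_pdivlMr// mul1r -{1}[d]powRr1 ?(ltW d0)//.
    by apply: ger_powR; rewrite ?d0// ltW.
  have t2 : n2%:R <= (2 * C + 1) * (d `^ s / d).
    have q0 : 0 <= 2 * rho / d by rewrite divr_ge0 ?(ltW d0)// mulr_ge0.
    rewrite /n2 -natr1; have := truncn_le (2 * rho / d).
    rewrite q0 => h; rewrite [leRHS]mulrDl mul1r.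
    apply: lerD => //; apply: (le_trans h).
    by rewrite /rho le_eqVlt; apply/orP; left; apply/eqP; ring.
  apply: (le_trans (ler_pM _ _ t1 t2)) => //.
  have -> : d `^ (s - 2) = d `^ s / d / d.
    rewrite powRD ?(gt_eqF d0) ?implybT// powRN powR_mulrn ?(ltW d0)// expr2 invfM mulrA//.
  by rewrite le_eqVlt; apply/orP; left; apply/eqP; ring.
Qed.

End graph_covers.

Section graph_dimension.
Variable R : realType.
Variable v : R -> R.
Hypothesis cv : continuous v.
Hypothesis bv : bounded_mfun v.
Hypothesis pv : periodic v 1.
Hypothesis hv : forall s : R, 0 < s < 2^-1 -> exists C : R,
  forall x y, `|v x - v y| <= C * `|x - y| `^ s.
Local Notation N d := (covering_number (torus_graph v) d).

Lemma upper_box_dim_graph_le : (upper_box_dim (torus_graph v) <= (3 / 2)%:E)%E.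
Proof.
apply/lee_addgt0Pr => e0 e00.
(* the exponent [s = 1/2 - e/2] must be positive *)
pose e := Num.min e0 2^-1; have e_gt0 : 0 < e by rewrite lt_min e00 invr_gt0 ltr0n.
have ee0 : e <= e0 by rewrite ge_min lexx.
have e12 : e <= 2^-1 by rewrite ge_min lexx orbT.
pose s := 2^-1 - e / 2.
have hs : 0 < s < 2^-1 by rewrite /s; apply/andP; split; lra.
have [C1 hC1] := hv hs; pose C := `|C1|.
have hC x y : `|v x - v y| <= C * `|x - y| `^ s.
  by apply: (le_trans (hC1 x y)); rewrite ler_wpM2r ?powR_ge0// ler_norm.
have C0 : 0 <= C by exact: normr_ge0.
pose K := 4 * C + 2; have K1 : 1 <= K by rewrite /K; lra.
have lK : 0 <= ln K by rewrite ln_ge0.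
(* below this radius the constant [K] of the covering costs at most [d ^ (- e / 2)] *)
pose del := Num.min 2^-1 (expR (- (2 * ln K / e))).
have del0 : 0 < del by rewrite lt_min invr_gt0 ltr0n expR_gt0.
apply: (@le_trans _ _ (3 / 2 + e)%:E); last by rewrite EFinD leeD2l// lee_fin.
rewrite /upper_box_dim limf_esupE; apply: (@le_trans _ _ (ereal_sup
  ((fun d : R => lne (N d) * ((ln d^-1)^-1)%:E)%E @` [set d | 0 < d < del]))).
  apply: ereal_inf_lbound; exists [set d | 0 < d < del] => //.
  near=> d; apply/andP; split; near: d; [exact: nbhs_right_gt|exact: nbhs_right_lt].
apply: ge_ereal_sup => _ [d /= /andP[d0 dd] <-].
move: dd; rewrite lt_min => /andP[d2 dexp].
have L0 : 0 < ln d^-1.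
  by rewrite ln_gt0// invf_gt1// (lt_trans d2)// invf_lt1// ltr1n.
have [||n [c [cov n0 nle]]] := @hoelder_cover _ v C s d C0 _ _ hC.
- by case/andP: hs => s0 s2; rewrite s0 (lt_trans s2)// invf_lt1// ltr1n.
- by rewrite d0 ltW// (lt_trans d2)// invf_lt1// ltr1n.
have Nn : (N d <= n%:R%:E)%E by apply: ereal_inf_lbound; exists n => //; exists c.
have lnn : ln (n%:R : R) <= (3 / 2 + e) * ln d^-1.
  have lnd : ln d <= - (2 * ln K / e) by rewrite -[leRHS]expRK ler_ln ?posrE ?expR_gt0// ltW.
  have : ln (n%:R : R) <= ln K + (s - 2) * ln d.
    rewrite -ln_powR -lnM ?posrE ?powR_gt0//; last by rewrite (lt_le_trans ltr01).
    by rewrite ler_ln ?posrE ?ltr0n// mulr_gt0 ?powR_gt0// (lt_le_trans ltr01).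
  have hK : ln K <= - (e / 2) * ln d.
    have := ler_wpM2l (ltW e_gt0) lnd; rewrite mulrN mulrCA divff ?gt_eqF// mulr1.
    lra.
  by rewrite lnV ?posrE// /s; lra.
have : (lne (N d) <= (ln n%:R)%:E)%E.
  move: Nn; case: (N d) => [r| |]//= rn; last by rewrite leNye.
  case: (leP r 0) => r0; first by rewrite leNye.
  by rewrite lee_fin ler_ln ?posrE ?ltr0n// -lee_fin.
move=> h; rewrite muleC; apply: (@le_trans _ _ (((ln d^-1)^-1)%:E * (ln n%:R)%:E)%E).
  by rewrite lee_wpmul2l// lee_fin invr_ge0 ltW.
by rewrite -EFinM lee_fin mulrC ler_pdivrMr.
Unshelve. all: by end_near. Qed.

(** A covering by few balls makes the [L^1] modulus of continuity small at the
    scale of the covering, which is excluded by the divergence of the critical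
    mass. *)
Lemma upper_box_dim_graph_ge : ~ (exists K : R, forall M, half_mass v M <= K) ->
  ((3 / 2)%:E <= upper_box_dim (torus_graph v))%E.
Proof.
move=> unb; rewrite leNgt; apply/negP => H; apply: unb.
move: H; rewrite /upper_box_dim limf_esupE => /ereal_inf_lt[_ [W W0 <-] WH].
(* [1 <= s0] lets [d ^ (2 - s0)] dominate the boundary term [4 M d] of
   [cover_L1_increment] *)
have [s0 [s01 s02 sW]] : exists s0 : R, [/\ 1 <= s0, s0 < 3 / 2 &
    forall d, W d -> (lne (N d) * ((ln d^-1)^-1)%:E <= s0%:E)%E].
  have ub d : W d -> (lne (N d) * ((ln d^-1)^-1)%:E <=
      ereal_sup ((fun d : R => lne (N d) * ((ln d^-1)^-1)%:E)%E @` W))%E.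
    by move=> Wd; apply: ereal_sup_ubound; exists d.
  move: WH ub; case: (ereal_sup _) => [r| |]//.
    rewrite lte_fin => r32 ub; exists (Num.max r 1); split.
    - by rewrite le_max lexx orbT.
    - by rewrite gt_max r32/=; lra.
    - by move=> d /ub/le_trans; apply; rewrite lee_fin le_max lexx.
  move=> _ ub; exists 1; split => //; first by lra.
  by move=> d /ub/le_trans; apply; rewrite leNye.
have [del /= del0 hdel] : exists2 del : R, 0 < del & forall d, 0 < d < del -> W d.
  move: W0 => [e /= e0 he]; exists e => // d /andP[d0 de].
  by apply: he => //; rewrite /= sub0r normrN gtr0_norm.
pose sg := 2 - s0.
have [_ [M hM]] := bv.
have M0 : 0 <= M by exact: le_trans (normr_ge0 _) (hM 0).
have [k0 hk0] : exists k0 : nat, forall k, (k0 <= k)%N -> (2 ^+ k.+2)^-1 < Num.min del 1.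
  pose m := Num.min del 1; have m0 : 0 < m by rewrite lt_min del0 ltr01.
  exists (Num.truncn m^-1) => k kk; rewrite invf_plt ?posrE ?exprn_gt0//.
  apply: (lt_le_trans (truncnS_gt _)); rewrite -natrX ler_nat.
  apply: (leq_ltn_trans kk); apply: (leq_trans (ltn_expl k (isT : (1 < 2)%N))).
  by rewrite leq_exp2l//; exact: leqW (leqnSn k).
apply: (@half_mass_bounded _ v bv pv hv 1 sg (16 + 4 * M) k0) => //; first by rewrite /sg; lra.
move=> k /hk0; set d := (2 ^+ k.+2)^-1; rewrite lt_min => /andP[ddel d1].
have d0 : 0 < d by rewrite invr_gt0 exprn_gt0.
have L0 : 0 < ln d^-1 by rewrite ln_gt0// invf_gt1.
have := sW d (hdel d _); rewrite d0 ddel => /(_ isT) h.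
have Nlt : (N d < (d `^ (- s0) + 1)%:E)%E.
  have N0 : (0 <= N d)%E by apply: le_ereal_inf_tmp => _ [n _ <-]; rewrite lee_fin.
  move: h N0; case: (N d) => [r| |]//= => [h r0|].
    rewrite lte_fin; case: (leP r 0) h => [r00 _|r00].
      by rewrite (le_lt_trans r00)// ltr_wpDl ?powR_ge0.
    rewrite -EFinM lee_fin ler_pdivrMr// => h; rewrite (@le_lt_trans _ _ (d `^ (- s0)))//.
      rewrite -ler_ln ?posrE ?powR_gt0// ln_powR (le_trans h)//.
      by rewrite lnV ?posrE// mulrN mulNr.
    by rewrite ltrDl.
  by rewrite mulyr gtr0_sg ?invr_gt0// mul1e leye_eq.
have [_ [n [c cov] <-] nlt] := ereal_inf_lt Nlt.
rewrite lte_fin in nlt.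
apply: (le_trans (cover_L1_increment cv d0 (ltW d1) bv hM cov)).
have dsg : d <= d `^ sg.
  rewrite -{1}[d]powRr1 ?(ltW d0)//; apply: ger_powR; first by rewrite d0 ltW.
  by rewrite /sg; lra.
have dd : d ^+ 2 <= d by rewrite expr2 ger_pMl// ltW.
have nd : n%:R * d ^+ 2 <= d `^ sg + d ^+ 2.
  apply: (@le_trans _ _ ((d `^ (- s0) + 1) * d ^+ 2)).
    by rewrite ler_wpM2r ?sqr_ge0// ltW.
  rewrite mulrDl mul1r lerD2r -powR_mulrn ?(ltW d0)// -powRD ?(gt_eqF d0) ?implybT//.
  by rewrite addrC.
have m1 := ler_wpM2l M0 dsg.
have d2 := le_trans dd dsg.
have b1 : 8 * (n%:R * d ^+ 2) <= 16 * d `^ sg.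
  apply: (le_trans (ler_wpM2l (ler0n _ 8) nd)).
  by move: (d `^ sg) (d ^+ 2) d2 => y z d2; lra.
rewrite [leRHS]mulrDl; apply: lerD => //.
by have := ler_wpM2l (ler0n R 4) m1; rewrite !mulrA.
Qed.

End graph_dimension.

(** * Positivity of the logarithmic rate *)

Lemma measurable_periodic (R : realType) (f : R -> R) : periodic f 1 ->
  measurable_fun `[(0 : R), 1] f -> measurable_fun [set: R] f.
Proof.
move=> pf mf.
have mI := @measurable_itv01 R.
have mr := (measurable_restrictT f mI).1 mf.
pose fr (x : R) : R := x - (Num.floor x)%:~R.
have mfloor : measurable_fun [set: R] (fun x : R => (Num.floor x)%:~R : R).
  apply: nondecreasing_measurable => //.
  by move=> x y xy; rewrite ler_int; exact: le_floor.
have mfr : measurable_fun [set: R] fr by exact: measurable_funB.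
rewrite (_ : f = (f \_ `[(0 : R), 1]) \o fr); first exact: measurableT_comp mr mfr.
apply/funext => x /=; rewrite patchE.
have /andP[f0 f1] := frac_itv x.
rewrite mem_set; first by rewrite /fr periodic_frac.
by rewrite /= in_itv/= f0 ltW.
Qed.

Section positivity.
Variable R : realType.
Variables (g T : R -> R) (V : R).
Hypothesis pg : periodic g 1.
Hypothesis gT : variation_majorant g T V.
Hypothesis g_jump : jump_points g !=set0.
Let bg : bounded_mfun g := bv_bounded_mfun pg gT.

(** A jump contributes to the increments of [g] at all small scales, so that
    [g] cannot vanish almost everywhere. *)
Lemma kappa_gt0 : 0 < kappa g.
Proof.
have [x0 [x01 jx0]] := g_jump.
have [Joo hJ] := sqr_modulus_cvg pg gT; set J := fine _ in hJ.
have Jfin : (\esum_(x in jump_points g) (`|jump g x| ^+ 2)%:E)%E \is a fin_num.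
  by rewrite ge0_fin_numE// esum_ge0// => x _; rewrite lee_fin sqr_ge0.
have J0 : 0 < J.
  apply: (@lt_le_trans _ _ (`|jump g x0| ^+ 2)); first by rewrite exprn_gt0// normr_gt0.
  rewrite -lee_fin /J fineK//; apply: esum_ge; exists [set x0].
    by split; [exact: finite_set1|move=> x ->].
  by rewrite fsbig_set1.
rewrite /kappa -/J -/(torus_integral (fun x => g x ^+ 2)).
rewrite divr_gt0//; last by rewrite mulr_gt0// exprn_gt0// pi_gt0.
rewrite mulr_gt0// lt_neqAle eq_sym torus_integral_ge0 ?andbT//; last first.
  by move=> x; exact: sqr_ge0.
apply/negP => /eqP B0.
have J2 : 0 < J / 2 by rewrite divr_gt0.
have [h0 h00 /(_ (h0 / 2))] := hJ _ J2.
rewrite divr_gt0// (_ : h0 / 2 < h0); last by lra.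
move=> /(_ isT).
have -> : sqr_modulus g (h0 / 2) = 0.
  have bs := bounded_mfun_shift (- (h0 / 2)) bg.
  apply/eqP; rewrite eq_le; apply/andP; split; last first.
    by apply: torus_integral_ge0 => x; exact: sqr_ge0.
  apply: (@le_trans _ _ (torus_integral (fun x => 2 * g x ^+ 2 + 2 * g (x - h0 / 2) ^+ 2))).
    apply: le_torus_integral.
    - by apply: bounded_mfunX; exact: bounded_mfunB.
    - by apply: bounded_mfunD; apply: bounded_mfunZ; exact: bounded_mfunX.
    - move=> x _; move: (g x) (g (x - h0 / 2)) => p q; rewrite -subr_ge0.
      by rewrite (_ : _ - _ = (p + q) ^+ 2); [exact: sqr_ge0|ring].
  rewrite torus_integralD ?torus_integralZ; try exact: bounded_mfunX.
  - have pg2 : periodic (fun x => g x ^+ 2) 1 by move=> x; rewrite pg.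
    rewrite (@torus_integral_shift _ (- (h0 / 2)) (fun x => g x ^+ 2))//.
      by rewrite B0 mulr0 addr0.
    exact: bounded_mfunX.
  - by apply: bounded_mfunZ; exact: bounded_mfunX.
  - by apply: bounded_mfunZ; exact: bounded_mfunX.
rewrite sub0r normrN ger0_norm; last by rewrite mulr_ge0 ?divr_ge0// ltW.
rewrite mulrC ler_pM2r ?divr_gt0//; lra.
Qed.

End positivity.

Theorem theorem47 (R : realType) (g : R -> R) (u : R -> R -> R[i])
    (g_periodic : periodic g 1)
    (g_bv : bounded_variation 0 1 g)
    (g_jump : jump_points g !=set0)
    (u_evolution : schrodinger_evolution g u) :
  let P := uniform_prob (@ltr01 R) in
  let Y := critical_mass u in
  [/\ exists eps : nat -> R,
        eps @ \oo --> 0 /\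
        \forall M \near \oo,
          ('E_P[Y M] = ((kappa g + eps M) * ln M%:R)%:E)%E,
      exists C : R,
        \forall M \near \oo,
          ('V_P[Y M] <= (C * ln M%:R)%:E)%E,
      {ae @lebesgue_measure R, forall t,
        Y M t / ln M%:R @[M --> \oo] --> kappa g},
      {ae @lebesgue_measure R, forall t, ~ in_sobolev (1 / 2) (density u t)} &
      {ae @lebesgue_measure R, forall t,
        (exists v : R -> R,
          [/\ continuous v,
              {ae @lebesgue_measure R, forall x, density u t x = v x},
              forall eps : R, 0 < eps < 1 / 2 -> in_hoelder (1 / 2 - eps) v &
              upper_box_dim (torus_graph v) = (3 / 2)%:E]) /\
        (forall sigma : R, 1 / 2 < sigma ->
          ~ in_besov_1oo sigma (density u t))}].
Proof.
move=> P Y; have [T [V gT]] := variation_majorant_exists g_periodic g_bv.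
have kp := kappa_gt0 g_periodic gT g_jump.
have Ylog := ae_critical_mass_log_asymp g_periodic gT u_evolution.
have unbounded (t : R) : log_asymp (critical_mass u ^~ t) (kappa g) ->
    ~ (exists K : R, forall M, half_mass (density u t) M <= K).
  by move=> h [K hK]; exact: (log_asymp_unbounded kp h hK).
split.
- exact: (expectation_asymptotics g_periodic gT u_evolution).
- exact: (variance_asymptotics g_periodic gT u_evolution).
- move: Ylog; apply: (@filterS _ _ (ae_filter_ringOfSetsType _)) => t ht.
  exact: (@log_asymp_cvg _ _ _ ht).
- move: Ylog; apply: (@filterS _ _ (ae_filter_ringOfSetsType _)) => t ht.
  by move=> /half_mass_le_sobolev; exact: unbounded.
have regular := @ae_weyl_regular R.
move: Ylog regular; apply: (@filterS2 _ _ (ae_filter_ringOfSetsType _)) => t ht wt.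
have [v [bv pv uv hv]] := density_hoelder_version g_periodic gT u_evolution wt.
have iu := integrable_density u_evolution t.
have iv := @bounded_mfun_integrable _ v 0 1 bv.
have massE M : half_mass (density u t) M = half_mass v M.
  by apply: eq_bigr => m _; rewrite (ae_eq_fourier_coef m iu iv uv).
have vunb : ~ (exists K : R, forall M, half_mass v M <= K).
  by move=> [K hK]; apply: (unbounded t ht); exists K => M; rewrite massE.
have cv : continuous v.
  have [|C hC] := hv 4^-1; first by apply/andP; split; lra.
  by apply: hoelder_continuous hC; rewrite invr_gt0.
split.
  exists v; split => //.
  - move=> eps /andP[e0 e1]; split => //; have [|C hC] := hv (1 / 2 - eps).
      by apply/andP; split; lra.
    by exists C.
  - apply/eqP; rewrite eq_le (upper_box_dim_graph_le hv).
    exact: upper_box_dim_graph_ge cv bv pv hv vunb.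
move=> sigma sg [pd idn [C hC]]; apply: vunb.
set r := (Num.truncn sigma).+1 in hC.
apply: (@half_mass_bounded _ v bv pv hv r sigma C 0%N) => //; first by lra.
move=> k _; set h := (2 ^+ k.+2)^-1.
have h0 : 0 < h by rewrite invr_gt0 exprn_gt0.
have bI := bounded_mfun_iter_difference r h bv.
have := hC h; rewrite (ger0_norm (ltW h0)) -lee_fin; apply: le_trans.
rewrite -torus_integralE; last exact: bounded_mfun_norm.
rewrite le_eqVlt; apply/orP; left; apply/eqP.
have mden : measurable_fun [set: R] (density u t).
  apply: measurable_periodic => //.
  by have /integrableP[/measurable_EFinP] := iu.
have mI := @measurable_itv01 R.
apply: ae_eq_integral => //.
- apply/measurable_EFinP; apply: measurable_funS measurableT (@subsetT _ _) _.
  exact: (bounded_mfun_norm bI).1.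
- apply/measurable_EFinP; apply: measurable_funS measurableT (@subsetT _ _) _.
  apply: measurableT_comp => //; apply: measurable_sum => k'.
  apply: measurable_funM => //; apply: (@measurableT_comp _ _ _ _ _ _ (density u t)) => //.
  exact: measurable_funD.
have uvk : {ae @lebesgue_measure R, forall x, forall j : nat,
    density u t (x + j%:R * h) = v (x + j%:R * h)}.
  apply/ae_foralln => j.
  exact: (@ae_shift _ (fun x => density u t x = v x) (j%:R * h)).
move: uvk; apply: (@filterS _ _ (ae_filter_ringOfSetsType _)) => x hx _.
congr (`|_|%:E); apply: eq_bigr => j _; by rewrite hx.
Qed.
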